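(* Let $f:(\mathbb C^d,0)\to(\mathbb C^d,0)$ be a contracting rigid holomorphic germ. Let $s$ be the number of non-zero eigenvalues of $df_0$ (with multiplicity), $r$ the number of periodic and $p$ the number of non-periodic irreducible components of $\mathrm{Crit}^\infty(f)$, and $e=s-r$. Then $f$ is analytically conjugate to a germ of the form $$(u,v,y,z)\mapsto\Big(\alpha\,u^{B},\ \mu v+\rho(u,v),\ \beta\,u^{C}y^{D}\big(\mathbf 1+g(u,v,y,z)\big),\ h(u,v,y,z)\Big),$$ with $(u,v,y,z)\in\mathbb C^r\times\mathbb C^e\times\mathbb C^p\times\mathbb C^{d-(s+p)}$, where: - $\alpha\in(\mathbb C^* )^r$, $\mu=(\mu^1,\dots,\mu^e)\in(\mathbb D^* )^e$ consists of non-zero eigenvalues of $df_0$, $\beta\in(\mathbb C^* )^p$; - $B\in M_{r\times r}(\mathbb N)$ is a permutation matrix, $C\in M_{r\times p}(\mathbb N)$, $D\in M_{p\times p}(\mathbb N)$; - $\rho:(\mathbb C^s,0)\to(\mathbb C^e,0)$, $g:(\mathbb C^d,0)\to(\mathbb C^p,0)$, $h:(\mathbb C^d,0)\to(\mathbb C^{d-(s+p)},0)$ are holomorphic; - $\mathrm{Crit}^\infty(f)=\{u^{\mathbf 1}y^{\mathbf 1}=0\}$; - the linear part of $z\mapsto h(0,0,0,z)$ is nilpotent; - $\rho=(\rho^1,\dots,\rho^e)$ is a polynomial map and, for each $k$, $\rho^k$ contains only monomials $u^{n_u}v^{n_v}$ ($(n_u,n_v)\in\mathbb N^r\times\mathbb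 N^e$) that are primary resonant for the $k$-th coordinate of $v$, i.e. satisfy $\xi^{n_u}\mu^{\eta n_v}=(\mu^k)^\eta$, where $\eta\ge1$ is the order of the permutation matrix $B$ and $\xi\in(\mathbb D^* )^r$ is defined by $(u\mapsto\alpha u^B)^{\circ\eta}(u)=\xi u$.
   Context: A holomorphic germ $f:(\mathbb C^d,0)\to(\mathbb C^d,0)$ is contracting if every eigenvalue of $df_0$ has modulus $<1$. $\mathrm{Crit}(f)=\{\det df=0\}$, $\mathrm{Crit}^\infty(f)=\bigcup_{n\ge0}f^{-n}(\mathrm{Crit}(f))$ (germ at $0$). $f$ is rigid if $\mathrm{Crit}^\infty(f)$ is a union of finitely many smooth irreducible hypersurface germs $W^1,\dots,W^q$ through $0$ meeting transversally. Writing $f^*W^k=\sum_la^k_lW^l$ ($a^k_l\in\mathbb N$), $W^k$ is periodic if $(f^* )^\eta W^k=W^k$ for some $\eta\ge1$. $\mathbb D^*$ is the punctured unit disc. Notation: for $x\in\mathbb C^s$, $n\in\mathbb N^s$: $x^n=\prod_i(x^i)^{n_i}$, and $\mu^{\eta n}=\prod_i(\mu^i)^{\eta n_i}$. For $E=(e^k_l)\in M_{s\times p}(\mathbb N)$ ($l$ row, $k$ column), $x^E\in\mathbb C^p$ has $k$-th coordinate $\prod_l(x^l)^{e^k_l}$. Products of vectors (e.g. $\mu v$, $\alpha u^B$, $\xi u$) are coordinatewise; $\mathbf 1=(1,\dots,1)$, $x^{\mathbf 1}=\prod_ix^i$. Since $B$ is a permutation matrix, $u\mapsto\alpha u^B$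 has coordinates $\alpha^iu^{\pi(i)}$ for a permutation $\pi$, and its $\eta$-th iterate is a diagonal map $u\mapsto\xi u$. *)

(* Defs.v *)
From HB Require Import structures.
From mathcomp Require Import all_boot all_order all_algebra all_fingroup.
From mathcomp Require Import complex.
From mathcomp Require Import all_classical all_reals all_analysis.
Import numFieldNormedType.Exports.
Set Implicit Arguments.
Unset Strict Implicit.
Unset Printing Implicit Defensive.
Import Order.TTheory GRing.Theory Num.Theory.
Local Open Scope ring_scope.

(* The complex numbers, packaged as a numClosedFieldType so that the
   normed-space structures of mathcomp-analysis are found on it and on
   'rV[CC R]_n (sup norm), with scalar field CC R: differentiability below
   is complex (C-linear Frechet) differentiability. *)
Definition CC (R : realType) : numClosedFieldType := (R[i] : numClosedFieldType).

Section Defs.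
Variable R : realType.
Local Notation C := (CC R).

Definition holo_germ {n : nat} {V : normedModType C} (F : 'rV[C]_n -> V) : Prop :=
  \forall x \near (0 : 'rV[C]_n), differentiable F x.

(* the Jacobian matrix of F at x (acting on row vectors: v *m M = dF_x v) *)
Definition jac {n m : nat} (F : 'rV[C]_n -> 'rV[C]_m) (x : 'rV[C]_n) : 'M[C]_(n, m) :=
  lin1_mx ('d F x).

Definition contracting {d : nat} (f : 'rV[C]_d -> 'rV[C]_d) : Prop :=
  f 0 = 0 /\ holo_germ f /\
  forall lam : C, root (char_poly (jac f 0)) lam -> `|lam| < 1.

Definition in_crit {d : nat} (f : 'rV[C]_d -> 'rV[C]_d) (x : 'rV[C]_d) : Prop :=
  \det (jac f x) = 0.

Definition in_crit_inf {d : nat} (f : 'rV[C]_d -> 'rV[C]_d) (x : 'rV[C]_d) : Prop :=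
  exists n : nat, in_crit f (iter n f x).

(* W^1,...,W^q = {phi_k = 0} are smooth hypersurface germs through 0 meeting
   transversally: phi_k holomorphic, phi_k(0) = 0, and the differentials
   d(phi_k)_0 are linearly independent (in particular non-zero). *)
Definition transversal_smooth_hypersurfaces {d q : nat}
    (phi : 'I_q -> 'rV[C]_d -> C) : Prop :=
  (forall k, holo_germ (phi k) /\ phi k 0 = 0) /\
  (forall c : 'I_q -> C,
      (forall v : 'rV[C]_d, \sum_(k < q) c k * 'd (phi k) 0 v = 0) ->
      forall k, c k = 0).

Definition rigid_with {d q : nat} (f : 'rV[C]_d -> 'rV[C]_d)
    (phi : 'I_q -> 'rV[C]_d -> C) : Prop :=
  transversal_smooth_hypersurfaces phi /\
  \forall x \near (0 : 'rV[C]_d), (in_crit_inf f x <-> exists k, phi k x = 0).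

Definition germ_dvd {d : nat} (a b : 'rV[C]_d -> C) : Prop :=
  exists c : 'rV[C]_d -> C, holo_germ c /\
    \forall x \near (0 : 'rV[C]_d), b x = a x * c x.

(* A = (a^k_l) is the matrix of f^star : f^star W^k = sum_l a^k_l W^l, where
   a^k_l is the vanishing order of phi_k o f along W^l = {phi_l = 0}. *)
Definition pullback_matrix {d q : nat} (f : 'rV[C]_d -> 'rV[C]_d)
    (phi : 'I_q -> 'rV[C]_d -> C) (A : 'I_q -> 'I_q -> nat) : Prop :=
  forall k l,
    germ_dvd (fun x => phi l x ^+ A k l) (phi k \o f) /\
    ~ germ_dvd (fun x => phi l x ^+ (A k l).+1) (phi k \o f).

End Defs.

(* action of f^star on divisors sum_k v_k W^k (coefficient vectors in N^q) *)
Definition pull_div {q : nat} (A : 'I_q -> 'I_q -> nat) (v : 'I_q -> nat) : 'I_q -> nat :=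
  fun l => (\sum_(k < q) v k * A k l)%N.

Definition div_unit {q : nat} (k : 'I_q) : 'I_q -> nat := fun l => nat_of_bool (l == k).

Definition periodic_comp {q : nat} (A : 'I_q -> 'I_q -> nat) (k : 'I_q) : Prop :=
  exists eta : nat, (0 < eta)%N /\
    forall l, iter eta (pull_div A) (div_unit k) l = div_unit k l.

Section NF.
Variable R : realType.
Local Notation C := (CC R).

Definition monom {n : nat} (x : 'rV[C]_n) (m : 'I_n -> nat) : C :=
  \prod_(i < n) x 0 i ^+ m i.

Definition mono_map {a b : nat} (E : 'M[nat]_(a, b)) (x : 'rV[C]_a) : 'rV[C]_b :=
  \row_(k < b) \prod_(l < a) x 0 l ^+ E l k.

Definition hmul {n : nat} (x y : 'rV[C]_n) : 'rV[C]_n := \row_(i < n) (x 0 i * y 0 i).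

(* the permutation matrix of sigma: u^B has k-th coordinate u^(sigma k) *)
Definition perm_natmx {r : nat} (sigma : 'S_r) : 'M[nat]_(r, r) :=
  \matrix_(l < r, k < r) nat_of_bool (sigma k == l).

(* polynomial maps C^r x C^e -> C^e given by finite lists of terms
   (exponent of u, exponent of v, coefficient) for each coordinate *)
Definition poly_term (r e : nat) : Type := (('I_r -> nat) * ('I_e -> nat) * C)%type.

Definition poly_eval {r e : nat} (rho : 'I_e -> seq (poly_term r e))
    (u : 'rV[C]_r) (v : 'rV[C]_e) : 'rV[C]_e :=
  \row_(k < e) \sum_(tm <- rho k) tm.2 * monom u tm.1.1 * monom v tm.1.2.

Definition monom_pow {n : nat} (mu : 'rV[C]_n) (eta : nat) (m : 'I_n -> nat) : C :=
  \prod_(i < n) mu 0 i ^+ (eta * m i).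

Definition blk_u {r e p t : nat} (w : 'rV[C]_(r + e + p + t)) : 'rV[C]_r :=
  lsubmx (lsubmx (lsubmx w)).
Definition blk_v {r e p t : nat} (w : 'rV[C]_(r + e + p + t)) : 'rV[C]_e :=
  rsubmx (lsubmx (lsubmx w)).
Definition blk_y {r e p t : nat} (w : 'rV[C]_(r + e + p + t)) : 'rV[C]_p :=
  rsubmx (lsubmx w).
Definition blk_z {r e p t : nat} (w : 'rV[C]_(r + e + p + t)) : 'rV[C]_t :=
  rsubmx w.

Definition normal_form {r e p t : nat}
    (alpha : 'rV[C]_r) (B : 'M[nat]_(r, r)) (mu : 'rV[C]_e)
    (rho : 'I_e -> seq (poly_term r e)) (beta : 'rV[C]_p)
    (Cm : 'M[nat]_(r, p)) (Dm : 'M[nat]_(p, p))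
    (g : 'rV[C]_(r + e + p + t) -> 'rV[C]_p)
    (h : 'rV[C]_(r + e + p + t) -> 'rV[C]_t)
    (w : 'rV[C]_(r + e + p + t)) : 'rV[C]_(r + e + p + t) :=
  let u := blk_u w in let v := blk_v w in let y := blk_y w in
  row_mx (row_mx (row_mx
    (hmul alpha (mono_map B u))
    (hmul mu v + poly_eval rho u v))
    (hmul (hmul beta (mono_map Cm u))
          (hmul (mono_map Dm y) (const_mx 1 + g w))))
    (h w).

Definition biholo_germ {n m : nat} (Phi : 'rV[C]_n -> 'rV[C]_m) : Prop :=
  Phi 0 = 0 /\ holo_germ Phi /\
  exists Psi : 'rV[C]_m -> 'rV[C]_n,
    Psi 0 = 0 /\ holo_germ Psi /\
    (\forall x \near (0 : 'rV[C]_n), Psi (Phi x) = x) /\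
    (\forall y \near (0 : 'rV[C]_m), Phi (Psi y) = y).

End NF.

(* Main.v *)
Require Import Defs.
From HB Require Import structures.
From mathcomp Require Import all_boot all_order all_algebra all_fingroup.
From mathcomp Require Import complex.
From mathcomp Require Import all_classical all_reals all_analysis.
From mathcomp Require Import ring lra.
Import numFieldNormedType.Exports.
Import Order.TTheory GRing.Theory Num.Theory.
Set Implicit Arguments.
Unset Strict Implicit.
Unset Printing Implicit Defensive.
Local Open Scope ring_scope.

(* The pullback of f by itself splits the coordinates into four groups.
   - For a periodic component, phi_k o f = c_k phi_(sigma k) with c_k(0) <> 0.  The cohomological equation
     a_(sigma k) = (c_k / c_k(0)) (a_k o f), a_k(0) = 1, is solved by iterating the contraction f, and
     u_k = a_k phi_k satisfies u o f = alpha u^B.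
   - Let F = f^eta, so that u o F = xi u.  On germs of order M the operator F^* - l is invertible as soon as
     th^M < |l|, where th < 1 is the contraction rate; hence a generalized eigenvector of the cotangent map
     with eigenvalue mu <> 0 lifts to a germ v killed by a power of F^* - mu^eta.  Comparing leading forms,
     every germ in that generalized eigenspace is a finite combination of the monomials in u and v of weight
     mu^eta.  Since f^* commutes with F^*, this applies to v o f - mu v and yields rho: no
     Poincare-Dulac iteration is needed.
   - The remaining phi_j are the coordinates y; dividing phi_j o f by the monomial in u and y given by the
     divisor f^* W^j leaves a unit.
   - The z are arbitrary linear forms.  A power of the cotangent map sends all forms into the span of du and dv,
     because the differentials of the non-periodic phi_j end up in the span of the periodic ones; this is the
     nilpotency on {u = v = y = 0}, and it also shows that du, dv, dy are independent. *)

(** The analysis starts from complex differentiability near 0 alone. Cauchy estimates come from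
    Goursat's subdivision argument on finite Riemann sums, and every limit is geometric, so no
    integral is formed. Power series are avoided too: germs are handled through [ord], a growth
    bound at 0, and [hom], homogeneous polynomials. Two obstacles shape the rest. Dividing
    [phi_k o f] by a monomial must leave a unit, although only its divisor is given: in a chart
    where the [W^l] are coordinate hyperplanes, a non-unit whose zeros lie in their union vanishes
    on one of them, against the maximality of the exponents. The identity [s = r + e] comes from the
    characteristic polynomial, recorded while the [du] are extended to a basis of generalized
    eigenvectors. *)

Section RealNorm.
Variable R : realType.
Local Notation C := (CC R).

(* The norm of a normed module over [C] takes its values in [C]; [nm] is the real-valued one. *)
Definition nm {V : normedModType C} (x : V) : R := complex.Re `|x|.

Lemma nmE (V : normedModType C) (x : V) : `|x| = ((nm x)%:C)%C.
Proof.
rewrite /nm; have := normr_ge0 x; case: `|x| => a b.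
by rewrite lecE /= => /andP[/eqP -> _].
Qed.

Lemma nm_ge0 (V : normedModType C) (x : V) : 0 <= nm x.
Proof. by rewrite -lecR -nmE normr_ge0. Qed.

Lemma le_nm (V W : normedModType C) (x : V) (y : W) :
  (`|x| <= `|y|) = (nm x <= nm y).
Proof. by rewrite !nmE lecR. Qed.

Lemma nm0 (V : normedModType C) : nm (0 : V) = 0.
Proof. by rewrite /nm normr0. Qed.

Lemma nm0_eq0 (V : normedModType C) (x : V) : nm x <= 0 -> x = 0.
Proof. by rewrite -lecR -nmE normr_le0 => /eqP. Qed.

Lemma nm_gt0 (V : normedModType C) (x : V) : (0 < nm x) = (x != 0).
Proof. by rewrite -ltcR -nmE normr_gt0. Qed.

Lemma nmN (V : normedModType C) (x : V) : nm (- x) = nm x.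
Proof. by rewrite /nm normrN. Qed.

Lemma nmD (V : normedModType C) (x y : V) : nm (x + y) <= nm x + nm y.
Proof. by rewrite -lecR rmorphD /= -!nmE ler_normD. Qed.

Lemma nmB (V : normedModType C) (x y : V) : nm (x - y) <= nm x + nm y.
Proof. by rewrite -[nm y]nmN nmD. Qed.

Lemma nmBC (V : normedModType C) (x y : V) : nm (x - y) = nm (y - x).
Proof. by rewrite -nmN opprB. Qed.

Lemma nmDl (V : normedModType C) (x y : V) : nm x - nm y <= nm (x + y).
Proof. by have := nmB (x + y) y; rewrite addrK; lra. Qed.

Lemma nmBl (V : normedModType C) (x y : V) : nm x - nm y <= nm (x - y).
Proof. by rewrite -[nm y]nmN nmDl. Qed.

Lemma nmZ (V : normedModType C) (a : C) (x : V) : nm (a *: x) = nm a * nm x.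
Proof.
by apply/complexI; rewrite rmorphM /= -!nmE normrZ.
Qed.

Lemma nmM (a b : C) : nm (a * b) = nm a * nm b.
Proof. exact: (nmZ (a : C) (b : C^o)). Qed.

Lemma nm1 : nm (1 : C) = 1.
Proof. by rewrite /nm normr1. Qed.

Lemma nmX (a : C) n : nm (a ^+ n) = nm a ^+ n.
Proof. by elim: n => [|n IH]; rewrite ?expr0 ?nm1 // !exprS nmM IH. Qed.

Lemma nmV (a : C) : nm (a^-1) = (nm a)^-1.
Proof.
have [->|a0] := eqVneq a 0; first by rewrite invr0 nm0 invr0.
have na : nm a != 0 by rewrite gt_eqF // nm_gt0.
by apply: (mulfI na); rewrite -nmM !divff // nm1.
Qed.

Lemma nm_real (a : R) : 0 <= a -> nm ((a%:C)%C : C) = a.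
Proof. by move=> a0; rewrite /nm ger0_norm // lecR. Qed.

Lemma nm_realabs (a : R) : nm ((a%:C)%C : C) = `|a|.
Proof.
have [a0|a0] := leP 0 a; first by rewrite nm_real // ger0_norm.
rewrite -nmN -rmorphN /= nm_real; last by lra.
by rewrite ltr0_norm.
Qed.

Lemma nm_i : nm ('i%C : C) = 1.
Proof.
have : nm ('i%C : C) ^+ 2 = 1.
  by rewrite -nmX sqr_i nmN nm1.
move=> /eqP; rewrite sqrf_eq1 => /orP[/eqP //|/eqP h].
by have := nm_ge0 ('i%C : C); rewrite h; lra.
Qed.

Lemma nm_sum (V : normedModType C) (I : finType) (F : I -> V) :
  nm (\sum_i F i) <= \sum_i nm (F i).
Proof.
apply: (big_ind2 (fun a b => nm a <= b)) => //; first by rewrite nm0.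
by move=> a b c d ab cd; apply: (le_trans (nmD _ _)); apply: lerD.
Qed.

Lemma nm_Re (z : C) : `|complex.Re z| <= nm z.
Proof.
rewrite /nm; case: z => a b; rewrite normc_def /= -sqrtr_sqr.
by apply: ler_wsqrtr; rewrite lerDl sqr_ge0.
Qed.

Lemma nm_Im (z : C) : `|complex.Im z| <= nm z.
Proof.
rewrite /nm; case: z => a b; rewrite normc_def /= -sqrtr_sqr.
by apply: ler_wsqrtr; rewrite lerDr sqr_ge0.
Qed.

Lemma nm_ReIm (z : C) : nm z <= `|complex.Re z| + `|complex.Im z|.
Proof.
rewrite [z in nm z]complexE; apply: (le_trans (nmD _ _)).
by rewrite nmM nm_i mul1r !nm_realabs.
Qed.

Lemma nm_coord n (x : 'rV[C]_n) i : nm (x 0 i) <= nm x.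
Proof.
rewrite -le_nm [leRHS]/Num.norm /= mx_normE.
by rewrite -[leLHS]nngE num_le; exact: (le_bigmax _ _ (ord0, i)).
Qed.

Lemma nm_rv_le n (x : 'rV[C]_n) (B : R) :
  0 <= B -> (forall i, nm (x 0 i) <= B) -> nm x <= B.
Proof.
move=> B0 h; have [-> | xn0] := eqVneq x 0; first by rewrite nm0.
have : mx_norm x != 0 by rewrite -[mx_norm x]/(`|x|) normr_eq0.
move=> /mx_norm_neq0[[i j]] /=; rewrite (ord1 i) => e.
by move: (h j); rewrite -[X in X <= B -> _]/(complex.Re `|x 0 j|) -e.
Qed.

(** Radii of balls live in the scalar field [C], but a positive element of [C] is real, so real
    radii describe the same neighbourhoods. *)
Lemma near0P (V : normedModType C) (P : V -> Prop) :
  (\forall x \near (0 : V), P x) <->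
  exists2 r : R, 0 < r & forall x, nm x < r -> P x.
Proof.
split=> [/nbhs_ballP[e /= e0 h] | [r r0 h]].
  exists (complex.Re e).
    by move: e0; rewrite /= ltcE /= => /andP[].
  move=> x xr; apply: h; rewrite -ball_normE /= sub0r normrN nmE.
  by move: e0; case: (e) xr => a b; rewrite /= !ltcE /= => xr /andP[/eqP -> _];
    rewrite eqxx.
apply/nbhs_ballP; exists ((r%:C)%C) => /=; first by rewrite ltcR.
move=> x; rewrite -ball_normE /= sub0r normrN nmE ltcR.
exact: h.
Qed.

Lemma nearxP (V : normedModType C) (a : V) (P : V -> Prop) :
  (\forall x \near a, P x) <->
  exists2 r : R, 0 < r & forall x, nm (x - a) < r -> P x.
Proof.
rewrite [X in X <-> _](near_shift 0); split.
  move=> /near0P[r r0 h]; exists r => // x xr.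
  by have := h _ xr; rewrite /= subr0 subrK.
move=> [r r0 h]; apply/near0P; exists r => // x xr.
by apply: h; rewrite /= subr0 addrK.
Qed.

Lemma continuous_nmP (V W : normedModType C) (f : V -> W) a :
  {for a, continuous f} <-> forall e : R, 0 < e ->
    exists2 r : R, 0 < r & forall x, nm (x - a) < r -> nm (f x - f a) < e.
Proof.
split=> [/cvgrPdist_lt h e e0|h].
  have /h/nearxP[r r0 hr] : 0 < ((e%:C)%C : C) by rewrite ltcR.
  exists r => // x xr; have := hr x xr.
  by rewrite nmE ltcR nmBC.
apply/cvgrPdist_lt => e e0.
have e0' : 0 < complex.Re e by move: e0; rewrite ltcE /= => /andP[].
have [r r0 hr] := h _ e0'; apply/nearxP; exists r => // x xr.
rewrite nmE nmBC; move: (hr x xr) e0; case: (e) => u v /=.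
by rewrite !ltcE /= => ? /andP[/eqP -> _]; rewrite eqxx.
Qed.

Lemma differentiable_nm (V W : normedModType C) (f : V -> W) x :
  differentiable f x -> forall e : R, 0 < e ->
  exists2 r : R, 0 < r & forall h, nm h < r ->
    nm (f (x + h) - f x - 'd f x h) <= e * nm h.
Proof.
move=> /diff_locally /eqaddoP h e e0.
have /h : 0 < ((e%:C)%C : C) by rewrite ltcR.
move=> /near0P[r r0 hr]; exists r => // k kr.
have := hr k kr; rewrite !nmE /= -rmorphM lecR /=.
set X := (X in nm X); set Y := (X in _ -> nm X <= _).
by suff -> : X = Y by []; rewrite /X /Y [x + k]addrC opprD addrA.
Qed.

Lemma nm_differentiable (V W : normedModType C) (f : V -> W) (D : {linear V -> W}) x :
  continuous D ->
  (forall e : R, 0 < e -> exists2 r : R, 0 < r & forall h, nm h < r ->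
    nm (f (x + h) - f x - D h) <= e * nm h) ->
  differentiable f x /\ 'd f x = D :> (V -> W).
Proof.
move=> Dc h.
have E : f \o shift x = cst (f x) + D +o_ 0 id.
  apply/eqaddoP => e e0.
  have e0' : 0 < complex.Re e by move: e0; rewrite ltcE /= => /andP[].
  have [r r0 hr] := h _ e0'; apply/near0P; exists r => // k kr.
  have := hr k kr.
  have -> : e = ((complex.Re e)%:C)%C.
    by move: e0; case: (e) => u v /=; rewrite ltcE /= => /andP[/eqP -> _].
  rewrite !nmE -rmorphM lecR /=.
  set X := (X in nm X); set Y := (X in _ -> nm X <= _).
  by suff -> : X = Y by []; rewrite /X /Y [x + k]addrC opprD addrA.
have Dd := diff_unique Dc E.
split=> //; apply/diff_locallyP; split; first by rewrite Dd.
by rewrite Dd.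
Qed.

Lemma differentiable_near (V W : normedModType C) (f g : V -> W) x :
  (\forall y \near x, f y = g y) -> differentiable f x ->
  differentiable g x /\ 'd g x = 'd f x :> (V -> W).
Proof.
move=> /nearxP[r r0 fg] df.
have [] := @nm_differentiable V W g ('d f x) x.
- exact: diff_continuous.
- move=> e e0; have [r' r0' h] := differentiable_nm df e0.
  exists (Num.min r r') => [|k]; first by rewrite lt_min r0.
  rewrite lt_min => /andP[k1 k2]; rewrite -!fg ?subrr ?nm0 //; first exact: h.
  by rewrite addrC addKr.
by move=> dg E; split; [exact: dg | exact: E].
Qed.

End RealNorm.

(** * Complex analysis in one variable *)

Section OneVariable.
Variable R : realType.
Local Notation C := (CC R).
Local Notation I := ('i%C : C).
Implicit Types (g : C -> C) (a z h : C) (n : nat).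

Lemma nested_intervals (x s : nat -> R) :
  (forall n, 0 <= s n) -> (forall n, x n <= x n.+1) ->
  (forall n, x n.+1 + s n.+1 <= x n + s n) ->
  exists c, forall n, x n <= c <= x n + s n.
Proof.
move=> s0 xi xd.
have mi n k : x n <= x (n + k)%N.
  by elim: k => [|k IH]; rewrite ?addn0 // addnS (le_trans IH).
have md n k : x (n + k)%N + s (n + k)%N <= x n + s n.
  by elim: k => [|k IH]; rewrite ?addn0 // addnS (le_trans (xd _)).
have ub n : ubound (range x) (x n + s n).
  move=> _ [k _ <-]; have [nk|kn] := leqP n k.
    by rewrite -(subnKC nk); have := md n (k - n)%N; have := s0 (n + (k - n))%N; lra.
  have := mi k (n - k)%N; rewrite subnKC; last exact: ltnW.
  by have := s0 n; lra.
have hs : has_sup (range x) by split; [exists (x 0%N), 0%N | exists (x 0%N + s 0%N)].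
exists (sup (range x)) => n; apply/andP; split.
  by apply: (sup_upper_bound hs); exists n.
by apply: ge_sup; [case: hs | exact: ub].
Qed.

Definition sqr_pred a (s : R) z :=
  (complex.Re a <= complex.Re z <= complex.Re a + s) /\
  (complex.Im a <= complex.Im z <= complex.Im a + s).

Definition rc (x : R) : C := (x%:C)%C.

(** Corner of the [(i, j)]-th of the nine squares of a 3 by 3 grid. Subdivision is into thirds
    because a centred square then has a centred subsquare, which isolates a singularity at the
    centre while the other eight squares avoid it. *)
Definition shiftsq a (s : R) (i j : 'I_3) : C :=
  a + rc (s * i%:R) + rc (s * j%:R) * I.

Lemma ReD z w : complex.Re (z + w : C) = complex.Re z + complex.Re w.
Proof. by case: z w => ? ? [? ?]. Qed.
Lemma ImD z w : complex.Im (z + w : C) = complex.Im z + complex.Im w.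
Proof. by case: z w => ? ? [? ?]. Qed.
Lemma ReN z : complex.Re (- z : C) = - complex.Re z.
Proof. by case: z. Qed.
Lemma ImN z : complex.Im (- z : C) = - complex.Im z.
Proof. by case: z. Qed.
Lemma ReM z w : complex.Re (z * w : C) =
  complex.Re z * complex.Re w - complex.Im z * complex.Im w.
Proof. by case: z w => ? ? [? ?]. Qed.
Lemma ImM z w : complex.Im (z * w : C) =
  complex.Re z * complex.Im w + complex.Im z * complex.Re w.
Proof. by case: z w => ? ? [? ?]. Qed.
Lemma ReI : complex.Re I = 0. Proof. by []. Qed.
Lemma ImI : complex.Im I = 1. Proof. by []. Qed.
Lemma Rerc (x : R) : complex.Re (rc x) = x. Proof. by []. Qed.
Lemma Imrc (x : R) : complex.Im (rc x) = 0. Proof. by []. Qed.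
Definition reim := (ReD, ImD, ReN, ImN, ReM, ImM, ReI, ImI, Rerc, Imrc).

(** Compactness of a square in the form used everywhere below: a defect inherited by some subsquare
    persists on arbitrarily small squares around one point [c], where a local estimate refutes
    it. *)
Lemma nested_squares (Bad : C -> R -> Prop) a (s : R) :
  0 < s ->
  (forall b u, 0 < u -> Bad b u ->
     exists i j, Bad (shiftsq b (u / 3) i j) (u / 3)) ->
  Bad a s ->
  exists2 c, sqr_pred a s c & forall e, 0 < e -> exists b u,
    [/\ 0 < u < e, sqr_pred b u c, forall z, sqr_pred b u z -> sqr_pred a s z & Bad b u].
Proof.
move=> s0 step bad0.
(* Carrying positivity and badness inside the type turns dependent choice into plain iteration of
   [nxt]. *)
pose T := {x : C * R | 0 < x.2 /\ Bad x.1 x.2}.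
have nxt (x : T) : {y : T | (exists i j, (sval y).1 = shiftsq (sval x).1 ((sval x).2 / 3) i j
    /\ (sval y).2 = (sval x).2 / 3)}.
  apply: cid; case: x => -[b u] /= [u0 hb].
  have [i [j hij]] := step _ _ u0 hb.
  have u3 : 0 < u / 3 by lra.
  by exists (exist _ (shiftsq b (u / 3) i j, u / 3) (conj u3 hij)); exists i, j.
pose x0 : T := exist _ (a, s) (conj s0 bad0).
pose q n : C * R := sval (iter n (fun x => sval (nxt x)) x0).
have qS n : exists i j, (q n.+1).1 = shiftsq (q n).1 ((q n).2 / 3) i j
    /\ (q n.+1).2 = (q n).2 / 3 by rewrite /q iterS; set X := iter n _ _; case: (nxt X) => y /=.
have q0 n : 0 < (q n).2 by rewrite /q; case: (iter _ _ _) => y /= [].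
have qB n : Bad (q n).1 (q n).2 by rewrite /q; case: (iter _ _ _) => y /= [].
have i3 (i : 'I_3) : 0 <= (i%:R : R) <= 2.
  by rewrite ler0n /=; rewrite -[2]/(2%:R) ler_nat -ltnS.
have [cx hx] : exists c, forall n, complex.Re (q n).1 <= c <= complex.Re (q n).1 + (q n).2.
  apply: nested_intervals => n; first exact: ltW.
  - case: (qS n) => i [j [-> _]]; rewrite /shiftsq !reim.
    by have := i3 i; have := q0 n; nra.
  - case: (qS n) => i [j [-> ->]]; rewrite /shiftsq !reim.
    by have := i3 i; have := q0 n; nra.
have [cy hy] : exists c, forall n, complex.Im (q n).1 <= c <= complex.Im (q n).1 + (q n).2.
  apply: nested_intervals => n; first exact: ltW.
  - case: (qS n) => i [j [-> _]]; rewrite /shiftsq !reim.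
    by have := i3 j; have := q0 n; nra.
  - case: (qS n) => i [j [-> ->]]; rewrite /shiftsq !reim.
    by have := i3 j; have := q0 n; nra.
have qs n : (q n).2 = s / 3 ^+ n.
  elim: n => [|n IH]; first by rewrite expr0 divr1.
  by have [i [j [_ ->]]] := qS n; rewrite IH exprS; field; rewrite expf_neq0.
have sub n z : sqr_pred (q n).1 (q n).2 z -> sqr_pred a s z.
  elim: n => [//|n IH] h; apply: IH; move: h.
  case: (qS n) => i [j [-> ->]]; rewrite /sqr_pred /shiftsq !reim.
  by have := i3 i; have := i3 j; have := q0 n; move=> ? ? ? [/andP[? ?] /andP[? ?]]; split; nra.
pose c : C := (cx +i* cy)%C.
have hc n : sqr_pred (q n).1 (q n).2 c by split; [exact: hx | exact: hy].
exists c; first exact: (hc 0%N).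
move=> e e0; have [n hn] : exists n, s / 3 ^+ n < e.
  exists (Num.bound (s / e)).
  have h3 : (Num.bound (s / e))%:R <= (3 : R) ^+ (Num.bound (s / e)).
    rewrite -natrX ler_nat; exact/ltnW/ltn_expl.
  rewrite ltr_pdivrMr ?exprn_gt0 // mulrC -ltr_pdivrMr //.
  apply: lt_le_trans h3; exact: archi_boundP (ltW (divr_gt0 s0 e0)).
exists (q n).1, (q n).2; split; [by rewrite q0 qs hn | exact: hc | exact: sub | exact: qB].
Qed.

(** Mean value inequality by trisection: an excessive increment on an interval forces one on some
    third of it, and at the limit point this contradicts the bound on the derivative. Only the real
    parts of the nested squares matter. *)
Lemma path_lipschitz (p D : R -> C) (L : R) :
  0 <= L ->
  (forall t, 0 <= t <= 1 -> nm (D t) <= L) ->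
  (forall t, 0 <= t <= 1 -> forall e, 0 < e -> exists2 r, 0 < r & forall u,
     `|u - t| < r -> nm (p u - p t - rc (u - t) * D t) <= e * `|u - t|) ->
  nm (p 1 - p 0) <= L.
Proof.
move=> L0 DL pD; rewrite leNgt; apply/negP => hL.
(* A slope strictly between [L] and the actual increment: the gap [L' - L] is the room left for the
   error of differentiability. *)
pose L' := (L + nm (p 1 - p 0)) / 2.
have LL' : L < L' by rewrite /L'; lra.
pose Bad b u := L' * u < nm (p (complex.Re b + u) - p (complex.Re b)).
have bad0 : Bad 0 1 by rewrite /Bad /= add0r mulr1 /L'; lra.
have step b u : 0 < u -> Bad b u ->
    exists i j, Bad (shiftsq b (u / 3) i j) (u / 3).
  move=> u0 hb; apply: contrapT => H.
  have K (i : 'I_3) : nm (p (complex.Re b + u / 3 * i%:R + u / 3)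
      - p (complex.Re b + u / 3 * i%:R)) <= L' * (u / 3).
    rewrite leNgt; apply/negP => hi; apply: H; exists i, ord0.
    by rewrite /Bad /shiftsq !reim /= !mulr0 !mulr1 subrr addr0.
  move: hb; rewrite /Bad; apply/negP; rewrite -leNgt.
  have := K (inord 0); have := K (inord 1); have := K (inord 2).
  rewrite !inordK // mulr0 addr0 mulr1.
  set b0 := complex.Re b; set p1 := p (b0 + u / 3).
  have -> : b0 + u / 3 * 2 + u / 3 = b0 + u by field.
  have -> : b0 + u / 3 + u / 3 = b0 + u / 3 * 2 by field.
  set p2 := p (b0 + _ * 2) => h2 h1 h0.
  have -> : p (b0 + u) - p b0 = (p (b0 + u) - p2) + (p2 - p1) + (p1 - p b0).
    by ring.
  by apply: le_trans (nmD _ _) _; have := nmD (p (b0 + u) - p2) (p2 - p1); lra.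
have [c [hc _] hn] := nested_squares ltr01 step bad0.
move: hc; rewrite /= add0r => hc.
pose t := complex.Re c.
have e0 : 0 < L' - L by lra.
have [r r0 hr] := pD t hc _ e0.
have [b [u [/andP[u0 ur] [hb _] _ bad]]] := hn _ r0.
move: bad; rewrite /Bad; apply/negP; rewrite -leNgt.
set b0 := complex.Re b in hb *.
have /andP[hb1 hb2] := hb.
have A1 : `|b0 + u - t| < r by rewrite ger0_norm /t; lra.
have A2 : `|b0 - t| < r by rewrite ler0_norm /t; lra.
have := hr _ A1; have := hr _ A2.
rewrite [`|b0 + u - t|]ger0_norm ?[`|b0 - t|]ler0_norm /t; try lra.
rewrite -/t; set X := nm _; set Y := nm _ => hX hY.
have -> : p (b0 + u) - p b0 = (p (b0 + u) - p t - rc (b0 + u - t) * D t)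
   - (p b0 - p t - rc (b0 - t) * D t) + rc u * D t.
  have -> : rc u = rc (b0 + u - t) - rc (b0 - t).
    by rewrite /rc -rmorphB; congr (_%:C)%C; ring.
  by ring.
have hD : nm (rc u * D t) <= u * L.
  by rewrite nmM nm_real; [apply: ler_wpM2l; [lra | apply: DL] | lra].
apply: le_trans (nmD _ _) _; have := nmB (p (b0 + u) - p t - rc (b0 + u - t) * D t)
  (p b0 - p t - rc (b0 - t) * D t).
by rewrite -/X -/Y; nra.
Qed.

(** Left-endpoint Riemann sum, with [3 ^ n] pieces, of the integral of [g] over the segment from [a]
    to [a + h]. The estimates are proved for these sums at large levels [n]. *)
Fixpoint rint n g a h : C :=
  if n is n'.+1 then
    rint n' g a (h / 3) + rint n' g (a + h / 3) (h / 3) + rint n' g (a + h / 3 * 2) (h / 3)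
  else h * g a.

Lemma rintD n g g' a h : rint n (fun z => g z + g' z) a h = rint n g a h + rint n g' a h.
Proof. by elim: n a h => [|n IH] a h /=; rewrite ?mulrDr // !IH; ring. Qed.

Lemma rintZ n (k : C) g a h : rint n (fun z => k * g z) a h = k * rint n g a h.
Proof. by elim: n a h => [|n IH] a h /=; rewrite ?IH; ring. Qed.

(** The sum is not exact on affine functions ([c] is only close to 1/2), but its error has the same
    shape on every segment, which is what makes it cancel around a square. *)
Lemma rint_affine n : exists c : C, forall (p q : C) a h,
  rint n (fun z => p + q * z) a h = h * (p + q * (a + h * c)).
Proof.
elim: n => [|n [c IH]]; first by exists 0 => p q a h /=; ring.
by exists (1 / 3 + c / 3) => p q a h /=; rewrite !IH; field.
Qed.

Lemma rint_bound n g a h (B : R) :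
  (forall t : R, 0 <= t <= 1 -> nm (h * g (a + rc t * h)) <= B) ->
  nm (rint n g a h) <= B.
Proof.
elim: n a h B => [|n IH] a h B H /=.
  by have := H 0; rewrite /rc rmorph0 mul0r addr0; apply; lra.
have K (k : C) (x : R) : k = rc x -> 0 <= x <= 2 ->
   nm (rint n g (a + h / 3 * k) (h / 3)) <= B / 3.
  move=> -> x02; apply: IH => t t01.
  have -> : a + h / 3 * rc x + rc t * (h / 3) = a + rc ((x + t) / 3) * h.
    by rewrite /rc fmorph_div rmorphD /= rmorph_nat; field.
  rewrite mulrAC nmM nmV.
  have -> : nm (3 : C) = 3 by rewrite -[3 : C](rmorph_nat (@real_complex R) 3) nm_real.
  by have := H ((x + t) / 3); rewrite nmM; lra.
have := K 0 0; have := K 1 1; have := K 2 2.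
rewrite /rc rmorph0 rmorph1 rmorph_nat mulr0 mulr1 addr0.
move=> /(_ erefl) h2 /(_ erefl) h1 /(_ erefl) h0.
apply: le_trans (nmD _ _) _.
have := nmD (rint n g a (h / 3)) (rint n g (a + h / 3) (h / 3)).
by lra.
Qed.

Lemma rint_Im_ge n g a h (m : R) :
  (forall t : R, 0 <= t <= 1 -> m <= complex.Im (h * g (a + rc t * h))) ->
  m <= complex.Im (rint n g a h).
Proof.
elim: n a h m => [|n IH] a h m H /=.
  by have := H 0; rewrite /rc rmorph0 mul0r addr0; apply; lra.
have K (k : C) (x : R) : k = rc x -> 0 <= x <= 2 ->
   m / 3 <= complex.Im (rint n g (a + h / 3 * k) (h / 3)).
  move=> -> x02; apply: IH => t t01.
  have -> : a + h / 3 * rc x + rc t * (h / 3) = a + rc ((x + t) / 3) * h.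
    by rewrite /rc fmorph_div rmorphD /= rmorph_nat; field.
  have := H ((x + t) / 3); set w := g _.
  have -> : h / 3 * w = rc (1 / 3) * (h * w).
    by rewrite /rc fmorph_div rmorph1 rmorph_nat; field.
  by rewrite [complex.Im (rc _ * _)]ImM Rerc Imrc; lra.
have := K 0 0; have := K 1 1; have := K 2 2.
rewrite /rc rmorph0 rmorph1 rmorph_nat mulr0 mulr1 addr0.
move=> /(_ erefl) h2 /(_ erefl) h1 /(_ erefl) h0.
by rewrite !ImD; lra.
Qed.

(** Sum around a square. The top and left sides carry a minus sign instead of being traversed
    backwards: left-endpoint sums on an edge shared by two subsquares are then literally equal, so
    the subdivision formula [bintS] is an identity and not an approximation. *)
Definition bint n g a (s : R) : C :=
  rint n g a (rc s) + rint n g (a + rc s) (rc s * I)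
  - rint n g (a + rc s * I) (rc s) - rint n g a (rc s * I).

Lemma bintS n g a (s : R) :
  bint n.+1 g a s = \sum_(i < 3) \sum_(j < 3) bint n g (shiftsq a (s / 3) i j) (s / 3).
Proof.
pose P (x y : C) : C := a + rc (s / 3) * x + rc (s / 3) * y * I.
pose H x y := rint n g (P x y) (rc (s / 3)).
pose V x y := rint n g (P x y) (rc (s / 3) * I).
have E (i j : 'I_3) : bint n g (shiftsq a (s / 3) i j) (s / 3) =
   H i%:R j%:R + V (i%:R + 1) j%:R - H i%:R (j%:R + 1) - V i%:R j%:R.
  rewrite /bint /shiftsq /H /V /P /rc.
  rewrite ![(_ * _)%:C%C]rmorphM /= !rmorph_nat.
  by congr (_ + _ - _ - _); congr (rint _ _ _ _); ring.
rewrite !big_ord_recl !big_ord0.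
rewrite !E /=.
have S3 : rc s / 3 = rc (s / 3) by rewrite /rc fmorph_div rmorph_nat.
have S3I : rc s * I / 3 = rc (s / 3) * I by rewrite -S3; ring.
have S3' : rc s = rc (s / 3) * 3 by rewrite -S3; field.
rewrite /bint /= S3 S3I S3' /H /V /P.
rewrite -[bump 0 (bump 0 0)]/2%N -[bump 0 0]/1%N.
have -> : (2 : C) + 1 = 3 by rewrite -[RHS]natr1.
rewrite !mulr0 !mul0r !addr0 !add0r !mulr1.
have -> : (1 : C) + 1 = 2 by [].
set k := rc (s / 3).
have -> : k * 2 * I = k * I * 2 by ring.
have -> : k * 3 * I = k * I * 3 by ring.
rewrite [a + k * I * 3 + k]addrAC [a + k * I * 3 + k * 2]addrAC.
by ring.
Qed.

End OneVariable.

(** * Goursat's lemma for Riemann sums over squares *)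

Section Cauchy.
Variable R : realType.
Local Notation C := (CC R).
Local Notation I := ('i%C : C).
Implicit Types (g f : C -> C) (a z h : C) (n : nat).

Lemma bintD n g g' a (s : R) :
  bint n (fun z => g z + g' z) a s = bint n g a s + bint n g' a s.
Proof. by rewrite /bint !rintD; ring. Qed.

Lemma bintZ n (k : C) g a (s : R) : bint n (fun z => k * g z) a s = k * bint n g a s.
Proof. by rewrite /bint !rintZ; ring. Qed.

Lemma bint_affine n (p q : C) a (s : R) : bint n (fun z => p + q * z) a s = 0.
Proof. by have [c E] := @rint_affine R n; rewrite /bint !E; ring. Qed.

Definition on_bdry a (s : R) z := exists2 t : R, 0 <= t <= 1 &
  [\/ z = a + rc t * rc s, z = a + rc s + rc t * (rc s * I),
      z = a + rc s * I + rc t * rc s | z = a + rc t * (rc s * I)].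

Lemma bint_bound n g a (s : R) (B : R) : 0 <= s ->
  (forall z, on_bdry a s z -> nm (g z) <= B) -> nm (bint n g a s) <= 4 * s * B.
Proof.
move=> s0 H.
have ns : nm (rc s) = s by rewrite nm_real.
have nsI : nm (rc s * I) = s by rewrite nmM nm_i mulr1.
have h1 : nm (rint n g a (rc s)) <= s * B.
  apply: rint_bound => t t01; rewrite nmM ns; apply: ler_wpM2l => //.
  by apply: H; exists t => //; constructor 1.
have h2 : nm (rint n g (a + rc s) (rc s * I)) <= s * B.
  apply: rint_bound => t t01; rewrite nmM nsI; apply: ler_wpM2l => //.
  by apply: H; exists t => //; constructor 2.
have h3 : nm (rint n g (a + rc s * I) (rc s)) <= s * B.
  apply: rint_bound => t t01; rewrite nmM ns; apply: ler_wpM2l => //.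
  by apply: H; exists t => //; constructor 3.
have h4 : nm (rint n g a (rc s * I)) <= s * B.
  apply: rint_bound => t t01; rewrite nmM nsI; apply: ler_wpM2l => //.
  by apply: H; exists t => //; constructor 4.
rewrite /bint.
apply: le_trans (nmB _ _) _.
have := nmB (rint n g a (rc s) + rint n g (a + rc s) (rc s * I)) (rint n g (a + rc s * I) (rc s)).
have := nmD (rint n g a (rc s)) (rint n g (a + rc s) (rc s * I)).
by lra.
Qed.

Lemma on_bdry_sqr a (s : R) z : 0 <= s -> on_bdry a s z -> sqr_pred a s z.
Proof.
move=> s0 [t /andP[t0 t1] h].
by case: h => ->; rewrite /sqr_pred !reim; split; nra.
Qed.

Lemma sqr_diam a (s : R) z w : 0 <= s -> sqr_pred a s z -> sqr_pred a s w ->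
  nm (z - w) <= 2 * s.
Proof.
move=> s0 [/andP[? ?] /andP[? ?]] [/andP[? ?] /andP[? ?]].
apply: le_trans (nm_ReIm _) _; rewrite !reim.
have : `|complex.Re z - complex.Re w| <= s by rewrite ler_norml; apply/andP; split; lra.
have : `|complex.Im z - complex.Im w| <= s by rewrite ler_norml; apply/andP; split; lra.
lra.
Qed.

Lemma diff1Z g a h : 'd g a h = h * 'd g a 1.
Proof. by rewrite -[h in LHS]mulr1 -[_ * 1]/(h *: (1 : C)) linearZ. Qed.

(** Near the limit point [c] the function differs from an affine one by a small multiple of
    [|z - c|]; affine functions contribute 0, so the sum over a small square is at most [e'] times
    its area. *)
Lemma goursat g a (s : R) : 0 < s ->
  (forall z, sqr_pred a s z -> differentiable g z) ->
  forall e : R, 0 < e -> exists N, forall n, (N <= n)%N -> nm (bint n g a s) <= e.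
Proof.
move=> s0 dg e e0; apply: contrapT => H.
pose e' := e / s ^+ 2.
have e'0 : 0 < e' by rewrite divr_gt0 // exprn_gt0.
(* Badness asks for arbitrarily high levels, since each subdivision lowers the level by one; the
   bound is proportional to the area so that the nine subsquares share it equally. *)
pose Bad b u := forall N, exists2 n, (N <= n)%N & e' * u ^+ 2 < nm (bint n g b u).
have bad0 : Bad a s.
  move=> N; apply: contrapT => K; apply: H; exists N => n Nn.
  rewrite leNgt; apply/negP => hn; apply: K; exists n => //.
  by rewrite /e' divfK // expf_neq0 // gt_eqF.
have step b u : 0 < u -> Bad b u -> exists i j, Bad (shiftsq b (u / 3) i j) (u / 3).
  move=> u0 hb; apply: contrapT => K.
  have K' (ij : 'I_3 * 'I_3) : exists N, forall n, (N <= n)%N ->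
      nm (bint n g (shiftsq b (u / 3) ij.1 ij.2) (u / 3)) <= e' * (u / 3) ^+ 2.
    apply: contrapT => K'; apply: K; exists ij.1, ij.2 => N.
    apply: contrapT => K''; apply: K'; exists N => n Nn.
    by rewrite leNgt; apply/negP => hn; apply: K''; exists n.
  have [N hN] := boolp.choice K'.
  pose M := (\max_ij N ij)%N.
  have [n Mn] := hb M.+1; apply/negP; rewrite -leNgt.
  case: n Mn => // n Mn; rewrite bintS pair_big /=.
  apply: le_trans (nm_sum _) _.
  have -> : e' * u ^+ 2 = \sum_(ij : 'I_3 * 'I_3) e' * (u / 3) ^+ 2.
    rewrite sumr_const card_prod !card_ord -mulr_natr.
    by rewrite (_ : (3 * 3)%N = 9%N) //; field.
  by apply: ler_sum => ij _; apply: hN; apply: (leq_trans (leq_bigmax ij)).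
have [c hc hn] := nested_squares s0 step bad0.
(* 16 is 4 for the perimeter [4 * u] times 4 for the crude bound [4 * u] on the distance to [c]. *)
have e16 : 0 < e' / 16 by lra.
have [r r0 hr] := differentiable_nm (dg c hc) e16.
have r2 : 0 < r / 4 by lra.
have [b [u [/andP[u0 ur] bc _ bad]]] := hn _ r2.
have [n _] := bad 0%N; apply/negP; rewrite -leNgt.
pose q := 'd g c 1.
pose g' z := g z + (- 1) * (g c - q * c + q * z).
have -> : bint n g b u = bint n g' b u.
  by rewrite /g' bintD bintZ bint_affine mulr0 addr0.
have -> : e' * u ^+ 2 = 4 * u * (e' / 16 * (4 * u)) by field.
apply: bint_bound => [|z /(on_bdry_sqr (ltW u0)) zb]; first exact: ltW.
have zc := sqr_diam (ltW u0) zb bc.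
have zr : nm (z - c) < r by lra.
have := hr (z - c) zr; rewrite diff1Z -/q [c + (z - c)]addrC subrK.
rewrite (_ : g z - g c - _ = g' z); last by rewrite /g'; ring.
by move=> h; apply: le_trans h _; apply: ler_wpM2l; lra.
Qed.

(** Lower left corner of the square with centre [a] and half side [r]. *)
Definition csq a (r : R) : C := a - rc r - rc r * I.

Lemma csq_bdry a (r : R) z : 0 < r -> on_bdry (csq a r) (2 * r) z ->
  r <= nm (z - a) <= 2 * r.
Proof.
move=> r0 [t /andP[t0 t1] hz].
have [h1 h2] : (`|complex.Re (z - a)| <= r /\ `|complex.Im (z - a)| <= r).
  by case: hz => ->; rewrite /csq !reim !ler_norml; split; nra.
have h3 : r <= `|complex.Re (z - a)| \/ r <= `|complex.Im (z - a)|.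
  case: hz => ->; rewrite /csq !reim.
  - by right; rewrite ler_normr; apply/orP; right; nra.
  - by left; rewrite ler_normr; apply/orP; left; nra.
  - by right; rewrite ler_normr; apply/orP; left; nra.
  - by left; rewrite ler_normr; apply/orP; right; nra.
apply/andP; split; last by apply: le_trans (nm_ReIm _) _; lra.
by case: h3 => h3; apply: le_trans h3 _; [exact: nm_Re | exact: nm_Im].
Qed.

Lemma csq_in a (r : R) z : 0 <= r -> sqr_pred (csq a r) (2 * r) z -> nm (z - a) <= 2 * r.
Proof.
rewrite /sqr_pred /csq !reim => r0 [/andP[h1 h2] /andP[h3 h4]].
apply: le_trans (nm_ReIm _) _; rewrite !reim.
have : `|complex.Re z - complex.Re a| <= r by rewrite ler_norml; apply/andP; split; lra.
have : `|complex.Im z - complex.Im a| <= r by rewrite ler_norml; apply/andP; split; lra.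
lra.
Qed.

(** A singularity where [(z - a) * g z] tends to 0 is harmless. By Goursat the eight outer squares
    contribute nothing in the limit, so the square may be shrunk about [a] by any power of 3, and on
    a small one the perimeter beats the growth of [g]. *)
Lemma goursat_punctured g a (r : R) : 0 < r ->
  (forall z, nm (z - a) <= 2 * r -> z != a -> differentiable g z) ->
  (forall e : R, 0 < e -> exists2 d, 0 < d & forall z, nm (z - a) < d -> nm (g z) * nm (z - a) <= e) ->
  forall e : R, 0 < e -> exists N, forall n, (N <= n)%N -> nm (bint n g (csq a r) (2 * r)) <= e.
Proof.
move=> r0 dg ga e e0.
have one (rho : R) : 0 < rho <= r -> forall e, 0 < e -> exists N, forall n, (N <= n)%N ->
    nm (bint n.+1 g (csq a rho) (2 * rho) - bint n g (csq a (rho / 3)) (2 * (rho / 3))) <= e.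
  move=> /andP[rho0 rhor] e1 e10.
  have K (ij : 'I_3 * 'I_3) : exists N, ij != (inord 1, inord 1) -> forall n, (N <= n)%N ->
      nm (bint n g (shiftsq (csq a rho) (2 * rho / 3) ij.1 ij.2) (2 * rho / 3)) <= e1 / 9.
    have [->|ijn] := eqVneq ij (inord 1, inord 1); first by exists 0%N.
    have s0 : 0 < 2 * rho / 3 by lra.
    have e90 : 0 < e1 / 9 by lra.
    have [] := @goursat g (shiftsq (csq a rho) (2 * rho / 3) ij.1 ij.2) _ s0 _ _ e90; last first.
      by move=> N hN; exists N => _.
    case: ij ijn => i j /= ijn z hz.
    have i3 (i0 : 'I_3) : 0 <= (i0%:R : R) <= 2.
      by rewrite ler0n /=; rewrite -[2]/(2%:R) ler_nat -ltnS.
    have ine (i0 : 'I_3) : i0 != inord 1 -> (i0%:R : R) = 0 \/ (i0%:R : R) = 2.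
      case: i0 => -[|[|[|//]]] //= ?; rewrite -val_eqE /= inordK //; first by left.
      by right.
    have := hz; rewrite /sqr_pred /shiftsq /csq !reim.
    have /andP[i1 i2] := i3 i; have /andP[j1 j2] := i3 j => -[/andP[b1 b2] /andP[b3 b4]].
    apply: dg.
      apply: (@le_trans _ _ (2 * rho)); last by lra.
      apply: csq_in; first exact: ltW.
      by rewrite /sqr_pred /csq !reim; split; apply/andP; split; nra.
    apply/eqP => za; move: ijn; rewrite za in b1 b2 b3 b4; rewrite xpair_eqE negb_and.
    by move=> /orP[/ine[hi|hi]|/ine[hi|hi]]; rewrite hi in b1 b2 b3 b4; nra.
  have [N hN] := boolp.choice K.
  exists (\max_ij N ij)%N => n Mn.
  rewrite bintS pair_big /= (bigD1 (inord 1, inord 1)) //=.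
  have -> : shiftsq (csq a rho) (2 * rho / 3) (inord 1) (inord 1) = csq a (rho / 3).
    rewrite /shiftsq /csq !inordK // !mulr1.
    have -> : rc (2 * rho / 3) = rc rho - rc (rho / 3).
      by rewrite /rc -rmorphB; congr (_%:C)%C; field.
    by ring.
  have -> : 2 * rho / 3 = 2 * (rho / 3) by field.
  rewrite addrAC subrr add0r.
  rewrite big_mkcond /=.
  apply: le_trans (nm_sum _) _.
  have -> : e1 = \sum_(ij : 'I_3 * 'I_3) e1 / 9.
    rewrite sumr_const card_prod !card_ord -mulr_natr.
    by rewrite (_ : (3 * 3)%N = 9%N) //; field.
  apply: ler_sum => ij _; case: ifP => [ijn|_]; last by rewrite nm0; lra.
  rewrite (_ : 2 * (rho / 3) = 2 * rho / 3); last by field.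
  apply: hN => //; exact: (leq_trans (leq_bigmax ij)).
have many k : forall e, 0 < e -> exists N, forall n, (N <= n)%N ->
    nm (bint (n + k) g (csq a r) (2 * r) - bint n g (csq a (r / 3 ^+ k)) (2 * (r / 3 ^+ k))) <= e.
  elim: k => [|k IH] e1 e10.
    by exists 0%N => n _; rewrite addn0 expr0 divr1 subrr nm0 ltW.
  have e2 : 0 < e1 / 2 by lra.
  have k3 : 1 <= (3 : R) ^+ k by rewrite exprn_ege1 // ler1n.
  have rk : 0 < r / 3 ^+ k <= r.
    by rewrite divr_gt0 ?exprn_gt0 //= ler_pdivrMr ?exprn_gt0 // ler_peMr // ltW.
  have [N1 h1] := IH _ e2; have [N2 h2] := one _ rk _ e2.
  exists (N1 + N2)%N => n Nn; rewrite addnS -addSn.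
  have -> : r / 3 ^+ k.+1 = r / 3 ^+ k / 3 by rewrite exprS; field; rewrite expf_neq0.
  have := h1 n.+1 (leq_trans (leq_addr _ _) (leqW Nn)).
  have := h2 n (leq_trans (leq_addl _ _) Nn).
  set X := bint _ _ _ _; set Y := bint _ _ _ _; set Z := bint _ _ _ _ => hX hZ.
  have -> : Z - Y = (Z - X) + (X - Y) by ring.
  by apply: le_trans (nmD _ _) _; lra.
(* On the shrunken square of half side [r / 3 ^+ k] the perimeter is eight half sides, and [g] is at
   most [e / 16] divided by the half side, for a total of [e / 2]. *)
have e16 : 0 < e / 16 by lra.
have [d d0 hd] := ga _ e16.
have [k hk] : exists k, r / 3 ^+ k < d / 2.
  exists (Num.bound (r / (d / 2))); set m := Num.bound _.
  have h3 : m%:R <= (3 : R) ^+ m by rewrite -natrX ler_nat; exact/ltnW/ltn_expl.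
  have d2 : 0 < d / 2 by lra.
  rewrite ltr_pdivrMr ?exprn_gt0 // mulrC -ltr_pdivrMr //.
  by apply: lt_le_trans h3; exact: archi_boundP (ltW (divr_gt0 r0 d2)).
have rk0 : 0 < r / 3 ^+ k by rewrite divr_gt0 // exprn_gt0.
have e2 : 0 < e / 2 by lra.
have [N hN] := many k _ e2; exists (N + k)%N => n Nn.
have kn : (k <= n)%N := leq_trans (leq_addl _ _) Nn.
have := hN (n - k)%N; rewrite subnK // leq_subRL // addnC => /(_ Nn).
set X := bint _ _ _ _; set Y := bint _ _ _ _ => hX.
have hY : nm Y <= e / 2.
  have -> : e / 2 = 4 * (2 * (r / 3 ^+ k)) * ((e / 16) / (r / 3 ^+ k)).
    by field; rewrite expf_neq0 //=; lra.
  apply: bint_bound => [|z hz]; first by lra.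
  have /andP[z1 z2] := csq_bdry rk0 hz.
  rewrite ler_pdivlMr //; apply: le_trans (hd z _); last by lra.
  by apply: ler_wpM2l => //; exact: nm_ge0.
have -> : X = (X - Y) + Y by ring.
by apply: le_trans (nmD _ _) _; lra.
Qed.

End Cauchy.

(** * Cauchy estimates for values and derivatives *)

Section CauchyEstimates.
Variable R : realType.
Local Notation C := (CC R).
Local Notation I := ('i%C : C).
Implicit Types (g f : C -> C) (a z h : C) (n : nat).

(** On each side the imaginary part of [h / (z - a)] is at least 1, at every level [n], so the four
    sides give at least 4. The exact limit has modulus [2 * pi], but a lower bound suffices. *)
Lemma bint_kernel n a (r : R) : 0 < r ->
  4 <= nm (bint n (fun z => (z - a)^-1) (csq a r) (2 * r)).
Proof.
move=> r0; apply: le_trans (nm_Im _).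
have key (x y u v : R) : x ^+ 2 + y ^+ 2 != 0 ->
    complex.Im ((u +i* v)%C * (x +i* y : C)%C^-1 : C) = (v * x - u * y) / (x ^+ 2 + y ^+ 2).
  by move=> xy; rewrite ImM /=; field.
apply: (@le_trans _ _ (complex.Im (bint n (fun z => (z - a)^-1) (csq a r) (2 * r)))); last exact: ler_norm.
have mx (h b : C) : (forall t : R, 0 <= t <= 1 -> 1 <= complex.Im (h * (b + rc t * h - a)^-1)) ->
    1 <= complex.Im (rint n (fun z => (z - a)^-1) b h) by move=> H; apply: rint_Im_ge.
have neg (h b : C) : (forall t : R, 0 <= t <= 1 -> 1 <= complex.Im (- h * (b + rc t * h - a)^-1)) ->
    1 <= - complex.Im (rint n (fun z => (z - a)^-1) b h).
  move=> H; rewrite -ImN -mulN1r -rintZ; apply: rint_Im_ge => t t01.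
  by have := H t t01; rewrite mulrCA mulN1r mulNr.
rewrite /bint !reim.
suff : [/\ 1 <= complex.Im (rint n (fun z => (z - a)^-1) (csq a r) (rc (2 * r))),
  1 <= complex.Im (rint n (fun z => (z - a)^-1) (csq a r + rc (2 * r)) (rc (2 * r) * I)),
  1 <= - complex.Im (rint n (fun z => (z - a)^-1) (csq a r + rc (2 * r) * I) (rc (2 * r))) &
  1 <= - complex.Im (rint n (fun z => (z - a)^-1) (csq a r) (rc (2 * r) * I))].
  by case=> *; lra.
have r2 : rc (2 * r) = rc r * 2 by rewrite /rc rmorphM rmorph_nat mulrC.
have E (x y : R) : rc x + rc y * I = (x +i* y)%C.
  by apply/eqP; rewrite eq_complex !reim /= !mulr0 !mulr1 !subr0 !addr0 add0r !eqxx.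
have sq (x y : R) : x = r \/ x = - r -> x ^+ 2 + y ^+ 2 != 0.
  by move=> xr; rewrite gt_eqF //; case: xr => ->; nra.
have sq' (x y : R) : y = r \/ y = - r -> x ^+ 2 + y ^+ 2 != 0.
  by move=> xr; rewrite addrC sq.
split; [apply: mx | apply: mx | apply: neg | apply: neg] => t /andP[t0 t1];
  have T : ((2 * t - 1) * r) ^+ 2 <= r ^+ 2
    by (rewrite -subr_ge0 (_ : _ - _ = 4 * (t * (1 - t)) * r ^+ 2); last (by ring);
        rewrite !mulr_ge0 ?sqr_ge0 //; lra).
- have -> : csq a r + rc t * rc (2 * r) - a = ((2 * t - 1) * r +i* (- r))%C.
    by rewrite -[RHS]E /csq /rc !(rmorphM, rmorphB, rmorphN, rmorph_nat, rmorph1) /=; ring.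
  have -> : rc (2 * r) = ((2 * r) +i* 0)%C by [].
  rewrite key; last by apply: sq'; right.
  by rewrite ler_pdivlMr; nra.
- have -> : csq a r + rc (2 * r) + rc t * (rc (2 * r) * I) - a = (r +i* ((2 * t - 1) * r))%C.
    by rewrite -[RHS]E /csq /rc !(rmorphM, rmorphB, rmorphN, rmorph_nat, rmorph1) /=; ring.
  have -> : rc (2 * r) * I = (0 +i* (2 * r))%C by rewrite -[RHS]E /rc rmorph0 add0r.
  rewrite key; last by apply: sq; left.
  by rewrite ler_pdivlMr; nra.
- have -> : csq a r + rc (2 * r) * I + rc t * rc (2 * r) - a = ((2 * t - 1) * r +i* r)%C.
    by rewrite -[RHS]E /csq /rc !(rmorphM, rmorphB, rmorphN, rmorph_nat, rmorph1) /=; ring.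
  have -> : - rc (2 * r) = ((- (2 * r)) +i* 0)%C by rewrite -[RHS]E /rc rmorph0 mul0r addr0 rmorphN.
  rewrite key; last by apply: sq'; left.
  by rewrite ler_pdivlMr; nra.
- have -> : csq a r + rc t * (rc (2 * r) * I) - a = ((- r) +i* ((2 * t - 1) * r))%C.
    by rewrite -[RHS]E /csq /rc !(rmorphM, rmorphB, rmorphN, rmorph_nat, rmorph1) /=; ring.
  have -> : - (rc (2 * r) * I) = (0 +i* (- (2 * r)))%C.
    by rewrite -[RHS]E /rc rmorph0 add0r rmorphN mulNr.
  rewrite key; last by apply: sq; right.
  by rewrite ler_pdivlMr; nra.
Qed.

Lemma differentiable_subc a z : differentiable (fun w : C => w - a) z.
Proof. exact: differentiableB. Qed.

Lemma differentiable_invsub a z : z != a -> differentiable (fun w : C => (w - a)^-1) z.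
Proof.
move=> za; apply: (@differentiableV _ _ (fun w => w - a)); first exact: differentiable_subc.
by rewrite subr_eq0.
Qed.

Lemma cauchy_value f a (r M : R) : 0 < r ->
  (forall z, nm (z - a) <= 2 * r -> differentiable f z) ->
  (forall z, r <= nm (z - a) <= 2 * r -> nm (f z) <= M) ->
  nm (f a) <= 2 * M.
Proof.
move=> r0 df fM; rewrite leNgt; apply/negP => hM.
pose e := (nm (f a) - 2 * M).
have e0 : 0 < e by rewrite /e; lra.
pose h z := (f z - f a) * (z - a)^-1.
have dh z : nm (z - a) <= 2 * r -> z != a -> differentiable h z.
  move=> z1 z2; apply: differentiableM; last exact: differentiable_invsub.
  by apply: differentiableB; [exact: df | exact: differentiable_cst].
have da : differentiable f a by apply: df; rewrite subrr nm0; lra.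
have [|N hN] := goursat_punctured r0 dh _ e0.
  move=> e1 e10; have /continuous_nmP/(_ e1 e10)[d d0 hd] := differentiable_continuous da.
  exists d => // z zd; rewrite -nmM /h mulrAC.
  have [->|za] := eqVneq z a; first by rewrite (subrr (f a)) !mul0r nm0 ltW.
  rewrite mulfK ?subr_eq0 //; exact/ltW/hd.
have := hN N (leqnn _).
have -> : bint N h (csq a r) (2 * r) =
   bint N (fun z => f z * (z - a)^-1) (csq a r) (2 * r) +
   - f a * bint N (fun z => (z - a)^-1) (csq a r) (2 * r).
  by rewrite -bintZ -bintD; congr bint; apply/funext => z; rewrite /h; ring.
set X := bint _ _ _ _; set K := bint _ _ _ _.
have hK : 4 <= nm K by exact: bint_kernel.
have hX : nm X <= 4 * (2 * r) * (M / r).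
  apply: bint_bound => [|z /csq_bdry -/(_ r0) zr]; first lra.
  rewrite nmM nmV; apply: ler_pM; rewrite ?nm_ge0 ?invr_ge0 ?nm_ge0 ?fM //.
  by rewrite lef_pV2 ?posrE; lra.
have {}hX : nm X <= 8 * M by move: hX; rewrite (_ : _ * (M / r) = 8 * M) //; field; lra.
move=> h1; have := nmDl (- f a * K) X; rewrite nmM nmN [_ * K + X]addrC => h2.
have : 4 * nm (f a) <= nm (f a) * nm K by rewrite mulrC; apply: ler_wpM2l => //; exact: nm_ge0.
by rewrite /e in h1 e0 *; lra.
Qed.

(** Same scheme with [(f z - f a - q * (z - a)) / (z - a) ^ 2], whose singularity is admissible
    because [q] is the derivative at [a]. *)
Lemma cauchy_deriv f a (r M : R) : 0 < r ->
  (forall z, nm (z - a) <= 2 * r -> differentiable f z) ->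
  (forall z, nm (z - a) <= 2 * r -> nm (f z) <= M) ->
  nm ('d f a 1) <= 4 * M / r.
Proof.
move=> r0 df fM; rewrite leNgt; apply/negP => hM.
pose q := 'd f a 1.
pose e := (nm q - 4 * M / r).
have e0 : 0 < e by rewrite /e subr_gt0.
pose h z := (f z - f a - q * (z - a)) * ((z - a)^-1 * (z - a)^-1).
have dh z : nm (z - a) <= 2 * r -> z != a -> differentiable h z.
  move=> z1 z2; apply: differentiableM.
    apply: differentiableB.
      by apply: differentiableB; [exact: df | exact: differentiable_cst].
    apply: differentiableM; first exact: differentiable_cst.
    exact: differentiable_subc.
  by apply: differentiableM; exact: differentiable_invsub.
have aa : nm (a - a) <= 2 * r by rewrite subrr nm0; lra.
have da : differentiable f a by apply: df.
have [|N hN] := goursat_punctured r0 dh _ e0.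
  move=> e1 e10; have [d d0 hd] := differentiable_nm da e10.
  exists d => // z zd; have [->|za] := eqVneq z a; first by rewrite subrr nm0 mulr0 ltW.
  have := hd _ zd; rewrite diff1Z -/q [a + _]addrC subrK [(z - a) * q]mulrC => hq.
  have za0 : 0 < nm (z - a) by rewrite nm_gt0 subr_eq0.
  rewrite -nmM /h mulrA mulfVK ?subr_eq0 // nmM nmV.
  by rewrite ler_pdivrMr.
have := hN N (leqnn _).
have -> : bint N h (csq a r) (2 * r) =
   bint N (fun z => (f z - f a) * ((z - a)^-1 * (z - a)^-1)) (csq a r) (2 * r) +
   - q * bint N (fun z => (z - a)^-1) (csq a r) (2 * r).
  rewrite -bintZ -bintD; congr bint; apply/funext => z; rewrite /h.
  have [->|za] := eqVneq z a; first by rewrite !subrr invr0; ring.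
  by field; rewrite subr_eq0.
set X := bint _ _ _ _; set K := bint _ _ _ _.
have hK : 4 <= nm K by exact: bint_kernel.
have hX : nm X <= 4 * (2 * r) * (2 * M * (r^-1 * r^-1)).
  apply: bint_bound => [|z /csq_bdry -/(_ r0) /andP[z1 z2]]; first lra.
  have inv : (nm (z - a))^-1 <= r^-1 by rewrite lef_pV2 ?posrE; lra.
  have inv0 : 0 <= (nm (z - a))^-1 by rewrite invr_ge0 nm_ge0.
  rewrite !nmM !nmV; apply: ler_pM; rewrite ?mulr_ge0 ?nm_ge0 //; last first.
    by apply: ler_pM.
  by apply: le_trans (nmB _ _) _; have := fM z z2; have := fM a aa; lra.
have {}hX : nm X <= 4 * (4 * M / r).
  by move: hX; rewrite (_ : _ * (2 * M * _) = 4 * (4 * M / r)) //; field; lra.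
move=> h1; have := nmDl (- q * K) X; rewrite nmM nmN [_ * K + X]addrC => h2.
have : 4 * nm q <= nm q * nm K by rewrite mulrC; apply: ler_wpM2l => //; exact: nm_ge0.
by rewrite /e in h1 e0 *; lra.
Qed.

End CauchyEstimates.

(** * Geometric convergence *)

Section Geometric.
Variable R : realType.
Local Notation C := (CC R).
Local Open Scope classical_set_scope.
Local Open Scope ring_scope.

Lemma geo_small (k B e : R) : 0 <= k < 1 -> 0 < e -> exists n, B * k ^+ n < e.
Proof.
move=> /andP[k0 k1] e0.
have : (fun n => k ^+ n) @ \oo --> (0 : R) by apply: cvg_expr; rewrite ger0_norm.
move=> /cvgrPdist_lt /(_ (e / (`|B| + 1))).
have B1 : 0 < `|B| + 1 by have := normr_ge0 B; lra.
move=> /(_ (divr_gt0 e0 B1)) [N _ hN]; exists N.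
have /= := hN N (leqnn _); rewrite sub0r normrN ger0_norm ?exprn_ge0 //.
rewrite ltr_pdivlMr // => h; have := ler_norm B; have := exprn_ge0 N k0; nra.
Qed.

(** The substitute for passing to the limit: every approximation below comes with a geometric error,
    which this lemma discards. *)
Lemma geo_le (k B a b : R) : 0 <= k < 1 -> (forall n, a <= b + B * k ^+ n) -> a <= b.
Proof.
move=> kk h; rewrite leNgt; apply/negP => ab.
have e0 : 0 < a - b by lra.
by have [n] := geo_small B kk e0; have := h n; lra.
Qed.

(** Real and imaginary parts lie in nested intervals around the terms, of half length the tail
    [B / (1 - k) * k ^+ n] of the series; adding the two parts accounts for the factor 2. *)
Lemma geo_cauchy (a : nat -> C) (k B : R) : 0 <= k < 1 -> 0 <= B ->
  (forall n, nm (a n.+1 - a n) <= B * k ^+ n) ->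
  exists c, forall n, nm (a n - c) <= 2 * B / (1 - k) * k ^+ n.
Proof.
move=> /andP[k0 k1] B0 H.
have real (x : nat -> R) : (forall n, `|x n.+1 - x n| <= B * k ^+ n) ->
    exists c, forall n, `|x n - c| <= B / (1 - k) * k ^+ n.
  move=> hx; pose d n := B / (1 - k) * k ^+ n.
  have dE n : d n - d n.+1 = B * k ^+ n by rewrite /d exprS; field; lra.
  have d0 n : 0 <= d n by rewrite /d !mulr_ge0 ?invr_ge0 ?exprn_ge0 //; lra.
  have [|n|n|c hc] := @nested_intervals R (fun n => x n - d n) (fun n => 2 * d n).
  - by move=> n; have := d0 n; lra.
  - by have := hx n; rewrite ler_norml => /andP[]; have := dE n; lra.
  - by have := hx n; rewrite ler_norml => /andP[]; have := dE n; lra.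
  exists c => n; have := hc n; rewrite -/(d n) ler_norml => /andP[? ?].
  by apply/andP; split; lra.
have [n|cx hx] := real (fun n => complex.Re (a n)).
  by apply: le_trans (H n); rewrite -ReN -ReD; exact: nm_Re.
have [n|cy hy] := real (fun n => complex.Im (a n)).
  by apply: le_trans (H n); rewrite -ImN -ImD; exact: nm_Im.
exists (cx +i* cy)%C => n; apply: le_trans (nm_ReIm _) _.
rewrite ReD ImD ReN ImN /=; have := hx n; have := hy n.
by rewrite -!mulrA; lra.
Qed.

End Geometric.

(** * Cauchy and Taylor estimates on a normed space *)

Section ScalarHolomorphic.
Variables (R : realType) (V : normedModType (CC R)).
Local Notation C := (CC R).
Implicit Types (F : V -> C) (x h : V).

Lemma differentiable_line F x h (t : C) : differentiable F (x + t *: h) ->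
  differentiable (fun s : C => F (x + s *: h)) t /\
  'd (fun s : C => F (x + s *: h)) t 1 = 'd F (x + t *: h) h.
Proof.
move=> dF; pose l := fun s : C => x + s *: h.
have dl : is_diff t l (0 + *:%R^~ h) by apply: is_diffD.
have dl' : differentiable l t by case: dl.
split; first exact: (@differentiable_comp _ _ _ _ l F).
rewrite -[LHS]/('d (F \o l) t 1) diff_comp //=.
by rewrite (@diff_val _ _ _ _ _ _ _ dl) /= add0r scale1r.
Qed.

Lemma cauchy_dir F x (r M : R) h : 0 < r ->
  (forall y, nm (y - x) <= r -> differentiable F y) ->
  (forall y, nm (y - x) <= r -> nm (F y) <= M) ->
  nm ('d F x h) <= 8 * M * nm h / r.
Proof.
move=> r0 dF FM.
have xx : nm (x - x) <= r by rewrite subrr nm0 ltW.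
have M0 : 0 <= M by apply: le_trans (FM x xx); exact: nm_ge0.
have [->|h0] := eqVneq h 0; first by rewrite linear0 !nm0 mulr0 mul0r.
have nh : 0 < nm h by rewrite nm_gt0.
(* The disc of radius [2 * rho] on the complex line through [x] in direction [h] is then mapped into
   the ball of radius [r]. *)
pose rho := r / (2 * nm h).
have rho0 : 0 < rho by rewrite divr_gt0 //; lra.
have inb (z : C) : nm (z - 0) <= 2 * rho -> nm (x + z *: h - x) <= r.
  rewrite subr0 addrAC subrr add0r nmZ => hz.
  have -> : r = 2 * rho * nm h by rewrite /rho; field; lra.
  by apply: ler_wpM2r => //; exact: ltW.
have := @cauchy_deriv R (fun s => F (x + s *: h)) 0 rho M rho0.
have d0 : differentiable F (x + 0 *: h) by apply: dF; rewrite scale0r addr0.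
rewrite (differentiable_line d0).2 scale0r addr0.
have -> : 4 * M / rho = 8 * M * nm h / r by rewrite /rho; field; lra.
apply=> z /inb hz; last exact: FM.
by have [] := @differentiable_line F x h z (dF _ hz).
Qed.

Lemma segment_lipschitz F x h (L : R) : 0 <= L ->
  (forall t : R, 0 <= t <= 1 -> differentiable F (x + rc t *: h)) ->
  (forall t : R, 0 <= t <= 1 -> nm ('d F (x + rc t *: h) h) <= L) ->
  nm (F (x + h) - F x) <= L.
Proof.
move=> L0 dF dL.
have := @path_lipschitz R (fun t => F (x + rc t *: h)) (fun t => 'd F (x + rc t *: h) h) L L0 dL.
rewrite /rc rmorph0 rmorph1 scale1r scale0r addr0; apply => t t01 e e0.
have [d d0 hd] := differentiable_nm (differentiable_line (dF t t01)).1 e0.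
exists d => // u ut; have ut' : nm (rc (u - t)) < d by rewrite nm_realabs.
have := hd _ ut'; rewrite diff1Z (differentiable_line (dF t t01)).2 nm_realabs.
by rewrite (_ : rc t + rc (u - t) = rc u) // /rc -rmorphD; congr (_%:C)%C; ring.
Qed.

Lemma segment_in x h y (r : R) (t : R) : 0 <= t <= 1 ->
  nm (x - y) <= r -> nm (x + h - y) <= r -> nm (x + rc t *: h - y) <= r.
Proof.
move=> /andP[t0 t1] h1 h2.
have -> : x + rc t *: h - y = rc (1 - t) *: (x - y) + rc t *: (x + h - y).
  rewrite [x + _ - y]addrAC [x + h - y]addrAC; move: (x - y) => w.
  by rewrite /rc rmorphB rmorph1 scalerBl scale1r scalerDr addrA subrK.
apply: le_trans (nmD _ _) _; rewrite !nmZ !nm_real; try lra.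
by have -> : r = (1 - t) * r + t * r by [ring]; apply: lerD; apply: ler_wpM2l; lra.
Qed.

Lemma cauchy_lipschitz F x (r M : R) y z : 0 < r ->
  (forall y, nm (y - x) <= r -> differentiable F y) ->
  (forall y, nm (y - x) <= r -> nm (F y) <= M) ->
  nm (y - x) <= r / 2 -> nm (z - x) <= r / 2 ->
  nm (F y - F z) <= 16 * M * nm (y - z) / r.
Proof.
move=> r0 dF FM hy hz.
have M0 : 0 <= M by apply: le_trans (FM x _); rewrite ?subrr ?nm0 ?nm_ge0 // ltW.
rewrite -[y in F y](subrK z) [y - z + z]addrC.
have inb t : 0 <= t <= 1 -> nm (z + rc t *: (y - z) - x) <= r / 2.
  by move=> t01; apply: segment_in => //; rewrite [z + _]addrC subrK.
apply: segment_lipschitz => [|t /inb ht|t /inb ht].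
- by rewrite !mulr_ge0 ?nm_ge0 ?invr_ge0 // ltW.
- by apply: dF; lra.
have r2 : 0 < r / 2 by lra.
have := @cauchy_dir F (z + rc t *: (y - z)) (r / 2) M (y - z) r2.
rewrite (_ : 8 * M * _ / _ = 16 * M * nm (y - z) / r); last by field; lra.
have tri w : nm (w - (z + rc t *: (y - z))) <= r / 2 -> nm (w - x) <= r.
  move=> hw; rewrite -[w](subrK (z + rc t *: (y - z))) -addrA.
  by apply: le_trans (nmD _ _) _; lra.
by apply=> w /tri; [exact: dF | exact: FM].
Qed.

(** No second derivative is needed: the difference [G y = F (y + k) - F y] is bounded by a multiple
    of [|k|], and Cauchy's estimate applies to it. The constant is [512 = 8 * 16 * 4], the last
    factor from the radius [r / 4]. *)
Lemma deriv_lipschitz F x (r M : R) k h : 0 < r ->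
  (forall y, nm (y - x) <= r -> differentiable F y) ->
  (forall y, nm (y - x) <= r -> nm (F y) <= M) ->
  nm k <= r / 4 ->
  nm ('d F (x + k) h - 'd F x h) <= 512 * M * nm k * nm h / r ^+ 2.
Proof.
move=> r0 dF FM hk.
pose G y := F (y + k) - F y.
have r4 : 0 < r / 4 by lra.
have tri w : nm (w - x) <= r / 4 -> nm (w + k - x) <= r / 2.
  by move=> hw; rewrite addrAC; apply: le_trans (nmD _ _) _; lra.
have ds y : is_diff y (fun y : V => y + k) id.
  by have H := @is_diffD _ V V id (cst k) id 0 y _ _; rewrite addr0 in H; exact: H.
have dF1 y : nm (y + k - x) <= r / 2 -> differentiable (fun y => F (y + k)) y.
  move=> hy; apply: (@differentiable_comp _ _ _ _ (fun y => y + k) F).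
    by have [] := ds y.
  by apply: dF; lra.
have dG y : nm (y - x) <= r / 4 -> differentiable G y.
  move=> hy; apply: differentiableB; first by apply: dF1; exact: tri.
  by apply: dF; lra.
have xx : nm (x - x) <= r / 4 by rewrite subrr nm0; lra.
have -> : 'd F (x + k) h - 'd F x h = 'd G x h.
  have dxk := dF1 x (tri x xx).
  have dFx0 : differentiable F x by apply: dF; lra.
  have E1 := congr1 (fun g : V -> C => g h) (diffB dxk dFx0).
  apply: (etrans _ (esym E1)).
  congr (_ - _).
  have dk : differentiable (fun y : V => y + k) x by have [] := ds x.
  have dFx : differentiable F (x + k) by apply: dF; have := tri x xx; lra.
  have [_ E] := ds x; have E2 := congr1 (fun g : V -> C => g h) (diff_comp dk dFx).
  exact: (etrans (congr1 (fun g : V -> V => 'd F (x + k) (g h)) (esym E)) (esym E2)).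
have GM y : nm (y - x) <= r / 4 -> nm (G y) <= 16 * M * nm k / r.
  move=> hy; have := @cauchy_lipschitz F x r M (y + k) y r0 dF FM (tri y hy).
  by rewrite [y + k - y]addrAC subrr add0r; apply; lra.
have H := @cauchy_dir G x (r / 4) _ h r4 dG GM.
apply: (le_trans H).
by rewrite le_eqVlt; apply/orP; left; apply/eqP; field; lra.
Qed.

Lemma taylor2 F x (r M : R) k : 0 < r ->
  (forall y, nm (y - x) <= r -> differentiable F y) ->
  (forall y, nm (y - x) <= r -> nm (F y) <= M) ->
  nm k <= r / 4 ->
  nm (F (x + k) - F x - 'd F x k) <= 512 * M * nm k ^+ 2 / r ^+ 2.
Proof.
move=> r0 dF FM hk.
have M0 : 0 <= M by apply: le_trans (FM x _); rewrite ?subrr ?nm0 ?nm_ge0 // ltW.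
set L := 512 * M * nm k ^+ 2 / r ^+ 2.
have L0 : 0 <= L.
  apply: divr_ge0; last by apply: exprn_ge0; exact: ltW.
  by apply: mulr_ge0; [lra | apply: exprn_ge0; exact: nm_ge0].
have hkt (t : R) : 0 <= t <= 1 -> nm (rc t *: k) <= r / 4.
  by move=> /andP[t0 t1]; rewrite nmZ nm_real //; have := nm_ge0 k; nra.
have inb (t : R) : 0 <= t <= 1 -> nm (x + rc t *: k - x) <= r.
  by move=> /hkt; rewrite addrAC subrr add0r; lra.
have := @path_lipschitz R (fun t => F (x + rc t *: k) - rc t * 'd F x k)
  (fun t => 'd F (x + rc t *: k) k - 'd F x k) L L0.
rewrite /rc rmorph0 rmorph1 scale1r scale0r addr0 mul0r mul1r subr0.
rewrite (_ : F (x + k) - _ - F x = F (x + k) - F x - 'd F x k); last by ring.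
apply => t t01.
  apply: le_trans (deriv_lipschitz k r0 dF FM (hkt t t01)) _.
  rewrite /L [nm k ^+ 2]expr2 mulrA; apply: ler_wpM2r; first by rewrite invr_ge0 exprn_ge0 // ltW.
  apply: ler_wpM2r; first exact: nm_ge0.
  apply: ler_wpM2l; first by lra.
  move: t01 => /andP[t0 t1]; rewrite nmZ nm_real //; have := nm_ge0 k; nra.
move=> e e0.
have [d d0 hd] := differentiable_nm (differentiable_line (dF _ (inb t t01))).1 e0.
exists d => // u ut; have ut' : nm (rc (u - t)) < d by rewrite nm_realabs.
have := hd _ ut'; rewrite diff1Z (differentiable_line (dF _ (inb t t01))).2 nm_realabs.
have E : rc u = rc t + rc (u - t) by rewrite /rc -rmorphD; congr (_%:C)%C; ring.
rewrite -E -/(rc t) -/(rc u) -/(rc (u - t)).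
set X := nm _; set Y := nm _; suff -> : X = Y by [].
by rewrite /X /Y E; congr nm; ring.
Qed.

End ScalarHolomorphic.

(** * Weierstrass' convergence theorem *)

Section Weierstrass.
Variables (R : realType) (V : normedModType (CC R)).
Local Notation C := (CC R).
Implicit Types (F : V -> C) (x h : V).

Lemma bounded_linear_continuous (D : {linear V -> C}) (B : R) :
  (forall h, nm (D h) <= B * nm h) -> continuous D.
Proof.
move=> DB x; apply/continuous_nmP => e e0.
have B1 : 0 < `|B| + 1 by have := normr_ge0 B; lra.
exists (e / (`|B| + 1)); first exact: divr_gt0.
move=> y; rewrite ltr_pdivlMr // -linearB => h.
apply: le_lt_trans (DB _) _; have := ler_norm B; have := nm_ge0 (y - x); nra.
Qed.

Lemma quadratic_differentiable F x (D : V -> C) (B K d : R) : 0 < d -> 0 <= K ->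
  linear D -> (forall h, nm (D h) <= B * nm h) ->
  (forall h, nm h <= d -> nm (F (x + h) - F x - D h) <= K * nm h ^+ 2) ->
  differentiable F x /\ forall h, 'd F x h = D h.
Proof.
move=> d0 K0 Dl DB FD.
pose DM := GRing.isLinear.Build _ _ _ _ D Dl.
pose DL : {linear V -> C} := HB.pack D DM.
have [|//|h1 h2] := @nm_differentiable R V C F DL x; last first.
- by split=> // h; rewrite h2.
- move=> e e0; have K1 : 0 < K + 1 by lra.
  exists (Num.min d (e / (K + 1))) => [|h]; first by rewrite lt_min d0 divr_gt0.
  rewrite lt_min ltr_pdivlMr // => /andP[/ltW hd he].
  by apply: le_trans (FD h hd) _; have := nm_ge0 h; nra.
- exact: (@bounded_linear_continuous DL B DB).
Qed.

Lemma locally_bounded F x : differentiable F x ->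
  exists2 d : R, 0 < d & forall y, nm (y - x) <= d -> nm (F y) <= nm (F x) + 1.
Proof.
move=> /differentiable_continuous /continuous_nmP /(_ 1 ltr01)[d d0 hd].
exists (d / 2) => [|y hy]; first lra.
have yd : nm (y - x) < d by lra.
have := hd y yd; have := nmBl (F y) (F x); lra.
Qed.

(** By Cauchy's estimate the differentials of the [F_ n] converge geometrically too; their limit is
    linear, and the quadratic Taylor bound, uniform in [n], passes to the limit and exhibits it as
    the differential of the limit. *)
Lemma weierstrass (F_ : nat -> V -> C) x0 (r k B : R) : 0 <= k < 1 -> 0 <= B ->
  (forall n y, nm (y - x0) < r -> differentiable (F_ n) y) ->
  (forall n y, nm (y - x0) < r -> nm (F_ n.+1 y - F_ n y) <= B * k ^+ n) ->
  exists2 F, (forall y, nm (y - x0) < r -> differentiable F y) &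
    forall n y, nm (y - x0) < r -> nm (F_ n y - F y) <= 2 * B / (1 - k) * k ^+ n.
Proof.
move=> kk B0 dF cF.
have /boolp.choice[F hF] : forall y, exists c : C, nm (y - x0) < r ->
    forall n, nm (F_ n y - c) <= 2 * B / (1 - k) * k ^+ n.
  move=> y; have [hy|hy] := ltP (nm (y - x0)) r; last first.
    by exists 0.
  by have [c hc] := geo_cauchy kk B0 (fun n => cF n y hy); exists c.
set B' := 2 * B / (1 - k).
have /andP[k0 k1] := kk.
have B'0 : 0 <= B' by rewrite /B' !mulr_ge0 ?invr_ge0; lra.
exists F => [y yr|n y yr]; last exact: hF.
have [d1 d10 hd1] := locally_bounded (dF 0%N y yr).
pose d := Num.min d1 ((r - nm (y - x0)) / 2).
have d0 : 0 < d by rewrite lt_min d10 /=; lra.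
have inr z : nm (z - y) <= d -> nm (z - x0) < r.
  rewrite le_min => /andP[_ hz]; rewrite -[z](subrK y) -addrA.
  by apply: le_lt_trans (nmD _ _) _; lra.
have dF' n z : nm (z - y) <= d -> differentiable (F_ n) z by move=> /inr; exact: dF.
(* One bound for all the [F_ n] on the ball of radius [d]: passing from [F_ 0] to [F_ n] through the
   limit costs at most [2 * B']. *)
pose M := nm (F_ 0%N y) + 1 + 2 * B'.
have kn1 n : 0 <= k ^+ n <= 1 by rewrite exprn_ge0 // exprn_ile1 // ltW.
have FM n z : nm (z - y) <= d -> nm (F_ n z) <= M.
  move=> hz; have zr := inr z hz.
  have h0 : nm (F_ 0%N z) <= nm (F_ 0%N y) + 1.
    by apply: hd1; move: hz; rewrite le_min => /andP[].
  have -> : F_ n z = F_ 0%N z + (F_ n z - F z) - (F_ 0%N z - F z) by ring.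
  apply: le_trans (nmB _ _) _; have := nmD (F_ 0%N z) (F_ n z - F z).
  have := hF z zr n; have := hF z zr 0%N; rewrite expr0 -/B'.
  by have := kn1 n; rewrite /M; nra.
have M0 : 0 <= M by rewrite /M; have := nm_ge0 (F_ 0%N y); lra.
have dd n h : nm ('d (F_ n.+1) y h - 'd (F_ n) y h) <= (8 * B * nm h / d) * k ^+ n.
  have yy : nm (y - y) <= d by rewrite subrr nm0 ltW.
  have E := congr1 (fun g : V -> C => g h) (diffB (dF' n.+1 y yy) (dF' n y yy)).
  rewrite -[leLHS]/(nm (('d (F_ n.+1) y \- 'd (F_ n) y) h)) -E.
  have -> : 8 * B * nm h / d * k ^+ n = 8 * (B * k ^+ n) * nm h / d by ring.
  apply: (@cauchy_dir R V (F_ n.+1 - F_ n) y d (B * k ^+ n) h d0) => z hz.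
    by apply: differentiableB; exact: dF'.
  by apply: cF; exact: inr.
have /boolp.choice[D hD] : forall h, exists c : C,
    forall n, nm ('d (F_ n) y h - c) <= 2 * (8 * B * nm h / d) / (1 - k) * k ^+ n.
  move=> h; apply: geo_cauchy => //.
  by apply: divr_ge0; [apply: mulr_ge0; [lra | exact: nm_ge0] | exact: ltW].
have Dl : linear D.
  move=> a u v; apply/eqP; rewrite -subr_eq0; apply/eqP/nm0_eq0.
  pose E (w : V) := 2 * (8 * B * nm w / d) / (1 - k).
  apply: (@geo_le R k (E (a *: u + v) + nm a * E u + E v) _ 0 kk) => n; rewrite add0r.
  have := hD (a *: u + v) n; have := hD u n; have := hD v n; rewrite -!/(E _) linearP /=.
  set x1 := 'd _ _ _; set x2 := 'd _ _ _ => h1 h2 h3.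
  have -> : D (a *: u + v) - (a *: D u + D v) =
      a * (x2 - D u) + (x1 - D v) - (a *: x2 + x1 - D (a *: u + v)).
    by rewrite -[a *: D u]/(a * D u) -[a *: x2]/(a * x2); ring.
  apply: le_trans (nmB _ _) _; have := nmD (a * (x2 - D u)) (x1 - D v); rewrite nmM.
  by have := nm_ge0 a; nra.
have DB h : nm (D h) <= 8 * M / d * nm h.
  apply: (@geo_le R k (2 * (8 * B * nm h / d) / (1 - k))) => // n.
  have := hD h n; have := @cauchy_dir R V (F_ n) y d M h d0 (dF' n) (FM n).
  have -> : 8 * M * nm h / d = 8 * M / d * nm h by ring.
  by have := nmBl (D h) ('d (F_ n) y h); rewrite nmBC; lra.
have d40 : 0 < d / 4 by lra.
have K0 : 0 <= 512 * M / d ^+ 2 by apply: divr_ge0; [lra | apply: exprn_ge0; exact: ltW].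
apply: (@quadratic_differentiable F y D (8 * M / d) (512 * M / d ^+ 2) (d / 4) d40 K0 Dl DB _).1.
move=> h hd4.
apply: (@geo_le R k (2 * B' + 2 * (8 * B * nm h / d) / (1 - k))) => // n.
have := taylor2 d0 (dF' n) (FM n) hd4.
have yh : nm (y + h - y) <= d by rewrite addrAC subrr add0r; lra.
have := hF _ (inr _ yh) n; have := hF y yr n; have := hD h n.
set x1 := F_ n y; set x2 := F_ n (y + h); set x3 := 'd _ _ _.
rewrite -/B'; set E := 2 * (_ / d) / _ => h1 h2 h3 h4.
have -> : F (y + h) - F y - D h = (x2 - x1 - x3) - (x2 - F (y + h)) + (x1 - F y) + (x3 - D h).
  by ring.
apply: le_trans (nmD _ _) _; have := nmD (x2 - x1 - x3 - (x2 - F (y + h))) (x1 - F y).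
have := nmB (x2 - x1 - x3) (x2 - F (y + h)).
have -> : 512 * M / d ^+ 2 * nm h ^+ 2 = 512 * M * nm h ^+ 2 / d ^+ 2 by ring.
by lra.
Qed.

Lemma weierstrass_unique (F_ : nat -> V -> C) F G x (k B B' : R) : 0 <= k < 1 ->
  (forall n, nm (F_ n x - F x) <= B * k ^+ n) -> (forall n, nm (F_ n x - G x) <= B' * k ^+ n) ->
  F x = G x.
Proof.
move=> kk h1 h2; apply/eqP; rewrite -subr_eq0; apply/eqP/nm0_eq0.
apply: (@geo_le R k (B + B')) => // n.
have -> : F x - G x = (F_ n x - G x) - (F_ n x - F x) by ring.
by apply: le_trans (nmB _ _) _; have := h1 n; have := h2 n; lra.
Qed.

(** A directional derivative is the geometric limit of the difference quotients with steps
    [(1 / 2) ^+ n], by the quadratic Taylor bound, hence is holomorphic by [weierstrass]. *)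
Lemma deriv_differentiable F x (r : R) v : 0 < r ->
  (forall y, nm (y - x) < r -> differentiable F y) ->
  differentiable (fun y => 'd F y v) x.
Proof.
move=> r0 dF.
have xx : nm (x - x) < r by rewrite subrr nm0.
have [d1 d10 hd1] := locally_bounded (dF x xx).
pose d := Num.min d1 (r / 2).
have d0 : 0 < d by rewrite lt_min d10 /=; lra.
have dF' z : nm (z - x) <= d -> differentiable F z.
  by rewrite le_min => /andP[_ hz]; apply: dF; lra.
set M := nm (F x) + 1 in hd1.
have M0 : 0 <= M by rewrite /M; have := nm_ge0 (F x); lra.
have FM z : nm (z - x) <= d -> nm (F z) <= M.
  by rewrite le_min => /andP[hz _]; exact: hd1.
(* [v] is shrunk to a vector [w] of norm at most [d / 8], so that every quotient is taken inside the
   ball; the factor [c] is undone at the end. *)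
pose c := d / 8 / (nm v + 1).
have v1 : 0 < nm v + 1 by have := nm_ge0 v; lra.
have c0 : 0 < c by rewrite /c !divr_gt0 //.
have [w wE] : exists w, w = rc c *: v by exists (rc c *: v).
have wd : nm w <= d / 8.
  rewrite wE nmZ nm_real ?(ltW c0) // /c; rewrite mulrAC -[_ / (nm v + 1)]mulrA.
  by apply: ler_piMr; [lra | rewrite ler_pdivrMr //; lra].
have half : 0 <= (1 / 2 : R) < 1 by apply/andP; split; lra.
pose e n : R := (1 / 2) ^+ n.
have e01 n : 0 < e n <= 1 by rewrite /e exprn_gt0 ?exprn_ile1 //; lra.
pose G n y := (F (y + rc (e n) *: w) - F y) * (rc (e n))^-1.
pose B := 512 * M * nm w ^+ 2 / (d / 2) ^+ 2.
have ew n : nm (rc (e n) *: w) <= d / 8.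
  have /andP[e0 e1] := e01 n; rewrite nmZ nm_real ?(ltW e0) //; have := nm_ge0 w; nra.
have d2 : 0 < d / 2 by lra.
have tri y z : nm (y - x) < d / 4 -> nm (z - y) <= d / 2 -> nm (z - x) <= d.
  by move=> h1 h2; rewrite -[z](subrK y) -addrA; apply: le_trans (nmD _ _) _; lra.
have GB n y : nm (y - x) < d / 4 -> nm (G n y - 'd F y w) <= B * e n.
  move=> hy; have /andP[e0 e1] := e01 n.
  have dFy z : nm (z - y) <= d / 2 -> differentiable F z by move=> /(tri _ _ hy); exact: dF'.
  have FMy z : nm (z - y) <= d / 2 -> nm (F z) <= M by move=> /(tri _ _ hy); exact: FM.
  have ew' : nm (rc (e n) *: w) <= d / 2 / 4 by have := ew n; lra.
  have := taylor2 d2 dFy FMy ew'.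
  rewrite (_ : 'd F y (rc (e n) *: w) = rc (e n) * 'd F y w); last exact: linearZ.
  have rce : rc (e n) != 0 by rewrite -nm_gt0 nm_real // ltW.
  have -> : F (y + rc (e n) *: w) - F y - rc (e n) * 'd F y w = rc (e n) * (G n y - 'd F y w).
    by rewrite /G; field.
  rewrite nmM nmZ nm_real ?(ltW e0) // => h.
  rewrite -(ler_pM2l e0); apply: le_trans h _.
  by rewrite /B le_eqVlt; apply/orP; left; apply/eqP; ring.
have B0 : 0 <= B.
  apply: divr_ge0; last by apply: exprn_ge0; lra.
  by apply: mulr_ge0; [lra | apply: exprn_ge0; exact: nm_ge0].
have dG n y : nm (y - x) < d / 4 -> differentiable (G n) y.
  move=> hy; apply: differentiableM; last exact: differentiable_cst.
  apply: differentiableB; last by apply: dF'; lra.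
  apply: (@differentiable_comp _ _ _ _ (fun y => y + rc (e n) *: w) F).
    exact: differentiableD.
  apply: dF'; rewrite addrAC; apply: le_trans (nmD _ _) _; have := ew n; lra.
have B20 : 0 <= 2 * B by lra.
have [|H dH HB] := @weierstrass G x (d / 4) (1 / 2) (2 * B) half B20 dG.
  move=> n y hy; have -> : G n.+1 y - G n y = (G n.+1 y - 'd F y w) - (G n y - 'd F y w) by ring.
  apply: le_trans (nmB _ _) _; have := GB n y hy; have := GB n.+1 y hy.
  have /andP[e0 e1] := e01 n.
  have -> : e n.+1 = e n / 2 by rewrite /e exprS mulrC mul1r.
  by rewrite -/(e n); nra.
have d4 : 0 < d / 4 by lra.
have HE : \forall y \near x, rc c^-1 * H y = 'd F y v.
  apply/nearxP; exists (d / 4) => // y hy.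
  have -> : H y = 'd F y w.
    apply: (@weierstrass_unique G H (fun y => 'd F y w) y (1 / 2)) => [//|n|n]; first exact: HB.
    exact: GB.
  rewrite wE (_ : 'd F y (rc c *: v) = rc c * 'd F y v); last exact: linearZ.
  rewrite mulrA /rc -rmorphM mulVf ?rmorph1 ?mul1r //.
  by rewrite gt_eqF.
apply: (differentiable_near HE _).1.
apply: differentiableM; first exact: differentiable_cst.
by apply: dH; rewrite subrr nm0.
Qed.

End Weierstrass.

(** * Germs in several variables *)

Section RowSpaces.
Variable R : realType.
Local Notation C := (CC R).

Lemma rv_linear_continuous n (W : normedModType C) (L : {linear 'rV[C]_n -> W}) : continuous L.
Proof.
pose B := \sum_(i < n) nm (L (delta_mx 0 i)).
have B0 : 0 <= B by apply: sumr_ge0 => i _; exact: nm_ge0.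
have LB h : nm (L h) <= B * nm h.
  rewrite {1}[h]row_sum_delta linear_sum; apply: le_trans (nm_sum _) _.
  rewrite /B mulr_suml; apply: ler_sum => i _.
  rewrite linearZ nmZ mulrC; apply: ler_wpM2l; [exact: nm_ge0 | exact: nm_coord].
move=> x; apply/continuous_nmP => e e0; have B1 : 0 < B + 1 by lra.
exists (e / (B + 1)) => [|y]; first exact: divr_gt0.
rewrite ltr_pdivlMr // -linearB => h.
apply: le_lt_trans (LB _) _; have := nm_ge0 (y - x); nra.
Qed.

Lemma rv_linear_differentiable n (W : normedModType C) (L : {linear 'rV[C]_n -> W}) x :
  differentiable L x.
Proof. exact/linear_differentiable/rv_linear_continuous. Qed.

Lemma differentiable_row (V : normedModType C) n (F : V -> 'rV[C]_n) x :
  (forall j, differentiable (fun y => F y 0 j) x) -> differentiable F x.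
Proof.
move=> dF; rewrite (_ : F = \sum_(j < n) (fun y => F y 0 j *: (delta_mx 0 j : 'rV[C]_n))).
  by apply: differentiable_sum => j; apply: differentiableZl.
by apply/funext => y; rewrite fct_sumE; exact: row_sum_delta.
Qed.

Lemma differentiable_entry (V : normedModType C) n (F : V -> 'rV[C]_n) x j :
  differentiable F x -> differentiable (fun y => F y 0 j) x.
Proof.
move=> dF; apply: (@differentiable_comp _ _ _ _ F (fun M : 'rV[C]_n => M 0 j)) => //.
exact: differentiable_coord.
Qed.

(** Dyadic left-endpoint mean of [g] over [[a, a + s]], a stand-in for its integral divided by
    [s]. *)
Fixpoint avg n (g : R -> C) (a s : R) : C :=
  if n is n'.+1 then rc (1 / 2) * (avg n' g a (s / 2) + avg n' g (a + s / 2) (s / 2)) else g a.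

Lemma avg_sum n (I : finType) (c : I -> C) (g : I -> R -> C) a s :
  avg n (fun t => \sum_i c i * g i t) a s = \sum_i c i * avg n (g i) a s.
Proof.
elim: n a s => [//|n IH] a s /=; rewrite !IH -big_split mulr_sumr.
by apply: eq_bigr => i _ /=; ring.
Qed.

Lemma avg_cauchy n (g : R -> C) (L a s : R) : 0 <= s ->
  (forall t u, a <= t -> t <= u -> u <= a + s -> nm (g u - g t) <= L * (u - t)) ->
  nm (avg n.+1 g a s - avg n g a s) <= L * s / 4 * (1 / 2) ^+ n.
Proof.
elim: n a s => [|n IH] a s s0 gL.
  rewrite /= expr0 mulr1.
  have -> : rc (1 / 2) * (g a + g (a + s / 2)) - g a = rc (1 / 2) * (g (a + s / 2) - g a).
    have -> : g a = rc (1 / 2) * (g a + g a) by rewrite /rc fmorph_div rmorph1 rmorph_nat; field.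
    by rewrite /rc fmorph_div rmorph1 rmorph_nat; field.
  rewrite nmM nm_real; last lra.
  have := gL a (a + s / 2); rewrite (_ : a + s / 2 - a = s / 2); last ring.
  by move=> /(_ (lexx _)) h; have := h _ _; lra.
rewrite [avg n.+2 _ _ _]/(rc (1 / 2) * (avg n.+1 _ _ _ + avg n.+1 _ _ _))
        [in X in _ - X]/avg -/avg.
have s2 : 0 <= s / 2 by lra.
have := IH a (s / 2) s2 _; have := IH (a + s / 2) (s / 2) s2 _.
set x1 := avg _ _ _ _; set x2 := avg _ _ _ _; set y1 := avg _ _ _ _; set y2 := avg _ _ _ _.
move=> h1 h2.
have -> : rc (1 / 2) * (y1 + x1) - rc (1 / 2) * (y2 + x2) = rc (1 / 2) * ((y1 - y2) + (x1 - x2)).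
  by ring.
rewrite nmM nm_real; last lra.
have {}h1 : nm (x1 - x2) <= L * (s / 2) / 4 * (1 / 2) ^+ n.
  by apply: h1 => t u t1 tu u1; apply: gL; lra.
have {}h2 : nm (y1 - y2) <= L * (s / 2) / 4 * (1 / 2) ^+ n.
  by apply: h2 => t u t1 tu u1; apply: gL; lra.
have := nmD (y1 - y2) (x1 - x2); rewrite exprS.
by move: h1 h2; move: ((1 / 2) ^+ n) => k; lra.
Qed.

(** Fundamental theorem of calculus with an error: halving the step halves the total of the
    quadratic errors. *)
Lemma avg_increment n (f g : R -> C) (K a s : R) : 0 <= s ->
  (forall t u, a <= t -> t <= u -> u <= a + s ->
     nm (f u - f t - rc (u - t) * g t) <= K * (u - t) ^+ 2) ->
  nm (f (a + s) - f a - rc s * avg n g a s) <= K * s ^+ 2 * (1 / 2) ^+ n.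
Proof.
elim: n a s => [|n IH] a s s0 fK /=.
  by rewrite expr0 mulr1; have := fK a (a + s); rewrite (_ : a + s - a = s); [apply; lra | ring].
have s2 : 0 <= s / 2 by lra.
have h1 : nm (f (a + s / 2) - f a - rc (s / 2) * avg n g a (s / 2)) <= K * (s / 2) ^+ 2 * (1 / 2) ^+ n.
  by apply: IH => // t u t1 tu u1; apply: fK; lra.
have h2 : nm (f (a + s / 2 + s / 2) - f (a + s / 2) - rc (s / 2) * avg n g (a + s / 2) (s / 2)) <= K * (s / 2) ^+ 2 * (1 / 2) ^+ n.
  by apply: IH => // t u t1 tu u1; apply: fK; lra.
rewrite (_ : a + s / 2 + s / 2 = a + s) in h2; last by field.
have E : rc s * rc (1 / 2) = rc (s / 2) by rewrite /rc -rmorphM; congr (_%:C)%C; field.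
rewrite mulrA E; move: h1 h2; set x1 := avg _ _ _ _; set x2 := avg _ _ _ _ => h1 h2.
rewrite (_ : f (a + s) - f a - _ = (f (a + s / 2) - f a - rc (s / 2) * x1) +
  (f (a + s) - f (a + s / 2) - rc (s / 2) * x2)); last by ring.
apply: le_trans (nmD _ _) _; move: h1 h2; rewrite [_ ^+ n.+1]exprS; move: ((1 / 2) ^+ n) => k.
have -> : K * (s / 2) ^+ 2 * k = K * s ^+ 2 * (1 / 2 * k) / 2 by field.
by move=> h1 h2; lra.
Qed.

Lemma avg_differentiable (V : normedModType C) n (g : V -> R -> C) a s x : 0 <= s ->
  (forall t, a <= t <= a + s -> differentiable (fun y => g y t) x) ->
  differentiable (fun y => avg n (g y) a s) x.
Proof.
elim: n a s => [|n IH] a s s0 dg /=; first by apply: dg; lra.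
apply: differentiableM; first exact: differentiable_cst.
by apply: differentiableD; apply: IH => [|t tt]; try lra; apply: dg; lra.
Qed.

End RowSpaces.

(** * Hadamard's lemma *)

Section Germs.
Variables (R : realType) (n : nat).
Local Notation C := (CC R).
Implicit Types (F G : 'rV[C]_n -> C).

Lemma holo_ball F : holo_germ F -> exists r : R, 0 < r /\ exists2 M : R, 0 <= M &
  forall x, nm x <= r -> differentiable F x /\ nm (F x) <= M.
Proof.
move=> /near0P[r r0 dF]; have := dF 0; rewrite nm0 => /(_ r0) /locally_bounded[d d0 hd].
exists (Num.min d (r / 2)); rewrite lt_min d0 /=; split; first lra.
exists (nm (F 0) + 1) => [|x]; first by have := nm_ge0 (F 0); lra.
rewrite le_min => /andP[h1 h2]; split; first by apply: dF; lra.
by apply: hd; rewrite subr0.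
Qed.

Definition proj (P : pred 'I_n) (x : 'rV[C]_n) : 'rV[C]_n := \row_i (if P i then x 0 i else 0).

(** [G i] is the mean of the [i]-th partial derivative along the affine path [p x] from [proj P x]
    to [x]. The dyadic means are holomorphic in [x] and converge geometrically, so [weierstrass]
    makes [G i] holomorphic. *)
Lemma hadamard F (P : pred 'I_n) : holo_germ F ->
  exists2 G : 'I_n -> 'rV[C]_n -> C, (forall i, holo_germ (G i)) &
  \forall x \near (0 : 'rV[C]_n),
     F x - F (proj P x) = \sum_i (x 0 i - proj P x 0 i) * G i x.
Proof.
move=> /holo_ball[r [r0 [M M0 FM]]].
pose p (x : 'rV[C]_n) (t : R) : 'rV[C]_n := \row_i (if P i then x 0 i else rc t * x 0 i).
have p0 x : p x 0 = proj P x.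
  by apply/rowP => i; rewrite !mxE; case: (P i) => //; rewrite /rc rmorph0 mul0r.
have p1 x : p x 1 = x.
  by apply/rowP => i; rewrite !mxE; case: (P i) => //; rewrite /rc rmorph1 mul1r.
have pu x t u : p x u = p x t + rc (u - t) *: (x - proj P x).
  apply/rowP => i; rewrite !mxE; case: (P i); first by rewrite subrr mulr0 addr0.
  by rewrite subr0 -mulrDl /rc -rmorphD; congr (_%:C%C * _); ring.
have pn x t : 0 <= t <= 1 -> nm (p x t) <= nm x.
  move=> /andP[t0 t1]; apply: nm_rv_le; first exact: nm_ge0.
  move=> i; rewrite mxE; case: (P i); first exact: nm_coord.
  by rewrite nmM nm_real //; have := nm_coord x i; have := nm_ge0 (x 0 i); nra.
have dn x : nm (x - proj P x) <= nm x.
  apply: nm_rv_le => [|i]; first exact: nm_ge0.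
  by rewrite !mxE; case: (P i); rewrite ?subrr ?nm0 ?nm_ge0 // subr0 nm_coord.
have dp t x : differentiable (fun y => p y t) x.
  apply: differentiable_row => j.
  rewrite (_ : (fun y => _) = (fun y : 'rV[C]_n => (if P j then 1 else rc t) * y 0 j)).
    by apply: differentiableM; [exact: differentiable_cst | exact: differentiable_coord].
  by apply/funext => y; rewrite mxE; case: (P j); rewrite ?mul1r.
pose e i : 'rV[C]_n := delta_mx 0 i.
pose g i x t := 'd F (p x t) (e i).
have r2 : 0 < r / 2 by lra.
have r8 : 0 < r / 8 by lra.
have ball y : nm y <= r / 8 -> (forall z, nm (z - y) <= r / 2 -> differentiable F z) /\
    (forall z, nm (z - y) <= r / 2 -> nm (F z) <= M).
  by move=> hy; split=> z hz; have [] := FM z; rewrite // -[z](subrK y);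
     apply: le_trans (nmD _ _) _; lra.
pose ee i := nm (e i).
pose L i := 512 * M * (r / 8) * ee i / (r / 2) ^+ 2.
have gL i x t u : nm x < r / 8 -> 0 <= t -> t <= u -> u <= 1 -> nm (g i x u - g i x t) <= L i * (u - t).
  move=> hx t0 tu u1; rewrite /g (pu x t u).
  have t01 : 0 <= t <= 1 by rewrite t0 (le_trans tu).
  have [b1 b2] := ball (p x t) (le_trans (pn x t t01) (ltW hx)).
  have hk : nm (rc (u - t) *: (x - proj P x)) <= (u - t) * (r / 8).
    rewrite nmZ nm_real ?subr_ge0 //; apply: ler_wpM2l; first by rewrite subr_ge0.
    exact: le_trans (dn x) (ltW hx).
  have hk' : nm (rc (u - t) *: (x - proj P x)) <= r / 2 / 4.
    by apply: le_trans hk _; clear -t0 tu u1 r8; nra.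
  apply: le_trans (deriv_lipschitz (e i) r2 b1 b2 hk') _.
  rewrite /L -/(ee i); set w := nm _ in hk *.
  rewrite [X in _ <= X](_ : _ = 512 * M * ((u - t) * (r / 8)) * ee i / (r / 2) ^+ 2); last by ring.
  apply: ler_wpM2r; first by rewrite invr_ge0 exprn_ge0 // ltW.
  apply: ler_wpM2r; first exact: nm_ge0.
  by apply: ler_wpM2l; [exact: mulr_ge0 (ler0n _ _) M0 | exact: hk].
have L0 i : 0 <= L i.
  apply: divr_ge0; last by rewrite exprn_ge0 // ltW.
  by apply: mulr_ge0; [apply: mulr_ge0; lra | exact: nm_ge0].
have half : 0 <= (1 / 2 : R) < 1 by apply/andP; split; lra.
have dg i t x : nm x < r / 8 -> 0 <= t <= 1 -> differentiable (fun y => g i y t) x.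
  move=> hx t01.
  apply: (@differentiable_comp _ _ _ _ (fun y => p y t) (fun y => 'd F y (e i))); first exact: dp.
  apply: (@deriv_differentiable _ _ F (p x t) (r / 2)) => // y hy.
  by have [b1 _] := ball (p x t) (le_trans (pn x t t01) (ltW hx)); apply: b1; exact: ltW.
have /boolp.choice[G hG] : forall i, exists G, (forall y, nm y < r / 8 -> differentiable G y) /\
    forall N y, nm y < r / 8 ->
    nm (avg N (g i y) 0 1 - G y) <= 2 * (L i / 4) / (1 - 1 / 2) * (1 / 2) ^+ N.
  move=> i; have L4 : 0 <= L i / 4 by have := L0 i; lra.
  have [N y hy|N y hy|G G1 G2] := @weierstrass R 'rV[C]_n (fun N y => avg N (g i y) 0 1) 0 (r / 8) (1 / 2) (L i / 4) half L4.
  - rewrite subr0 in hy; apply: avg_differentiable => [//|t]; rewrite add0r => t01; exact: dg.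
  - rewrite subr0 in hy; have -> : L i / 4 = L i * 1 / 4 by rewrite mulr1.
    apply: avg_cauchy => // t u t0 tu; rewrite add0r => u1; exact: gL.
  by exists G; split=> [y hy|N y hy]; [apply: G1 | apply: G2]; rewrite subr0.
exists G => [i|].
  by apply/near0P; exists (r / 8) => // x hx; have [h _] := hG i; exact: h.
apply/near0P; exists (r / 8) => // x hx.
apply/eqP; rewrite -subr_eq0; apply/eqP/nm0_eq0.
pose c i := x 0 i - proj P x 0 i.
pose K := 512 * M * (r / 8) ^+ 2 / (r / 2) ^+ 2.
pose B := K + \sum_i nm (c i) * (2 * (L i / 4) / (1 - 1 / 2)).
apply: (@geo_le R (1 / 2) B _ 0 half) => N; rewrite add0r.
pose S := \sum_i c i * avg N (g i x) 0 1.
have h1 : nm (F x - F (proj P x) - S) <= K * (1 / 2) ^+ N.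
  have := @avg_increment R N (fun t => F (p x t)) (fun t => \sum_i c i * g i x t) K 0 1 ler01 _.
  rewrite add0r p0 p1 avg_sum -/S expr1n mulr1 /rc rmorph1 (mul1r S); apply=> t u t0 tu.
  move=> u1; have t01 : 0 <= t <= 1 by rewrite t0 (le_trans tu).
  have -> : \sum_i c i * g i x t = 'd F (p x t) (x - proj P x).
    rewrite [x - proj P x]row_sum_delta linear_sum; apply: eq_bigr => i _.
    by rewrite /c /g linearZ !mxE.
  have [b1 b2] := ball (p x t) (le_trans (pn x t t01) (ltW hx)).
  have hk : nm (rc (u - t) *: (x - proj P x)) <= (u - t) * (r / 8).
    rewrite nmZ nm_real ?subr_ge0 //; apply: ler_wpM2l; first by rewrite subr_ge0.
    exact: le_trans (dn x) (ltW hx).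
  have hk' : nm (rc (u - t) *: (x - proj P x)) <= r / 2 / 4.
    by apply: le_trans hk _; clear -t0 tu u1 r8; nra.
  have := taylor2 r2 b1 b2 hk'.
  rewrite -pu (_ : 'd F (p x t) (rc (u - t) *: (x - proj P x)) = rc (u - t) * 'd F (p x t) (x - proj P x)); last exact: linearZ.
  move=> h; apply: le_trans h _.
  rewrite [X in _ <= X](_ : _ = 512 * M * ((u - t) * (r / 8)) ^+ 2 / (r / 2) ^+ 2); last by rewrite /K; ring.
  apply: ler_wpM2r; first by rewrite invr_ge0 exprn_ge0 // ltW.
  apply: ler_wpM2l; first exact: mulr_ge0 (ler0n _ _) M0.
  by apply: (lerXn2r _ _ _ hk); rewrite nnegrE; [exact: nm_ge0 | exact: le_trans (nm_ge0 _) hk].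
have h2 : nm (S - \sum_i c i * G i x) <= \sum_i nm (c i) * (2 * (L i / 4) / (1 - 1 / 2)) * (1 / 2) ^+ N.
  rewrite /S -sumrB; apply: le_trans (nm_sum _) _; apply: ler_sum => i _.
  rewrite -mulrBr nmM -mulrA; apply: ler_wpM2l; first exact: nm_ge0.
  by have [_] := hG i; apply.
rewrite -/(c _) in h2 *.
rewrite (_ : F x - F (proj P x) - _ = (F x - F (proj P x) - S) + (S - \sum_i c i * G i x)); last by ring.
by apply: le_trans (nmD _ _) _; rewrite /B mulrDl mulr_suml; apply: lerD.
Qed.

End Germs.

(** * Calculus of germs and of vanishing orders *)

Section GermCalculus.
Variable R : realType.
Local Notation C := (CC R).

Lemma near_forall (V : normedModType C) (I : finType) (P : I -> V -> Prop) :
  (forall i, \forall x \near (0 : V), P i x) -> \forall x \near (0 : V), forall i, P i x.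
Proof. by move=> h; apply: (@filter_forall V I P (nbhs (0 : V)) _ h). Qed.

Lemma holo_near n (V : normedModType C) (F G : 'rV[C]_n -> V) :
  (\forall x \near (0 : 'rV[C]_n), F x = G x) -> holo_germ F -> holo_germ G.
Proof.
move=> /near0P[r r0 FG] /near0P[s s0 dF]; apply/near0P.
exists (Num.min r s) => [|x]; first by rewrite lt_min r0.
rewrite lt_min => /andP[xr xs]; apply: (differentiable_near _ (dF x xs)).1.
apply/nearxP; exists (r - nm x) => [|y hy]; first lra.
by apply: FG; rewrite -[y](subrK x); apply: le_lt_trans (nmD _ _) _; lra.
Qed.

Lemma holo_cst n (V : normedModType C) (c : V) : holo_germ (fun _ : 'rV[C]_n => c).
Proof. by apply/near0P; exists 1 => // x _; exact: differentiable_cst. Qed.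

Lemma holo_linear n (V : normedModType C) (L : {linear 'rV[C]_n -> V}) : holo_germ L.
Proof. by apply/near0P; exists 1 => // x _; exact: rv_linear_differentiable. Qed.

Lemma holo_id n : holo_germ (fun x : 'rV[C]_n => x).
Proof. by apply/near0P; exists 1 => // x _. Qed.

Lemma holoD n (V : normedModType C) (F G : 'rV[C]_n -> V) :
  holo_germ F -> holo_germ G -> holo_germ (fun x => F x + G x).
Proof. by move=> hF hG; near=> x; apply: differentiableD; near: x. Unshelve. all: by end_near. Qed.

Lemma holoB n (V : normedModType C) (F G : 'rV[C]_n -> V) :
  holo_germ F -> holo_germ G -> holo_germ (fun x => F x - G x).
Proof. by move=> hF hG; near=> x; apply: differentiableB; near: x. Unshelve. all: by end_near. Qed.

Lemma holoM n (F G : 'rV[C]_n -> C) :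
  holo_germ F -> holo_germ G -> holo_germ (fun x => F x * G x).
Proof. by move=> hF hG; near=> x; apply: differentiableM; near: x. Unshelve. all: by end_near. Qed.

Lemma holo_sum n (I : Type) (s : seq I) (P : pred I) (F : I -> 'rV[C]_n -> C) :
  (forall i, holo_germ (F i)) -> holo_germ (fun x => \sum_(i <- s | P i) F i x).
Proof.
move=> hF; elim: s => [|i s IH].
  by apply: (holo_near _ (@holo_cst n C 0)); near=> x; rewrite big_nil.
case Pi : (P i).
  by apply: (holo_near _ (holoD (hF i) IH)); near=> x; rewrite big_cons Pi.
by apply: (holo_near _ IH); near=> x; rewrite big_cons Pi.
Unshelve. all: by end_near. Qed.

Lemma holo_prod n (I : Type) (s : seq I) (P : pred I) (F : I -> 'rV[C]_n -> C) :
  (forall i, holo_germ (F i)) -> holo_germ (fun x => \prod_(i <- s | P i) F i x).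
Proof.
move=> hF; elim: s => [|i s IH].
  by apply: (holo_near _ (@holo_cst n C 1)); near=> x; rewrite big_nil.
case Pi : (P i).
  by apply: (holo_near _ (holoM (hF i) IH)); near=> x; rewrite big_cons Pi.
by apply: (holo_near _ IH); near=> x; rewrite big_cons Pi.
Unshelve. all: by end_near. Qed.

Lemma holoX n (F : 'rV[C]_n -> C) k : holo_germ F -> holo_germ (fun x => F x ^+ k).
Proof.
move=> hF; elim: k => [|k IH].
  by apply: (holo_near _ (@holo_cst n C 1)); near=> x; rewrite expr0.
by apply: (holo_near _ (holoM hF IH)); near=> x; rewrite exprS.
Unshelve. all: by end_near. Qed.

Lemma holo_coord n (i : 'I_n) : holo_germ (fun x : 'rV[C]_n => x 0 i : C).
Proof. by apply/near0P; exists 1 => // x _; exact: differentiable_coord. Qed.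

Lemma holo_entry n m (F : 'rV[C]_n -> 'rV[C]_m) i :
  holo_germ F -> holo_germ (fun x => F x 0 i).
Proof. by move=> hF; near=> x; apply: differentiable_entry; near: x. Unshelve. all: by end_near. Qed.

Lemma holo_row n m (F : 'rV[C]_n -> 'rV[C]_m) :
  (forall i, holo_germ (fun x => F x 0 i)) -> holo_germ F.
Proof.
move=> hF; have : \forall x \near (0 : 'rV[C]_n), forall i, differentiable (fun y => F y 0 i) x.
  exact: near_forall.
by apply: filterS => x hx; exact: differentiable_row.
Qed.

Lemma near_holo n m (G : 'rV[C]_n -> 'rV[C]_m) (P : 'rV[C]_m -> Prop) :
  holo_germ G -> G 0 = 0 -> (\forall y \near (0 : 'rV[C]_m), P y) ->
  \forall x \near (0 : 'rV[C]_n), P (G x).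
Proof.
move=> /near0P[s s0 dG] G0 /near0P[r r0 hP].
have := dG 0; rewrite nm0 => /(_ s0) /differentiable_continuous /continuous_nmP /(_ r r0)[d d0 hd].
apply/near0P; exists d => // x hx; apply: hP.
by have := hd x; rewrite subr0 G0 subr0; apply.
Qed.

Lemma holo_comp n m (V : normedModType C) (F : 'rV[C]_m -> V) (G : 'rV[C]_n -> 'rV[C]_m) :
  holo_germ F -> holo_germ G -> G 0 = 0 -> holo_germ (fun x => F (G x)).
Proof.
move=> hF hG G0; have hFG := near_holo hG G0 hF.
near=> x; apply: (@differentiable_comp _ _ _ _ G F); by near: x.
Unshelve. all: by end_near. Qed.

Lemma holo_neq0 n (F : 'rV[C]_n -> C) : holo_germ F -> F 0 != 0 ->
  exists2 m : R, 0 < m & \forall x \near (0 : 'rV[C]_n), m <= nm (F x).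
Proof.
move=> /near0P[s s0 dF] F0.
have nF0 : 0 < nm (F 0) / 2 by rewrite divr_gt0 // nm_gt0.
have := dF 0; rewrite nm0 => /(_ s0) /differentiable_continuous /continuous_nmP /(_ _ nF0)[d d0 hd].
exists (nm (F 0) / 2) => //; apply/near0P; exists d => // x hx.
by have := hd x; rewrite subr0 => /(_ hx); have := nmBl (F 0) (F x); rewrite nmBC; lra.
Qed.

Lemma holoV n (F : 'rV[C]_n -> C) : holo_germ F -> F 0 != 0 -> holo_germ (fun x => (F x)^-1).
Proof.
move=> hF F0; have [m m0 hm] := holo_neq0 hF F0.
near=> x; apply: differentiableV; first by near: x.
rewrite -nm_gt0; apply: (lt_le_trans m0); by near: x.
Unshelve. all: by end_near. Qed.

(** Vanishing to order at least [k], as a growth bound: it presupposes neither holomorphy nor a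
    Taylor expansion, and multiplies and composes by elementary estimates. *)
Definition ord n k (F : 'rV[C]_n -> C) := exists2 c : R, 0 <= c &
  \forall x \near (0 : 'rV[C]_n), nm (F x) <= c * nm x ^+ k.

Lemma ord_near n k (F G : 'rV[C]_n -> C) :
  (\forall x \near (0 : 'rV[C]_n), F x = G x) -> ord k F -> ord k G.
Proof.
move=> FG [c c0 hc]; exists c => //; near=> x.
have <- : F x = G x by near: x.
by near: x.
Unshelve. all: by end_near. Qed.

Lemma ordD n k (F G : 'rV[C]_n -> C) : ord k F -> ord k G -> ord k (fun x => F x + G x).
Proof.
move=> [c c0 hc] [d d0 hd]; exists (c + d); first lra.
near=> x; apply: le_trans (nmD _ _) _; rewrite mulrDl; apply: lerD; by near: x.
Unshelve. all: by end_near. Qed.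

Lemma ordZ n k a (F : 'rV[C]_n -> C) : ord k F -> ord k (fun x => a * F x).
Proof.
move=> [c c0 hc]; exists (nm a * c); first by rewrite mulr_ge0 ?nm_ge0.
near=> x; rewrite nmM -mulrA; apply: ler_wpM2l; first exact: nm_ge0.
by near: x.
Unshelve. all: by end_near. Qed.

Lemma ordB n k (F G : 'rV[C]_n -> C) : ord k F -> ord k G -> ord k (fun x => F x - G x).
Proof.
move=> hF hG; apply: (ord_near _ (ordD hF (ordZ (-1) hG))).
by near=> x; rewrite mulN1r.
Unshelve. all: by end_near. Qed.

Lemma ordM n k l (F G : 'rV[C]_n -> C) : ord k F -> ord l G -> ord (k + l) (fun x => F x * G x).
Proof.
move=> [c c0 hc] [d d0 hd]; exists (c * d); first by rewrite mulr_ge0.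
near=> x; rewrite nmM exprD [c * d * _](_ : _ = (c * nm x ^+ k) * (d * nm x ^+ l)); last by ring.
by apply: ler_pM; rewrite ?nm_ge0 //; near: x.
Unshelve. all: by end_near. Qed.

Lemma ord_sum n k (I : Type) (s : seq I) (F : I -> 'rV[C]_n -> C) :
  (forall i, ord k (F i)) -> ord k (fun x => \sum_(i <- s) F i x).
Proof.
move=> hF; elim: s => [|i s IH].
  by exists 0 => //; near=> x; rewrite big_nil nm0 mul0r.
by apply: (ord_near _ (ordD (hF i) IH)); near=> x; rewrite big_cons.
Unshelve. all: by end_near. Qed.

Lemma ord_leq n k l (F : 'rV[C]_n -> C) : (k <= l)%N -> ord l F -> ord k F.
Proof.
move=> kl [c c0 /near0P[r r0 hc]]; exists c => //.
apply/near0P; exists (Num.min r 1) => [|x]; first by rewrite lt_min r0 /=.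
rewrite lt_min => /andP[xr x1]; apply: le_trans (hc x xr) _; apply: ler_wpM2l => //.
rewrite -(subnK kl) exprD ler_piMl ?exprn_ge0 ?nm_ge0 //.
by rewrite exprn_ile1 ?nm_ge0 // ltW.
Qed.

Lemma ord_holo n (F : 'rV[C]_n -> C) : holo_germ F -> ord 0 F.
Proof.
move=> /holo_ball[r [r0 [M M0 h]]]; exists M => //; apply/near0P; exists r => // x xr.
by rewrite expr0 mulr1; have [] := h x (ltW xr).
Qed.

Lemma diff0_bound n (F : 'rV[C]_n -> C) : exists2 c : R, 0 <= c & forall h, nm ('d F 0 h) <= c * nm h.
Proof.
exists (\sum_(i < n) nm ('d F 0 (delta_mx 0 i))); first by apply: sumr_ge0 => i _; exact: nm_ge0.
move=> h; rewrite {1}[h]row_sum_delta linear_sum; apply: le_trans (nm_sum _) _.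
rewrite mulr_suml; apply: ler_sum => i _; rewrite linearZ nmM mulrC.
by apply: ler_wpM2l; [exact: nm_ge0 | exact: nm_coord].
Qed.

Lemma holo_ord2 n (F : 'rV[C]_n -> C) : holo_germ F -> ord 2 (fun x => F x - F 0 - 'd F 0 x).
Proof.
move=> /holo_ball[r [r0 [M M0 h]]].
exists (512 * M / r ^+ 2).
  by apply: divr_ge0; [lra | apply: exprn_ge0; exact: ltW].
have r4 : 0 < r / 4 by lra.
apply/near0P; exists (r / 4) => // x /ltW xr.
have h1 y : nm (y - 0) <= r -> differentiable F y by rewrite subr0 => /h[].
have h2 y : nm (y - 0) <= r -> nm (F y) <= M by rewrite subr0 => /h[].
by have := taylor2 r0 h1 h2 xr; rewrite add0r mulrAC.
Qed.

Lemma linear_ord1 n (F : 'rV[C]_n -> C) : ord 1 ('d F 0).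
Proof.
have [c c0 h] := diff0_bound F; exists c => //; near=> x; rewrite expr1; exact: h.
Unshelve. all: by end_near. Qed.

Lemma holo_ord1 n (F : 'rV[C]_n -> C) : holo_germ F -> F 0 = 0 -> ord 1 F.
Proof.
move=> hF F0; have h2 := ord_leq (isT : (1 <= 2)%N) (holo_ord2 hF).
apply: (ord_near _ (ordD h2 (linear_ord1 F))); near=> x.
by rewrite F0 subr0 subrK.
Unshelve. all: by end_near. Qed.

Lemma ord_gt0 n k (F : 'rV[C]_n -> C) : (0 < k)%N -> ord k F -> F 0 = 0.
Proof.
move=> k0 [c c0 /near0P[r r0 h]]; apply: nm0_eq0.
by have := h 0; rewrite nm0 => /(_ r0); rewrite expr0n; case: k k0 {h} => //= k _; rewrite mulr0.
Qed.

Lemma ord_comp n m k (F : 'rV[C]_m -> C) (G : 'rV[C]_n -> 'rV[C]_m) :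
  holo_germ G -> G 0 = 0 -> ord k F -> ord k (fun x => F (G x)).
Proof.
move=> hG G0 [c c0 hc]; have hc' := near_holo hG G0 hc.
have : forall i, exists d : R, 0 <= d /\ \forall x \near (0 : 'rV[C]_n), nm (G x 0 i) <= d * nm x.
  move=> i; have [||d d0 hd] := @holo_ord1 n (fun x => G x 0 i).
  - exact: holo_entry.
  - by rewrite G0 mxE.
  by exists d; split=> //; near=> x; rewrite -[nm x]expr1; near: x.
move=> /boolp.choice[d hd]; pose D := \sum_i d i.
have D0 : 0 <= D by apply: sumr_ge0 => i _; have [] := hd i.
have nG : \forall x \near (0 : 'rV[C]_n), forall i, nm (G x 0 i) <= d i * nm x.
  by apply: near_forall => i; have [] := hd i.
exists (c * D ^+ k); first by rewrite mulr_ge0 ?exprn_ge0.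
near=> x; have h1 : nm (F (G x)) <= c * nm (G x) ^+ k by near: x.
have h2 : forall i, nm (G x 0 i) <= d i * nm x by near: x.
apply: le_trans h1 _; rewrite -mulrA; apply: ler_wpM2l => //; rewrite -exprMn.
apply: lerXn2r; rewrite ?nnegrE ?nm_ge0 ?mulr_ge0 ?nm_ge0 //.
apply: nm_rv_le => [|i]; first by rewrite mulr_ge0 ?nm_ge0.
apply: le_trans (h2 i) _; apply: ler_wpM2r; first exact: nm_ge0.
by rewrite /D (bigD1 i) //= lerDl; apply: sumr_ge0 => j _; have [] := hd j.
Unshelve. all: by end_near. Qed.

(** On the ray through [x], the bound at [t *: x] divided by [t ^ k] still contains a positive power
    of [t], and [t] tends to 0. *)
Lemma homogeneous_ord n k l (P : 'rV[C]_n -> C) : (k < l)%N ->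
  (forall (t : C) x, P (t *: x) = t ^+ k * P x) -> ord l P -> forall x, P x = 0.
Proof.
move=> kl Ph [c c0 /near0P[r r0 hc]] x.
have x1 : 0 < nm x + 1 by have := nm_ge0 x; lra.
pose s := Num.min 1 (r / (nm x + 1) / 2).
have s0 : 0 < s by rewrite lt_min ltr01 /= !divr_gt0.
have s1 : s <= 1 by rewrite ge_min lexx.
have sr : s * nm x < r.
  have : s <= r / (nm x + 1) / 2 by rewrite ge_min lexx orbT.
  rewrite ler_pdivlMr // ler_pdivlMr // => h; have := nm_ge0 x; nra.
apply: nm0_eq0; apply: (@geo_le R (1 / 2) (c * s * nm x ^+ l)).
  by apply/andP; split; lra.
move=> m; rewrite add0r; pose t := s * (1 / 2) ^+ m.
have h0 : 0 < (1 / 2 : R) ^+ m by apply: exprn_gt0; lra.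
have h1 : (1 / 2 : R) ^+ m <= 1 by apply: exprn_ile1; lra.
have t0 : 0 < t by rewrite mulr_gt0.
have ts : t <= s by rewrite ger_pMr.
have tx : nm (rc t *: x) < r.
  rewrite nmZ nm_real ?(ltW t0) //; apply: le_lt_trans sr; apply: ler_wpM2r => //; exact: nm_ge0.
have := hc _ tx; rewrite Ph nmM nmX nmZ nm_real ?(ltW t0) // -(subnK kl) addnS -addSn.
rewrite [(t * nm x) ^+ _]exprMn [t ^+ (_ + _)]exprD => H.
have {}H : nm (P x) <= c * (t ^+ (l - k.+1).+1 * nm x ^+ ((l - k.+1).+1 + k)).
  rewrite -(ler_pM2l (exprn_gt0 k t0)).  apply: le_trans H _.
  by rewrite le_eqVlt; apply/orP; left; apply/eqP; ring.
apply: (le_trans H); rewrite -[X in _ <= X]mulrA -[X in _ <= X]mulrA; apply: ler_wpM2l => //.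
have -> : s * (nm x ^+ ((l - k.+1).+1 + k) * (1 / 2) ^+ m) = t * nm x ^+ ((l - k.+1).+1 + k).
  by rewrite /t; ring.
apply: ler_wpM2r; first by rewrite exprn_ge0 // nm_ge0.
rewrite exprS ger_pMr // exprn_ile1 ?(ltW t0) //.
exact: le_trans ts s1.
Qed.

Lemma diff0_unique n (g L : 'rV[C]_n -> C) : holo_germ g ->
  (forall (t : C) x, L (t *: x) = t * L x) ->
  ord 2 (fun x => g x - g 0 - L x) -> forall v, 'd g 0 v = L v.
Proof.
move=> hg hL h2 v; apply/eqP; rewrite -subr_eq0; apply/eqP.
apply: (@homogeneous_ord n 1 2 (fun x => 'd g 0 x - L x)) => // [t x|].
  have E : 'd g 0 (t *: x) = t * 'd g 0 x by exact: linearZ.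
  by rewrite E hL expr1 mulrBr.
apply: (ord_near _ (ordB h2 (holo_ord2 hg))).
by near=> x; set a := 'd g 0 x; ring.
Unshelve. all: by end_near. Qed.

End GermCalculus.

(** * Identity theorem and absence of zero divisors *)

Section Identity.
Variable R : realType.
Local Notation C := (CC R).

(** [g] can be divided by [t] indefinitely, each division costing a factor 16 in the bound on the
    unit disc; hence [|g t| <= M * (16 * |t|) ^ n] for all [n], which is why the conclusion is
    limited to [|t| < 1 / 32]. *)
Lemma identity_disc (g : C -> C) (M d : R) : 0 < d ->
  (forall t, nm t <= 1 -> differentiable g t) ->
  (forall t, nm t <= 1 -> nm (g t) <= M) ->
  (forall t, nm t < d -> g t = 0) ->
  forall t, nm t < 1 / 32 -> g t = 0.
Proof.
move=> d0 dg gM gd.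
have M0 : 0 <= M by apply: le_trans (gM 0 _); rewrite ?nm0 ?nm_ge0.
(* With the convention [0^-1 = 0] the quotients vanish near 0 like [g], so they are differentiable
   there as well. *)
pose h n := iter n (fun (u : C -> C) t => u t * t^-1) g.
have hd n t : nm t < d -> h n t = 0.
  by elim: n => [|n IH] td /=; [exact: gd | rewrite IH // mul0r].
have dh n t : nm t <= 1 -> differentiable (h n) t.
  move=> t1; have [td|td] := ltP (nm t) d.
    apply: (@differentiable_near _ _ _ (cst 0) (h n) t _ _).1.
      apply/nearxP; exists (d - nm t) => [|y hy]; first lra.
      by rewrite hd // -[y](subrK t); apply: le_lt_trans (nmD _ _) _; lra.
    exact: differentiable_cst.
  elim: n => [|n IH] /=; first exact: dg.
  apply: differentiableM; first exact: IH.
  apply: differentiable_Rinv.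
  by rewrite -nm_gt0; lra.
have hM n : forall t, nm t <= 1 -> nm (h n t) <= M * 16 ^+ n.
  elim: n => [|n IH] t t1; first by rewrite expr0 mulr1; exact: gM.
  have k0 : 0 <= M * 16 ^+ n by rewrite mulr_ge0 ?exprn_ge0.
  rewrite /h iterS -/(h n) nmM nmV exprS.
  have [->|t0] := eqVneq t 0; first by rewrite hd ?nm0 // mul0r; lra.
  have nt : 0 < nm t by rewrite nm_gt0.
  rewrite ler_pdivrMr //.
  have [t2|t2] := ltP (1 / 2) (nm t).
    by have := IH t t1; nra.
  have half : 0 <= (1 / 2 : R) by lra.
  have l1 : nm (t - 0) <= 1 / 2 by rewrite subr0.
  have l2 : nm ((0 : C) - 0) <= 1 / 2 by rewrite subr0 nm0.
  have b1 y : nm (y - 0) <= 1 -> differentiable (h n) y by rewrite subr0; exact: dh.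
  have b2 y : nm (y - 0) <= 1 -> nm (h n y) <= M * 16 ^+ n by rewrite subr0; exact: IH.
  have := cauchy_lipschitz ltr01 b1 b2 l1 l2; rewrite (hd n 0) ?nm0 // !subr0 divr1.
  by move=> H; apply: le_trans H _; lra.
move=> t t32; apply: nm0_eq0.
have half : 0 <= (1 / 2 : R) < 1 by apply/andP; split; lra.
have gh n : g t = h n t * t ^+ n.
  elim: n => [|n IH]; first by rewrite expr0 mulr1.
  rewrite IH /h iterS -/(h n) exprS; have [->|t0] := eqVneq t 0; last by field.
  by rewrite hd ?nm0 // !mul0r.
apply: (@geo_le R (1 / 2) M _ 0 half) => n; rewrite add0r (gh n) nmM nmX.
have t1 : nm t <= 1 by lra.
apply: (@le_trans _ _ (M * 16 ^+ n * nm t ^+ n)).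
  by apply: ler_wpM2r (hM n t t1); rewrite exprn_ge0 ?nm_ge0.
rewrite -mulrA -exprMn; apply: ler_wpM2l => //.
by apply: lerXn2r; rewrite ?nnegrE ?mulr_ge0 ?nm_ge0 //; lra.
Qed.

Lemma identity_ball (V : normedModType C) (F : V -> C) b (r M d : R) : 0 < r -> 0 < d ->
  (forall x, nm (x - b) <= r -> differentiable F x) ->
  (forall x, nm (x - b) <= r -> nm (F x) <= M) ->
  (forall x, nm (x - b) < d -> F x = 0) ->
  forall x, nm (x - b) < r / 32 -> F x = 0.
Proof.
move=> r0 d0 dF FM Fd x xb.
have [->|xb0] := eqVneq x b; first by apply: Fd; rewrite subrr nm0.
have n0 : 0 < nm (x - b) by rewrite nm_gt0 subr_eq0.
pose c : C := rc (nm (x - b) / r).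
have nc : nm c = nm (x - b) / r by rewrite nm_real // divr_ge0 ?nm_ge0 // ltW.
have c0 : c != 0 by rewrite -nm_gt0 nc divr_gt0.
pose v := c^-1 *: (x - b).
have nv : nm v = r by rewrite /v nmZ nmV nc invf_div mulfVK // gt_eqF.
have := @identity_disc (fun t => F (b + t *: v)) M (d / r) _ _ _ _ c.
have E t : b + t *: v - b = t *: v by rewrite addrAC subrr add0r.
have inb (t : C) : nm t <= 1 -> nm (b + t *: v - b) <= r.
  by rewrite E nmZ nv => t1; rewrite ler_piMl // ltW.
rewrite [c *: v]scalerA divff // scale1r addrC subrK; apply.
- exact: divr_gt0.
- by move=> t /inb ht; have [] := @differentiable_line _ _ F b v t (dF _ ht).
- by move=> t /inb; exact: FM.
- by move=> t; rewrite ltr_pdivlMr // => td; apply: Fd; rewrite E nmZ nv.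
- by rewrite nc ltr_pdivrMr //; lra.
Qed.

(** If [G] is not zero near 0 it is non-zero at points [b] arbitrarily close to 0, so [F] vanishes
    near such a [b], and then, by the identity theorem on a ball centred at [b], also near 0. *)
Lemma germ_domain n (F G : 'rV[C]_n -> C) : holo_germ F -> holo_germ G ->
  (\forall x \near (0 : 'rV[C]_n), F x * G x = 0) ->
  (\forall x \near (0 : 'rV[C]_n), F x = 0) \/ (\forall x \near (0 : 'rV[C]_n), G x = 0).
Proof.
move=> hF /near0P[s s0 hG] /near0P[u u0 hFG].
have [r [r0 [M M0 FM]]] := holo_ball hF.
have [Gz|Gnz] := pselect (\forall x \near (0 : 'rV[C]_n), G x = 0); [by right | left].
(* The ball of radius [r / 2] about [b] gives vanishing within [r / 64] of [b]; with [|b| < r / 128]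
   this covers all [x] with [|x| < r / 128]. *)
pose w := Num.min s (Num.min u (r / 128)).
have w0 : 0 < w by rewrite !lt_min s0 u0 /=; lra.
have [b bw Gb] : exists2 b : 'rV[C]_n, nm b < w & G b != 0.
  apply: contrapT => H; apply: Gnz; apply/near0P; exists w => // x xw.
  by apply/eqP; apply: contrapT => /negP Gx; apply: H; exists x.
move: bw; rewrite !lt_min => /and3P[bs bu br].
have nGb : 0 < nm (G b) by rewrite nm_gt0.
have /continuous_nmP/(_ _ nGb)[d d0 hd] := differentiable_continuous (hG b bs).
pose d' := Num.min d (u - nm b).
have d'0 : 0 < d' by rewrite lt_min d0 /=; lra.
have Fz x : nm (x - b) < d' -> F x = 0.
  rewrite lt_min => /andP[h1 h2]; have xu : nm x < u.
    by rewrite -[x](subrK b); apply: le_lt_trans (nmD _ _) _; lra.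
  have := hFG x xu; move/eqP; rewrite mulf_eq0 => /orP[/eqP //|/eqP Gx].
  by have := hd x h1; rewrite Gx sub0r nmN ltxx.
have r2 : 0 < r / 2 by lra.
have inr x : nm (x - b) <= r / 2 -> nm x <= r.
  by move=> h; rewrite -[x](subrK b); apply: le_trans (nmD _ _) _; lra.
apply/near0P; exists (r / 128) => [|x xr]; first lra.
apply: (@identity_ball 'rV[C]_n F b (r / 2) M d' r2 d'0) => [y|y||].
- by move=> /inr /FM[].
- by move=> /inr /FM[].
- exact: Fz.
- by apply: le_lt_trans (nmB _ _) _; lra.
Qed.

Lemma germ_domain_prod n (I : eqType) (s : seq I) (F : I -> 'rV[C]_n -> C) :
  (forall i, holo_germ (F i)) ->
  (\forall x \near (0 : 'rV[C]_n), \prod_(i <- s) F i x = 0) ->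
  exists2 i, i \in s & \forall x \near (0 : 'rV[C]_n), F i x = 0.
Proof.
move=> hF; elim: s => [|i s IH] h.
  have /near0P[r r0 /(_ 0)] := h; rewrite big_nil nm0 => /(_ r0) /eqP.
  by rewrite oner_eq0.
case: (@germ_domain n (F i) (fun x => \prod_(j <- s) F j x)) => //.
- exact: holo_prod.
- by apply: filterS h => x; rewrite big_cons.
- by exists i => //; rewrite mem_head.
- by move=> /IH[j js hj]; exists j => //; rewrite inE js orbT.
Qed.

Lemma holo_proj n (P : pred 'I_n) : holo_germ (@proj R n P).
Proof.
apply: holo_row => i; case Pi : (P i).
  by apply: (holo_near _ (@holo_coord R n i)); near=> x; rewrite mxE Pi.
by apply: (holo_near _ (@holo_cst R n C 0)); near=> x; rewrite mxE Pi.
Unshelve. all: by end_near. Qed.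

Lemma proj0 n (P : pred 'I_n) : @proj R n P 0 = 0.
Proof. by apply/rowP => i; rewrite !mxE if_same. Qed.

Lemma coord_division n (F : 'rV[C]_n -> C) (l : 'I_n) : holo_germ F ->
  (\forall x \near (0 : 'rV[C]_n), (x : 'rV[C]_n) 0 l = 0 -> F x = 0) ->
  exists2 G : 'rV[C]_n -> C, holo_germ G & \forall x \near (0 : 'rV[C]_n), F x = (x : 'rV[C]_n) 0 l * G x.
Proof.
move=> hF Fl; have [G hG GE] := hadamard (predC1 l) hF.
exists (G l) => //.
have Fp := near_holo (holo_proj (predC1 l)) (proj0 _) Fl.
near=> x; have : F x - F (proj (predC1 l) x) = \sum_i (x 0 i - proj (predC1 l) x 0 i) * G i x.
  by near: x.
have -> : F (proj (predC1 l) x) = 0.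
  have : proj (predC1 l) x 0 l = 0 -> F (proj (predC1 l) x) = 0 by near: x.
  by apply; rewrite mxE /= eqxx.
rewrite subr0 => ->; rewrite (bigD1 l) //= big1 ?addr0 => [|i il].
  by rewrite mxE /= eqxx subr0.
by rewrite mxE /= il subrr mul0r.
Unshelve. all: by end_near. Qed.

Lemma sqr_cover (a : C) (s : R) z : 0 < s -> sqr_pred a s z ->
  exists i j, sqr_pred (shiftsq a (s / 3) i j) (s / 3) z.
Proof.
move=> s0 [hx hy].
have cover (u v : R) : u <= v <= u + s ->
    exists i : 'I_3, u + s / 3 * i%:R <= v <= u + s / 3 * i%:R + s / 3.
  move=> /andP[h1 h2]; have [h3|h3] := leP v (u + s / 3).
    by exists (inord 0); rewrite inordK // mulr0; lra.
  have [h4|h4] := leP v (u + s / 3 * 2).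
    by exists (inord 1); rewrite inordK // mulr1; lra.
  by exists (inord 2); rewrite inordK //; lra.
have [i hi] := cover _ _ hx; have [j hj] := cover _ _ hy.
by exists i, j; rewrite /sqr_pred /shiftsq !reim /=; split; move: hi hj; lra.
Qed.

End Identity.

(** * Zero sets of non-units *)

Section NonUnits.
Variables (R : realType) (n : nat).
Local Notation C := (CC R).
Local Notation ones := (const_mx 1 : 'rV[C]_n).

Lemma nm_ones (t : C) : nm (t *: ones) <= nm t.
Proof. by apply: nm_rv_le => [|i]; rewrite ?nm_ge0 // !mxE mulr1. Qed.

(** Compactness of the annulus through [nested_squares]: near each point of it a lower bound holds
    by continuity, and it survives small translations [b]. The uniformity in [b] is what the next
    lemma needs. *)
Lemma annulus_lower_bound (F : 'rV[C]_n -> C) (rho r : R) : 0 < rho -> 2 * rho < r ->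
  (forall x, nm x < r -> differentiable F x) ->
  (forall t : C, rho <= nm t <= 2 * rho -> F (t *: ones) != 0) ->
  exists2 m : R, 0 < m & \forall b \near (0 : 'rV[C]_n),
    forall t : C, rho <= nm t <= 2 * rho -> m <= nm (F (b + t *: ones)).
Proof.
move=> rho0 rr dF Fnz.
pose Good (a : C) s := exists2 m : R, 0 < m & \forall b \near (0 : 'rV[C]_n),
    forall t : C, sqr_pred a s t -> rho <= nm t <= 2 * rho -> m <= nm (F (b + t *: ones)).
suff [m m0 hm] : Good (csq 0 (2 * rho)) (2 * (2 * rho)).
  exists m => //; apply: filterS hm => b hb t t2; apply: (hb t _ t2).
  have := nm_Re t; have := nm_Im t; rewrite !ler_norml => /andP[? ?] /andP[? ?].
  by case/andP: t2 => ? ?; rewrite /sqr_pred /csq !reim /=; split; apply/andP; split; lra.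
apply: contrapT => bad.
have [||//|c hc hn] := @nested_squares R (fun a s => ~ Good a s) (csq 0 (2 * rho)) (2 * (2 * rho)).
- lra.
- move=> a s s0 ba; apply: contrapT => H; apply: ba.
  have /boolp.choice[m hm] : forall ij : 'I_3 * 'I_3, exists m : R, 0 < m /\
     \forall b \near (0 : 'rV[C]_n), forall t : C, sqr_pred (shiftsq a (s / 3) ij.1 ij.2) (s / 3) t ->
       rho <= nm t <= 2 * rho -> m <= nm (F (b + t *: ones)).
    move=> ij; apply: contrapT => H'; apply: H; exists ij.1, ij.2 => -[m m0 hm].
    by apply: H'; exists m.
  have /near_forall hall : forall ij, _ := fun ij => (hm ij).2.
  pose m' := \big[Num.min/1]_ij m ij.
  exists m'; first by apply: lt_bigmin => // ij _; have [] := hm ij.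
  apply: filterS hall => b hb t st t2; have [i [j hij]] := sqr_cover s0 st.
  by apply: le_trans (hb (i, j) t hij t2); exact: bigmin_le_cond.
have [c1|c1] := ltP (nm c) rho.
  have [a [s [/andP[s0 s1] ac _]]] := hn ((rho - nm c) / 2) ltac:(lra).
  apply; exists 1 => //; apply: filterE => b t /(sqr_diam (ltW s0) ac) tc /andP[t1 _].
  by have := nmBl t c; rewrite nmBC; lra.
have [c2|c2] := ltP (2 * rho) (nm c).
  have [a [s [/andP[s0 s1] ac _]]] := hn ((nm c - 2 * rho) / 2) ltac:(lra).
  apply; exists 1 => //; apply: filterE => b t /(sqr_diam (ltW s0) ac) tc /andP[_ t1].
  by have := nmBl c t; lra.
have cr : nm (c *: ones) < r by apply: le_lt_trans (nm_ones c) _; lra.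
have Fc : 0 < nm (F (c *: ones)) / 2 by rewrite divr_gt0 // nm_gt0; apply: Fnz; rewrite c1.
have /continuous_nmP/(_ _ Fc)[d d0 hd] := differentiable_continuous (dF _ cr).
have [a [s [/andP[s0 s1] ac _]]] := hn (d / 4) ltac:(lra).
apply; exists (nm (F (c *: ones)) / 2) => //.
apply/near0P; exists (d / 2) => [|b bd t ts _]; first lra.
have tc := sqr_diam (ltW s0) ts ac.
have /hd : nm (b + t *: ones - c *: ones) < d.
  rewrite -addrA -scalerBl; apply: le_lt_trans (nmD _ _) _.
  by have := nm_ones (t - c); move: bd tc s0 s1 d0; clear; lra.
by rewrite nmBC; have := nmBl (F (c *: ones)) (F (b + t *: ones)); lra.
Qed.

(* On a line [b + t (1,..,1)] the only possible zeros of [F] are [t = - b_l];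
   if there were none, the mean value estimate for [1/F] would keep [F b]
   away from [0]. *)
Lemma nonunit_vanishes (F : 'rV[C]_n -> C) (Q : pred 'I_n) : holo_germ F -> F 0 = 0 ->
  (\forall x \near (0 : 'rV[C]_n), F x = 0 -> exists2 l, Q l & x 0 l = 0) ->
  exists2 l, Q l & \forall x \near (0 : 'rV[C]_n), (x : 'rV[C]_n) 0 l = 0 -> F x = 0.
Proof.
move=> hF F0 /near0P[r1 r10 hQ]; have /near0P[r2 r20 dF2] := hF.
pose r := Num.min r1 r2; have r0 : 0 < r by rewrite lt_min r10.
have dF x : nm x < r -> differentiable F x by rewrite lt_min => /andP[_]; exact: dF2.
have Qz x : nm x < r -> F x = 0 -> exists2 l, Q l & x 0 l = 0.
  by rewrite lt_min => /andP[+ _]; exact: hQ.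
pose rho := r / 8; have rho0 : 0 < rho by rewrite /rho; lra.
have r2rho : 2 * rho < r by rewrite /rho; lra.
have Fnz (t : C) : rho <= nm t <= 2 * rho -> F (t *: ones) != 0.
  move=> /andP[t1 t2]; apply/eqP => Ft.
  have tr : nm (t *: ones) < r by apply: le_lt_trans (nm_ones t) _; lra.
  have [l _] := Qz _ tr Ft; rewrite !mxE mulr1 => t0; move: t1; rewrite t0 nm0; lra.
have [m m0 hm] := annulus_lower_bound rho0 r2rho dF Fnz.
have r4 : 0 < r / 4 by lra.
have m2 : 0 < m / 2 by lra.
have F00 : nm (0 : 'rV[C]_n) < r by rewrite nm0.
have /continuous_nmP/(_ _ m2)[d d0 hd] := differentiable_continuous (dF _ F00).
have key : \forall b \near (0 : 'rV[C]_n), exists2 l, Q l & F ((b : 'rV[C]_n) - (b : 'rV[C]_n) 0 l *: ones) = 0.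
  have /near0P[d1 d10 hd1] := hm.
  apply/near0P; exists (Num.min d1 (Num.min d (r / 4))) => [|b]; first by rewrite !lt_min d10 d0 r4.
  rewrite !lt_min => /and3P[b1 b2 b3]; apply: contrapT => H.
  have inr (t : C) : nm t <= 2 * rho -> nm (b + t *: ones) < r.
    by move=> ht; apply: le_lt_trans (nmD _ _) _; have := nm_ones t; move: ht b3 r4 r0; rewrite /rho; clear; lra.
  have nz (t : C) : nm t <= 2 * rho -> F (b + t *: ones) != 0.
    move=> ht; apply/eqP => Ft; have [l Ql] := Qz _ (inr t ht) Ft.
    rewrite !mxE mulr1 => /eqP; rewrite addrC addr_eq0 => /eqP tb.
    by apply: H; exists l => //; rewrite -scaleNr -tb.
  have g1 (z : C) : nm (z - 0) <= 2 * rho -> differentiable (fun t : C => (F (b + t *: ones))^-1) z.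
    rewrite subr0 => z2; apply: differentiableV; last exact: nz.
    by have [] := @differentiable_line _ _ F b ones z (dF _ (inr z z2)).
  have g2 (z : C) : rho <= nm (z - 0) <= 2 * rho -> nm ((F (b + z *: ones))^-1) <= m^-1.
    rewrite subr0 nmV => z2.
    by rewrite lef_pV2 ?posrE //; [exact: hd1 | rewrite nm_gt0; apply: nz; case/andP: z2].
  (* The estimate reads [1 / |F b| <= 2 / m], while [|F b| < m / 2] for [b] within [d] of 0. *)
  have := cauchy_value rho0 g1 g2; rewrite scale0r addr0 nmV.
  have := hd b; rewrite F0 !subr0 => /(_ b2) Fb.
  have nFb : 0 < nm (F b) by have := nz 0; rewrite nm0 scale0r addr0 nm_gt0; apply; lra.
  rewrite -[X in _ <= X]invrK invfM invrK lef_pV2 ?posrE //; last by rewrite mulr_gt0 // invr_gt0.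
  by rewrite mulrC; lra.
(* By [key] the product of the [H l] with [Q l] vanishes near 0, so one factor does, germs having no
   zero divisors; on the hyperplane [b_l = 0] this factor is [F] itself. *)
pose H l (b : 'rV[C]_n) := F (b - b 0 l *: ones).
have hb l : holo_germ (fun b : 'rV[C]_n => b - b 0 l *: ones).
  apply: holo_row => i.
  apply: (holo_near _ (holoB (@holo_coord R n i) (@holo_coord R n l))).
  by near=> x; rewrite !mxE mulr1.
have hH l : holo_germ (H l).
  by apply: (holo_comp hF (hb l)); rewrite mxE scale0r subr0.
have [|l] := @germ_domain_prod R n _ [seq l <- enum 'I_n | Q l] H hH _.
  apply: filterS key => b [l Ql Fl]; apply/eqP; rewrite prodf_seq_eq0.
  by apply/hasP; exists l; [rewrite mem_filter Ql mem_enum | rewrite /= /H Fl].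
rewrite mem_filter => /andP[Ql _] Hl; exists l => //.
by apply: filterS Hl => x; rewrite /H => + xl; rewrite xl scale0r subr0.
Unshelve. all: by end_near. Qed.

End NonUnits.

(** * Inverse functions and factorization along hypersurfaces *)

Section InverseFunction.
Variable R : realType.
Local Notation C := (CC R).

Lemma flat_lipschitz n (g : 'rV[C]_n -> C) : holo_germ g -> (forall v, 'd g 0 v = 0) ->
  exists2 rho : R, 0 < rho & forall x y, nm x < rho -> nm y < rho ->
    nm (g x - g y) <= 1 / 2 * nm (x - y).
Proof.
move=> /holo_ball[r [r0 [M M0 h]]] g0.
have h1 y : nm (y - 0) <= r -> differentiable g y by rewrite subr0 => /h[].
have h2 y : nm (y - 0) <= r -> nm (g y) <= M by rewrite subr0 => /h[].
pose K := 512 * M / r ^+ 2.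
have K0 : 0 <= K by apply: divr_ge0; [lra | apply: exprn_ge0; exact: ltW].
pose rho := Num.min (r / 4) (1 / (2 * (K + 1))).
have K1 : 0 < 2 * (K + 1) by lra.
exists rho => [|x y xr yr]; first by rewrite lt_min; apply/andP; split; [lra | exact: divr_gt0].
have inb (t : R) : 0 <= t <= 1 -> nm (y + rc t *: (x - y)) < rho.
  move=> t01; pose m := Num.max (nm x) (nm y).
  have mr : m < rho by rewrite gt_max xr yr.
  apply: le_lt_trans mr; rewrite -[X in nm X]subr0; apply: segment_in => //.
    by rewrite subr0 le_max lexx orbT.
  by rewrite subr0 addrC subrK le_max lexx.
rewrite -[x in g x](subrK y) [x - y + y]addrC.
apply: segment_lipschitz => [|t /inb|t /inb]; first by rewrite mulr_ge0 ?nm_ge0 //; lra.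
  by rewrite lt_min => /andP[hr _]; apply: h1; rewrite subr0; lra.
move: (y + _) => z; rewrite lt_min => /andP[/ltW hr]; rewrite ltr_pdivlMr // => hK.
have := @deriv_lipschitz R _ g 0 r M z (x - y) r0 h1 h2 hr.
rewrite [X in nm X](_ : _ = 'd g z (x - y)).
  move=> H; apply: (le_trans H).
  rewrite [X in X <= _](_ : _ = K * nm z * nm (x - y)); last by rewrite /K; ring.
  by apply: ler_wpM2r; [exact: nm_ge0 | have := nm_ge0 z; nra].
have -> : 0 + z = z by exact: add0r.
have E : 'd g 0 (x - y) = 0 := g0 (x - y).
have E2 : 'd g z (x - y) - 'd g 0 (x - y) = 'd g z (x - y) - 0 := congr1 (fun w => 'd g z (x - y) - w) E.
exact: (etrans E2 (subr0 _)).
Qed.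

Lemma mulmx_bound n m (B : 'M[C]_(n, m)) : exists2 b : R, 0 < b &
  forall x : 'rV[C]_n, nm (x *m B) <= b * nm x.
Proof.
pose b := \sum_i \sum_j nm (B i j).
have b0 : 0 <= b by do 2!apply: sumr_ge0 => ? _; exact: nm_ge0.
exists (b + 1) => [|x]; first lra.
apply: nm_rv_le => [|j]; first by rewrite mulr_ge0 ?nm_ge0 //; lra.
rewrite mxE; apply: le_trans (nm_sum _) _; rewrite mulrDl mul1r.
apply: (@le_trans _ _ (b * nm x)); last by have := nm_ge0 x; lra.
rewrite /b mulr_suml; apply: ler_sum => i _; rewrite nmM mulrC.
apply: ler_pM; rewrite ?nm_ge0 ?nm_coord //.
by rewrite (bigD1 j) //= lerDl; apply: sumr_ge0 => k _; exact: nm_ge0.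
Qed.

(** Source and target sizes are kept formally distinct, with a two-sided inverse [B] of the
    Jacobian, so that charts into sums such as [q + m] require no cast. The map [G x = x - F x *m B]
    is flat at 0, hence 1/2-Lipschitz near 0. *)
Lemma inverse_function n m (F : 'rV[C]_n -> 'rV[C]_m) (A : 'M[C]_(n, m)) (B : 'M[C]_(m, n)) :
  holo_germ F -> F 0 = 0 ->
  (forall j v, 'd (fun x => F x 0 j) 0 v = (v *m A) 0 j) ->
  A *m B = 1%:M -> B *m A = 1%:M -> biholo_germ F.
Proof.
move=> hF F0 dFA AB BA; split=> //; split=> //.
pose G (x : 'rV[C]_n) := x - F x *m B.
have hB : holo_germ (fun y : 'rV[C]_m => y *m B) by exact: (@holo_linear R m _ (mulmxr B)).
have hG : holo_germ G by apply: holoB; [exact: holo_id | exact: (holo_comp hB hF F0)].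
have G0 : G 0 = 0 by rewrite /G F0 mul0mx subr0.
have hGi i : holo_germ (fun x => G x 0 i) := holo_entry i hG.
have dG i v : 'd (fun x => G x 0 i) 0 v = 0.
  apply: (@diff0_unique R n _ (fun _ => 0)) => // [t x|]; first by rewrite mulr0.
  have h2 : ord 2 (fun x => \sum_j B j i * (F x 0 j - F 0 0 j - 'd (fun x => F x 0 j) 0 x)).
    by apply: ord_sum => j; apply: ordZ; apply: holo_ord2; exact: holo_entry.
  apply: (ord_near _ (ordZ (-1) h2)); near=> x.
  have xE : x 0 i = \sum_j (x *m A) 0 j * B j i.
    by rewrite -[x in LHS]mulmx1 -AB mulmxA mxE.
  have GE : G x 0 i = \sum_j ((x *m A) 0 j - F x 0 j) * B j i.
    rewrite /G mxE xE 2!mxE -sumrB; apply: eq_bigr => j _; by rewrite mulrBl.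
  have G0i : G 0 0 i = 0 by rewrite G0 mxE.
  rewrite [X in _ = X - _ - _]GE G0i !subr0 mulN1r -sumrN.
  by apply: eq_bigr => j _; rewrite dFA F0 [(0 : 'rV[C]_m) 0 j]mxE; ring.
have GE x : G x = x - F x *m B by [].
clearbody G.
have /near_forall/near0P[rho1 rho10 hrho] : forall i, \forall z \near (0 : C),
    forall x y, nm x <= nm z -> nm y <= nm z -> nm (G x 0 i - G y 0 i) <= 1 / 2 * nm (x - y).
  move=> i; have [s s0 hs] := flat_lipschitz (hGi i) (dG i).
  by apply/near0P; exists s => // z zs x y xz yz; apply: hs; exact: le_lt_trans zs.
have [rho2 rho20 hrho2] : exists2 r : R, 0 < r & forall x, nm x < r -> differentiable G x.
  by move: hG => /near0P.
pose rho := Num.min (rho1 / 2) (rho2 / 2).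
have rho0 : 0 < rho by rewrite lt_min; apply/andP; split; lra.
have Glip x y : nm x <= rho -> nm y <= rho -> nm (G x - G y) <= 1 / 2 * nm (x - y).
  rewrite !le_min => /andP[x1 _] /andP[y1 _].
  apply: nm_rv_le => [|i]; first by rewrite mulr_ge0 ?nm_ge0 //; lra.
  have nr : nm (rc (rho1 / 2)) = rho1 / 2 by rewrite nm_real //; lra.
  have hz : nm (rc (rho1 / 2)) < rho1 by rewrite nr; lra.
  by rewrite 2!mxE; apply: (hrho _ hz i); rewrite nr; lra.
have dGr x : nm x <= rho -> differentiable G x.
  by rewrite le_min => /andP[_ ?]; apply: hrho2; lra.
have [b b0 hb] := mulmx_bound B.
pose d := rho / 2 / b; have d0 : 0 < d by rewrite !divr_gt0.
have yB (y : 'rV[C]_m) : nm y < d -> nm (y *m B) <= rho / 2.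
  by rewrite ltr_pdivlMr // [nm y * b]mulrC => h; exact: (le_trans (hb y) (ltW h)).
(* A fixed point of [x = y *m B + G x] satisfies [F x *m B = y *m B], that is [F x = y]. Each
   iterate is holomorphic in [y] and the convergence is geometric. *)
pose P k (y : 'rV[C]_m) := iter k (fun x => y *m B + G x) 0.
have Pr k y : nm y < d -> nm (P k y) <= rho.
  move=> /yB hy; elim: k => [|k IH]; first by rewrite nm0 ltW.
  rewrite /P iterS -/(P k y); apply: le_trans (nmD _ _) _.
  have := Glip _ _ IH (_ : nm 0 <= rho); rewrite nm0 => /(_ (ltW rho0)).
  by rewrite G0 !subr0; lra.
have Pc k y : nm y < d -> nm (P k.+1 y - P k y) <= rho / 2 * (1 / 2) ^+ k.
  move=> yd; elim: k => [|k IH].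
    by rewrite expr0 mulr1 /P /= G0 addr0 subr0; exact: yB.
  rewrite [P k.+2 y]/P iterS -/(P k.+1 y) [X in _ - X]/P iterS -/(P k y).
  rewrite opprD addrACA subrr add0r; apply: le_trans (Glip _ _ (Pr _ _ yd) (Pr _ _ yd)) _.
  by rewrite exprS; move: IH; move: ((1 / 2) ^+ k) => K; lra.
have dP k y : nm y < d -> differentiable (P k) y.
  move=> yd; elim: k => [|k IH]; first exact: (differentiable_cst 0).
  apply: differentiableD; first exact: (@rv_linear_differentiable R m _ (mulmxr B)).
  by apply: (@differentiable_comp _ _ _ _ (P k) G) => //; apply: dGr; exact: Pr.
have half : 0 <= (1 / 2 : R) < 1 by apply/andP; split; lra.
have rho2' : 0 <= rho / 2 by lra.
have /boolp.choice[S hS] : forall i, exists S : 'rV[C]_m -> C, (forall y, nm y < d -> differentiable S y) /\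
   forall k y, nm y < d -> nm (P k y 0 i - S y) <= 2 * (rho / 2) / (1 - 1 / 2) * (1 / 2) ^+ k.
  move=> i.
  have [k y|k y|S S1 S2] := @weierstrass R 'rV[C]_m (fun k y => P k y 0 i) 0 d (1 / 2) (rho / 2) half rho2'.
  - by rewrite subr0 => yd; apply: differentiable_entry; exact: dP.
  - rewrite subr0 => yd; apply: le_trans (Pc k y yd).
    have -> : P k.+1 y 0 i - P k y 0 i = (P k.+1 y - P k y) 0 i by rewrite !mxE.
    exact: nm_coord.
  by exists S; split=> [y yd|k y yd]; [apply: S1 | apply: S2]; rewrite subr0.
pose Psi y : 'rV[C]_n := \row_i S i y.
have PPsi k y : nm y < d -> nm (P k y - Psi y) <= 2 * rho * (1 / 2) ^+ k.
  move=> yd; apply: nm_rv_le => [|i].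
    by rewrite !mulr_ge0 ?exprn_ge0 //; lra.
  rewrite !mxE; have [_ h] := hS i; apply: le_trans (h k y yd) _.
  by rewrite (_ : 2 * (rho / 2) / _ = 2 * rho) //; field.
have Psir y : nm y < d -> nm (Psi y) <= rho.
  move=> yd; apply: (@geo_le R (1 / 2) (2 * rho) _ _ half) => k.
  have := PPsi k y yd; have := Pr k y yd; have := nmBl (Psi y) (P k y); rewrite nmBC; clear; lra.
have Psif y : nm y < d -> Psi y = y *m B + G (Psi y).
  move=> yd; apply/eqP; rewrite -subr_eq0; apply/eqP/nm0_eq0.
  apply: (@geo_le R (1 / 2) (4 * rho) _ _ half) => k; rewrite add0r.
  have -> : Psi y - (y *m B + G (Psi y)) = (G (P k y) - G (Psi y)) - (P k.+1 y - Psi y).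
    rewrite [P k.+1 y]/P iterS -/(P k y); move: (P k y) (y *m B) => a c.
    by apply/rowP => i; rewrite !mxE; ring.
  apply: le_trans (nmB _ _) _.
  have := Glip _ _ (Pr k y yd) (Psir y yd); have := PPsi k y yd; have := PPsi k.+1 y yd.
  have : 0 <= (1 / 2 : R) ^+ k by apply: exprn_ge0; lra.
  rewrite [_ ^+ k.+1]exprS; move: ((1 / 2) ^+ k) => K K0 h1 h2 h3; clear -K0 h1 h2 h3 rho0; nra.
have inj x y : nm x <= rho -> nm y <= rho -> F x = F y -> x = y.
  move=> xr yr Fxy; apply/eqP; rewrite -subr_eq0; apply/eqP/nm0_eq0.
  have := Glip x y xr yr; rewrite !GE Fxy opprB addrA subrK.
  by have := nm_ge0 (x - y); lra.
have FPsi y : nm y < d -> F (Psi y) = y.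
  move=> yd; have /eqP := Psif y yd; rewrite GE addrCA -subr_eq0 opprD addrA subrr add0r.
  rewrite oppr_eq0 subr_eq0 => /eqP /(congr1 (fun u => u *m A)).
  by rewrite -!mulmxA BA !mulmx1.
have Psi0 : Psi 0 = 0.
  have n0 : nm (0 : 'rV[C]_m) < d by rewrite nm0.
  by apply: inj; rewrite ?nm0 ?(ltW rho0) ?Psir // FPsi.
exists Psi; split=> //; split; last split.
- apply: holo_row => i; apply/near0P; exists d => // y yd.
  have [h _] := hS i; apply: (differentiable_near _ (h y yd)).1.
  by near=> z; rewrite mxE.
- have : \forall y \near (0 : 'rV[C]_m), nm y < d by apply/near0P; exists d.
  move=> /(near_holo hF F0) /near0P[s s0 hs].
  apply/near0P; exists (Num.min s rho) => [|x]; first by rewrite lt_min s0.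
  rewrite lt_min => /andP[xs xr]; have Fxd := hs x xs.
  by apply: inj; [exact: Psir | exact: ltW | exact: FPsi].
- by apply/near0P; exists d.
Unshelve. all: by end_near. Qed.

End InverseFunction.

(** * Factorization of [phi_k o f] into a unit and a monomial *)

Section Factorization.
Variable R : realType.
Local Notation C := (CC R).

Lemma near0_const n (P : 'rV[C]_n -> Prop) : (\forall x \near (0 : 'rV[C]_n), P x) ->
  exists2 t : C, t != 0 & P (const_mx t).
Proof.
move=> /near0P[r r0 hP]; exists (rc (r / 2)).
  by rewrite -nm_gt0 nm_real; lra.
apply: hP; apply: (@le_lt_trans _ _ (r / 2)); last lra.
by apply: nm_rv_le => [|i]; rewrite ?mxE ?nm_real //; lra.
Qed.

(** Restrict to the hyperplane [x_l = 0]: the monomial does not involve [x_l], so its restriction is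
    not the zero germ, as a constant vector shows, and it can be cancelled. *)
Lemma coord_cancel n (F : 'rV[C]_n -> C) (l : 'I_n) (a : 'I_n -> nat) : holo_germ F -> a l = 0%N ->
  (\forall x \near (0 : 'rV[C]_n), (x : 'rV[C]_n) 0 l = 0 -> F x * \prod_i x 0 i ^+ a i = 0) ->
  \forall x \near (0 : 'rV[C]_n), (x : 'rV[C]_n) 0 l = 0 -> F x = 0.
Proof.
move=> hF al hz; pose pr := @proj R n (predC1 l).
have hpr : holo_germ pr := @holo_proj R n _.
have pr0 : pr 0 = 0 := @proj0 R n _.
pose m (x : 'rV[C]_n) := \prod_i x 0 i ^+ a i.
have hm : holo_germ m by apply: holo_prod => i; apply: holoX; exact: holo_coord.
case: (@germ_domain R n (fun x => F (pr x)) (fun x => m (pr x))).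
- exact: (holo_comp hF hpr pr0).
- exact: (holo_comp hm hpr pr0).
- by apply: filterS (near_holo hpr pr0 hz) => x; apply; rewrite mxE /= eqxx.
- apply: filterS => x hx xl; rewrite -hx; congr F; apply/rowP => i.
  by rewrite mxE /=; have [->|] := eqVneq i l.
- move=> /near0_const[t t0 /eqP]; rewrite prodf_seq_eq0 => /hasP[i _] /=.
  rewrite mxE /= mxE; have [->|il] := eqVneq i l; first by rewrite al expr0 oner_eq0.
  by rewrite expf_eq0 (negPf t0) andbF.
Qed.

(** Divisibility by each power separately gives divisibility by the product: coordinates are treated
    in turn and powers one at a time, [coord_cancel] removing the part already divided out. *)
Lemma monomial_division n (F : 'rV[C]_n -> C) (a : 'I_n -> nat) : holo_germ F ->
  (forall l, exists2 e : 'rV[C]_n -> C, holo_germ e &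
     \forall x \near (0 : 'rV[C]_n), F x = (x : 'rV[C]_n) 0 l ^+ a l * e x) ->
  exists2 c : 'rV[C]_n -> C, holo_germ c &
     \forall x \near (0 : 'rV[C]_n), F x = c x * \prod_i (x : 'rV[C]_n) 0 i ^+ a i.
Proof.
move=> hF hdiv.
suff H (s : seq 'I_n) : uniq s -> exists2 c : 'rV[C]_n -> C, holo_germ c &
     \forall x \near (0 : 'rV[C]_n), F x = c x * \prod_(i <- s) (x : 'rV[C]_n) 0 i ^+ a i.
  exact: H (index_enum_uniq _).
elim: s => [_|l s IH /= /andP[ls us]].
  by exists F => //; near=> x; rewrite big_nil mulr1.
have [c hc Fc] := IH us; have [e he Fe] := hdiv l.
suff H j : (j <= a l)%N -> exists2 c' : 'rV[C]_n -> C, holo_germ c' &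
    \forall x \near (0 : 'rV[C]_n), c x = (x : 'rV[C]_n) 0 l ^+ j * c' x.
  have [c' hc' cc'] := H _ (leqnn _); exists c' => //.
  by apply: filterS2 Fc cc' => x -> ->; rewrite big_cons; ring.
elim: j => [_|j IHj jl].
  by exists c => //; near=> x; rewrite expr0 mul1r.
have [c' hc' cc'] := IHj (ltnW jl).
pose P (x : 'rV[C]_n) := \prod_(i <- s) x 0 i ^+ a i.
have hP : holo_germ P by apply: holo_prod => i; apply: holoX; exact: holo_coord.
have hx k : holo_germ (fun x : 'rV[C]_n => x 0 l ^+ k) by apply: holoX; exact: holo_coord.
have c'P : \forall x \near (0 : 'rV[C]_n), c' x * P x - (x : 'rV[C]_n) 0 l ^+ (a l - j) * e x = 0.
  case: (@germ_domain R n (fun x => x 0 l ^+ j)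
      (fun x => c' x * P x - x 0 l ^+ (a l - j) * e x)) => //.
  - by apply: holoB; apply: holoM.
  - apply: filterS3 Fc Fe cc' => x E1 E2 E3; rewrite mulrBr !mulrA -exprD subnKC; last exact: ltnW.
    by rewrite -E2 -E3 E1 subrr.
  - move=> /near0_const[t t0 /eqP]; rewrite mxE expf_eq0 (negPf t0) andbF.
    by [].
pose a' i := if i \in s then a i else 0%N.
have sP x : P x = \prod_i x 0 i ^+ a' i.
  rewrite /P big_uniq //=.
  rewrite big_mkcond; apply: eq_bigr => i _; rewrite /a'.
  by case: (i \in s); rewrite ?expr0.
have c'l : \forall x \near (0 : 'rV[C]_n), (x : 'rV[C]_n) 0 l = 0 -> c' x = 0.
  apply: (@coord_cancel n c' l a') => //; first by rewrite /a' (negPf ls).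
  apply: filterS c'P => x /eqP; rewrite subr_eq0 sP => /eqP -> xl.
  by rewrite xl -(subnSK jl) exprS !mul0r.
have [c2 hc2 E] := coord_division hc' c'l.
exists c2 => //; apply: filterS2 cc' E => x -> ->.
by rewrite exprSr mulrA.
Unshelve. all: by end_near. Qed.

(** If the quotient [c] vanished at 0, it would vanish on a hyperplane [x_l = 0] with [Q l], and one
    more factor [x_l] could be extracted, against the maximality of [a l]. *)
Lemma monomial_unit n (F : 'rV[C]_n -> C) (Q : pred 'I_n) (a : 'I_n -> nat) : holo_germ F ->
  (\forall x \near (0 : 'rV[C]_n), F x = 0 -> exists2 l, Q l & (x : 'rV[C]_n) 0 l = 0) ->
  (forall l, exists2 e : 'rV[C]_n -> C, holo_germ e &
     \forall x \near (0 : 'rV[C]_n), F x = (x : 'rV[C]_n) 0 l ^+ a l * e x) ->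
  (forall l, Q l -> ~ exists2 e : 'rV[C]_n -> C, holo_germ e &
     \forall x \near (0 : 'rV[C]_n), F x = (x : 'rV[C]_n) 0 l ^+ (a l).+1 * e x) ->
  exists c : 'rV[C]_n -> C, [/\ holo_germ c, c 0 != 0 &
     \forall x \near (0 : 'rV[C]_n), F x = c x * \prod_i (x : 'rV[C]_n) 0 i ^+ a i].
Proof.
move=> hF hQ hdiv hndiv; have [c hc Fc] := monomial_division hF hdiv.
exists c; split=> //; apply/eqP => c0.
have [|l Ql cl] := @nonunit_vanishes R n c Q hc c0.
  near=> x => cx; have : F x = 0 -> exists2 l, Q l & x 0 l = 0 by near: x.
  apply; have -> : F x = c x * \prod_i x 0 i ^+ a i by near: x.
  by rewrite cx mul0r.
have [c2 hc2 E] := coord_division hc cl.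
apply: (hndiv l Ql); exists (fun x => c2 x * \prod_(i < n | i != l) x 0 i ^+ a i).
  by apply: holoM => //; apply: holo_prod => i; apply: holoX; exact: holo_coord.
near=> x; have -> : F x = c x * \prod_i x 0 i ^+ a i by near: x.
have -> : c x = x 0 l * c2 x by near: x.
by rewrite (bigD1 l) //= exprS; ring.
Unshelve. all: by end_near. Qed.

Definition grad n m (F : 'I_m -> 'rV[C]_n -> C) : 'M[C]_(m, n) :=
  \matrix_(k, i) 'd (F k) 0 (delta_mx 0 i).

Lemma gradE n m (F : 'I_m -> 'rV[C]_n -> C) k v : 'd (F k) 0 v = (v *m (grad F)^T) 0 k.
Proof.
rewrite [v in LHS]row_sum_delta linear_sum mxE; apply: eq_bigr => i _.
by rewrite linearZ !mxE.
Qed.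

Lemma transversal_row_free d q (phi : 'I_q -> 'rV[C]_d -> C) :
  transversal_smooth_hypersurfaces phi -> row_free (grad phi).
Proof.
move=> [_ H]; apply: inj_row_free => v v0; apply/rowP => k; rewrite mxE.
apply: (H (fun k => v 0 k)) => w.
have -> : \sum_(k < q) v 0 k * 'd (phi k) 0 w = (w *m (v *m grad phi)^T) 0 0.
  rewrite trmx_mul mulmxA mxE; apply: eq_bigr => i _.
  by rewrite gradE [(v^T) _ _]mxE mulrC.
by rewrite v0 trmx0 mulmx0 mxE.
Qed.

Lemma complete_rows d q (A : 'M[C]_(q, d)) : row_free A ->
  exists m (N : 'M[C]_(m, d)), row_free (col_mx A N) /\ row_full (col_mx A N).
Proof.
move=> fA; exists _, (row_base (A^C)%MS).
have E : (col_mx A (row_base (A^C)%MS) :=: 1%:M)%MS.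
  apply/eqmxP; rewrite submx1 /=.
  rewrite -(addsmxE A) (adds_eqmx (eqmx_refl _) (eq_row_base _)).
  by apply: submx_full; exact: addsmx_compl_full.
rewrite /row_free /row_full E mxrank1; split=> //.
by rewrite mxrank_compl (eqP fA) subnKC // -(eqP fA) rank_leq_col.
Qed.

Lemma transversal_chart d q (phi : 'I_q -> 'rV[C]_d -> C) :
  transversal_smooth_hypersurfaces phi ->
  exists m (Theta : 'rV[C]_d -> 'rV[C]_(q + m)), biholo_germ Theta /\
    forall k x, Theta x 0 (lshift m k) = phi k x.
Proof.
move=> tr; have [hphi _] := tr.
have [m [N [fN uN]]] := complete_rows (transversal_row_free tr).
pose Theta (x : 'rV[C]_d) : 'rV[C]_(q + m) := row_mx (\row_k phi k x) (x *m N^T).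
exists m, Theta; split; last by move=> k x; rewrite row_mxEl mxE.
have fA : row_full (col_mx (grad phi) N)^T by rewrite /row_full mxrank_tr.
have uA : row_free (col_mx (grad phi) N)^T by rewrite /row_free mxrank_tr.
have hN j : holo_germ (fun x : 'rV[C]_d => (x *m N^T) 0 j).
  exact/holo_entry/(@holo_linear R _ _ (mulmxr N^T)).
have EL k : (fun x => Theta x 0 (lshift m k)) = phi k.
  by apply/funext => x; rewrite row_mxEl mxE.
have ER k : (fun x => Theta x 0 (rshift q k)) = fun x => (x *m N^T) 0 k.
  by apply/funext => x; rewrite row_mxEr.
apply: (@inverse_function R d (q + m) Theta _ _ _ _ _ (mulmxVp uA) (mulVpmx fA)).
- apply: holo_row => j; case: (splitP j) => k jk.
    by have -> : j = lshift m k by [apply: val_inj]; rewrite EL; case: (hphi k).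
  by have -> : j = rshift q k by [apply: val_inj]; rewrite ER.
- apply/rowP => j; case: (splitP j) => k jk.
    have -> : j = lshift m k by apply: val_inj.
    by rewrite row_mxEl !mxE; case: (hphi k).
  have -> : j = rshift q k by apply: val_inj.
  by rewrite row_mxEr mul0mx !mxE.
- move=> j v; rewrite tr_col_mx mul_mx_row; case: (splitP j) => k jk.
    have -> : j = lshift m k by apply: val_inj.
    by rewrite EL row_mxEl gradE.
  have -> : j = rshift q k by apply: val_inj.
  rewrite ER row_mxEr; apply: (@diff0_unique R d _ (fun v => (v *m N^T) 0 k) (hN k)) => [t x|]; first by rewrite -scalemxAl mxE.
  by exists 0 => //; near=> x; rewrite mul0mx [X in _ - X - _]mxE subr0 subrr nm0 mul0r.
Unshelve. all: by end_near. Qed.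

(** Backward invariance; with rigidity it confines the zeros of [phi_k o f] to the union of the
    [W^l]. *)
Lemma in_crit_inf_pull d (f : 'rV[C]_d -> 'rV[C]_d) x : in_crit_inf f (f x) -> in_crit_inf f x.
Proof. by move=> [n hn]; exists n.+1; rewrite iterSr. Qed.

(** In a chart whose first [q] coordinates are the [phi_l], this is [monomial_unit] with [Q]
    selecting those coordinates; the matrix [A] provides exact divisibility along each of them. *)
Lemma pullback_factorization d q (f : 'rV[C]_d -> 'rV[C]_d) (phi : 'I_q -> 'rV[C]_d -> C)
    (A : 'I_q -> 'I_q -> nat) :
  holo_germ f -> f 0 = 0 -> rigid_with f phi -> pullback_matrix f phi A ->
  forall k, exists c : 'rV[C]_d -> C, [/\ holo_germ c, c 0 != 0 &
    \forall x \near (0 : 'rV[C]_d), phi k (f x) = c x * \prod_l phi l x ^+ A k l].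
Proof.
move=> hf f0 [tr crit] pm k; have [hphi _] := tr.
have [m [Th [bi Tphi]]] := transversal_chart tr.
have [T0 [hT [Psi [P0 [hPsi [PT TP]]]]]] := bi.
pose F x := phi k (f (Psi x)).
have fP0 : f (Psi 0) = 0 by rewrite P0.
have hfP : holo_germ (fun x => f (Psi x)) := holo_comp hf hPsi P0.
have hF : holo_germ F by exact: (holo_comp (hphi k).1 hfP fP0).
pose Q (l : 'I_(q + m)) := (l < q)%N.
(* The complementary coordinates of the chart receive exponent 0. *)
pose a (l : 'I_(q + m)) := if fintype.split l is inl l' then A k l' else 0%N.
have aL l : a (lshift m l) = A k l by rewrite /a (unsplitK (inl l : 'I_q + 'I_m)).
have aR l : a (rshift q l) = 0%N by rewrite /a (unsplitK (inr l : 'I_q + 'I_m)).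
have coordE l : \forall x \near (0 : 'rV[C]_(q + m)), phi l (Psi x) = (x : 'rV[C]_(q + m)) 0 (lshift m l).
  by apply: filterS TP => x Tx; rewrite -Tphi Tx.
have zeros : \forall x \near (0 : 'rV[C]_d), phi k (f x) = 0 -> exists l, phi l x = 0.
  have fcrit := near_holo hf f0 crit.
  near=> x => h; have [h1 _] : in_crit_inf f x <-> exists l, phi l x = 0 by near: x.
  apply: h1; apply: in_crit_inf_pull.
  have [_ h2] : in_crit_inf f (f x) <-> exists l, phi l (f x) = 0 by near: x.
  by apply: h2; exists k.
have toF (n : nat) l : germ_dvd (fun x => phi l x ^+ n) (phi k \o f) <->
    exists2 e : 'rV[C]_(q + m) -> C, holo_germ e &
     \forall x \near (0 : 'rV[C]_(q + m)), F x = (x : 'rV[C]_(q + m)) 0 (lshift m l) ^+ n * e x.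
  split=> [[c [hc Ec]]|[e he Ee]].
    exists (fun x => c (Psi x)); first exact: (holo_comp hc hPsi P0).
    have Ec' := near_holo hPsi P0 Ec; have El := coordE l.
    near=> x; have <- : phi l (Psi x) = x 0 (lshift m l) by near: x.
    by near: x.
  exists (fun x => e (Th x)); split; first exact: (holo_comp he hT T0).
  have Ee' := near_holo hT T0 Ee.
  near=> x; rewrite -Tphi; have <- : F (Th x) = Th x 0 (lshift m l) ^+ n * e (Th x) by near: x.
  by rewrite /F /=; congr (phi k (f _)); apply/esym; near: x.
have [||l Ql|c [hc c0 Ec]] := @monomial_unit (q + m) F Q a hF.
- have zF := near_holo hPsi P0 zeros.
  have /near_forall cE := coordE.
  near=> x => Fx; have : phi k (f (Psi x)) = 0 -> exists l, phi l (Psi x) = 0 by near: x.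
  move=> /(_ Fx) [l hl]; exists (lshift m l); first by rewrite /Q /= ltn_ord.
  have h : forall l, phi l (Psi x) = x 0 (lshift m l) by near: x.
  by rewrite -h.
- move=> l; case: (splitP l) => l' ll'.
    have -> : l = lshift m l' by apply: val_inj.
    by rewrite aL; apply/toF; case: (pm k l').
  have -> : l = rshift q l' by apply: val_inj.
  by exists F => //; near=> x; rewrite aR expr0 mul1r.
- have [l0 lE] : exists l0, l = lshift m l0 by exists (Ordinal Ql); apply: val_inj.
  rewrite {l Ql}lE.
  by rewrite aL => /toF; case: (pm k l0).
exists (fun x => c (Th x)); split; first exact: (holo_comp hc hT T0).
  by rewrite T0.
have Ec' := near_holo hT T0 Ec.
near=> x.
have PTx : Psi (Th x) = x by near: x.
have Ex : F (Th x) = c (Th x) * \prod_i Th x 0 i ^+ a i by near: x.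
rewrite -[x in LHS]PTx -/(F (Th x)) Ex.
rewrite big_split_ord /= [X in _ * (_ * X)]big1 ?mulr1 => [|i _]; last by rewrite aR.
by congr (_ * _); apply: eq_bigr => i _; rewrite aL Tphi.
Unshelve. all: by end_near. Qed.

End Factorization.

(** * Contracting germs *)

Section Contraction.
Variable R : realType.
Local Notation C := (CC R).

(** [J] is the Jacobian at 0 in the row convention. Stated through [ord], it turns the chain rule
    into arithmetic of orders and identifies Jacobians by uniqueness. *)
Definition first_order n m (f : 'rV[C]_n -> 'rV[C]_m) (J : 'M[C]_(n, m)) :=
  forall j, ord 2 (fun x => f x 0 j - (x *m J) 0 j).

Lemma first_order_comp n m p (f : 'rV[C]_n -> 'rV[C]_m) (g : 'rV[C]_m -> 'rV[C]_p) J K :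
  holo_germ f -> f 0 = 0 -> first_order f J -> first_order g K ->
  first_order (fun x => g (f x)) (J *m K).
Proof.
move=> hf f0 fJ gK j.
have h1 := ord_comp hf f0 (gK j).
have h2 : ord 2 (fun x => \sum_i K i j * (f x 0 i - (x *m J) 0 i)).
  by apply: ord_sum => i; apply: ordZ; exact: fJ.
apply: (ord_near _ (ordD h1 h2)); near=> x.
rewrite mulmxA [(x *m J *m K) 0 j]mxE [(f x *m K) 0 j]mxE.
under [X in _ + X]eq_bigr => i _ do rewrite mulrBr ![K i j * _]mulrC.
by rewrite sumrB addrA subrK.
Unshelve. all: by end_near. Qed.

Lemma first_order_id n : first_order (fun x : 'rV[C]_n => x) 1%:M.
Proof.
by move=> j; exists 0 => //; near=> x; rewrite mulmx1 subrr nm0 mul0r.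
Unshelve. all: by end_near. Qed.

Lemma first_order_diff n m (f : 'rV[C]_n -> 'rV[C]_m) J : holo_germ f -> f 0 = 0 -> first_order f J ->
  forall j v, 'd (fun x => f x 0 j) 0 v = (v *m J) 0 j.
Proof.
move=> hf f0 fJ j; apply: (@diff0_unique R n _ (fun v => (v *m J) 0 j) (holo_entry j hf)) => [t x|].
  by rewrite -scalemxAl mxE.
by apply: (ord_near _ (fJ j)); near=> x; rewrite f0 [(0 : 'rV[C]_m) 0 j]mxE subr0.
Unshelve. all: by end_near. Qed.

Lemma holo_first_order n m (f : 'rV[C]_n -> 'rV[C]_m) : holo_germ f -> f 0 = 0 ->
  first_order f (jac f 0).
Proof.
move=> hf f0 j; have df : differentiable f 0 by have /near0P[r r0 h] := hf; apply: (h 0); rewrite nm0.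
pose L (v : 'rV[C]_n) := ('d f 0 v) 0 j.
have E : forall v, 'd (fun x => f x 0 j) 0 v = L v.
  move=> v; have dj : differentiable (fun M : 'rV[C]_m => M 0 j : C) (f 0) by exact: differentiable_coord.
  have E1 := congr1 (fun g : 'rV[C]_n -> C => g v) (diff_comp df dj).
  apply: (etrans E1); rewrite /L -[LHS]/('d (fun M : 'rV[C]_m => M 0 j : C) (f 0) ('d f 0 v)).
  move: ('d f 0 v) => w; rewrite f0.
  apply: (@diff0_unique R m _ (fun w : 'rV[C]_m => w 0 j) (@holo_coord R m j)) => [t x|].
    by rewrite mxE.
  by exists 0 => //; near=> x; rewrite [(0 : 'rV[C]_m) 0 j]mxE subr0 subrr nm0 mul0r.
apply: (ord_near _ (holo_ord2 (holo_entry j hf))); near=> x.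
by rewrite f0 [(0 : 'rV[C]_m) 0 j]mxE subr0 E /L /jac mul_rV_lin1.
Unshelve. all: by end_near. Qed.

Lemma iter_fixed n (f : 'rV[C]_n -> 'rV[C]_n) k : f 0 = 0 -> iter k f 0 = 0.
Proof. by move=> f0; elim: k => //= k ->. Qed.

Lemma holo_iter n (f : 'rV[C]_n -> 'rV[C]_n) k : holo_germ f -> f 0 = 0 -> holo_germ (iter k f).
Proof.
move=> hf f0; elim: k => [|k IH]; first exact: holo_id.
by have := holo_comp hf IH (iter_fixed k f0).
Qed.

Fixpoint mpow n (J : 'M[C]_n) k : 'M[C]_n := if k is k'.+1 then mpow J k' *m J else 1%:M.

Lemma mpowC n (J : 'M[C]_n) i : mpow J i *m J = J *m mpow J i.
Proof. by elim: i => [|i IH] /=; rewrite ?mulmx1 ?mul1mx // {1}IH mulmxA. Qed.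

Lemma first_order_iter n (f : 'rV[C]_n -> 'rV[C]_n) J k : holo_germ f -> f 0 = 0 ->
  first_order f J -> first_order (iter k f) (mpow J k).
Proof.
move=> hf f0 fJ; elim: k => [|k IH]; first exact: first_order_id.
by have := first_order_comp (holo_iter k hf f0) (iter_fixed k f0) IH fJ.
Qed.

(** Induction on the annihilating factors: [x J^(i+1)] is [l] times [x J^i] plus [(x (J - l)) J^i],
    and the second term decays by induction. *)
Lemma mpow_decay n (J : 'M[C]_n) (ls : seq C) : (forall l, l \in ls -> nm l < 1) ->
  forall x : 'rV[C]_n, foldl (fun y l => y *m (J - l%:M)) x ls = 0 ->
  exists c k : R, [/\ 0 <= c, 0 <= k < 1 & forall i, nm (x *m mpow J i) <= c * k ^+ i].
Proof.
elim: ls => [_ x /= ->|l ls IH hl x /= hx].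
  exists 0, 0; split=> [//||i]; first by apply/andP; split; lra.
  by rewrite mul0mx nm0 mul0r.
have [|c [k [c0 /andP[k0 k1] h]]] := IH _ _ hx.
  by move=> l' l'l; apply: hl; rewrite inE l'l orbT.
have l1 : nm l < 1 by apply: hl; rewrite mem_head.
pose k' := Num.max (nm l) k.
have k'1 : k' < 1 by rewrite gt_max l1.
have k'0 : 0 <= k' by rewrite le_max nm_ge0.
have lk : nm l <= k' by rewrite le_max lexx.
have kk : k <= k' by rewrite le_max lexx orbT.
(* A rate strictly above both [|l|] and [k] absorbs the polynomial growth caused by repeated
   roots. *)
pose k2 := (1 + k') / 2.
pose c' := nm x + c / (k2 - k').
have kd : 0 < k2 - k' by rewrite /k2; lra.
have c'c : c <= c' * (k2 - k').
  by rewrite /c' mulrDl divfK ?gt_eqF // lerDr mulr_ge0 ?nm_ge0 // ltW.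
have c'0 : 0 <= c' by rewrite /c' addr_ge0 ?nm_ge0 // divr_ge0 // ltW.
exists c', k2; split=> //; first by apply/andP; rewrite /k2; split; lra.
elim=> [|i IHi].
  by rewrite /= mulmx1 expr0 mulr1 /c' lerDl divr_ge0 // ltW.
have E : x *m mpow J i.+1 = l *: (x *m mpow J i) + (x *m (J - l%:M)) *m mpow J i.
  by rewrite /= mpowC mulmxBr mulmxBl mulmxA mul_mx_scalar -scalemxAl addrC subrK.
rewrite E; apply: le_trans (nmD _ _) _; rewrite nmZ.
have k2k : k ^+ i <= k2 ^+ i by apply: lerXn2r; rewrite ?nnegrE // /k2; lra.
have := h i; have : 0 <= k2 ^+ i by apply: exprn_ge0; rewrite /k2; lra.
rewrite exprS => h1 h2.
have h3 : nm l * nm (x *m mpow J i) <= k' * (c' * k2 ^+ i) by apply: ler_pM; rewrite ?nm_ge0.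
have h4 : c * k ^+ i <= c * k2 ^+ i by apply: ler_wpM2l.
have h5 : c * k2 ^+ i <= c' * (k2 - k') * k2 ^+ i by apply: ler_wpM2r.
have -> : c' * (k2 * k2 ^+ i) = k' * (c' * k2 ^+ i) + c' * (k2 - k') * k2 ^+ i by ring.
by apply: lerD h3 _; exact: (le_trans h2 (le_trans h4 h5)).
Qed.

Lemma bernoulli_pow (a : R) n : 0 <= a <= 1 -> 1 - n%:R * a <= (1 - a) ^+ n.
Proof.
move=> /andP[a0 a1]; elim: n => [|n IH]; first by rewrite mul0r expr0; lra.
rewrite exprS -natr1; have : 0 <= (n%:R : R) by exact: ler0n.
move: (n%:R) IH => u; move: ((1 - a) ^+ n) => p h u0; nra.
Qed.

(** Decay of whole orbits up to a factor [c]: eigenvalues of modulus below 1 do not make the sup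
    norm decrease at the first step. Positive iterates satisfy the same estimate with the same
    constants. *)
Definition contracts n (F : 'rV[C]_n -> 'rV[C]_n) (c k r : R) :=
  [/\ 1 <= c, 0 < k < 1, 0 < r & forall x, nm x < r -> forall i, nm (iter i F x) <= c * k ^+ i * nm x].

Lemma linear_bound n m (f : 'rV[C]_n -> 'rV[C]_m) : holo_germ f -> f 0 = 0 ->
  exists2 c : R, 0 <= c & \forall x \near (0 : 'rV[C]_n), nm (f x) <= c * nm x.
Proof.
move=> hf f0.
have /boolp.choice[d hd] : forall i, exists d : R, 0 <= d /\
    \forall x \near (0 : 'rV[C]_n), nm (f x 0 i) <= d * nm x.
  move=> i; have [||d d0 hd] := @holo_ord1 R n (fun x => f x 0 i).
  - exact: holo_entry.
  - by rewrite f0 mxE.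
  by exists d; split=> //; apply: filterS hd => x; rewrite expr1.
have D0 : 0 <= \sum_i d i by apply: sumr_ge0 => i _; have [] := hd i.
exists (\sum_i d i) => //.
have /near_forall h := fun i => (hd i).2; apply: filterS h => x h.
apply: nm_rv_le => [|i]; first by rewrite mulr_ge0 ?nm_ge0.
apply: le_trans (h i) _; apply: ler_wpM2r; first exact: nm_ge0.
by rewrite (bigD1 i) //= lerDl; apply: sumr_ge0 => j _; have [] := hd j.
Qed.

(** Some iterate of the linear part shrinks norms by 1/4, so the same iterate of [F] shrinks them by
    1/2 near 0; the finitely many intermediate iterates are bounded linearly and account for [c]. *)
Lemma contraction_of_decay n (F : 'rV[C]_n -> 'rV[C]_n) (J : 'M[C]_n) :
  holo_germ F -> F 0 = 0 -> first_order F J ->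
  (forall x : 'rV[C]_n, exists c k : R,
     [/\ 0 <= c, 0 <= k < 1 & forall i, nm (x *m mpow J i) <= c * k ^+ i]) ->
  exists c k r, contracts F c k r.
Proof.
move=> hF F0 FJ dec.
have [N hN] : exists N, forall x : 'rV[C]_n, nm (x *m mpow J N.+1) <= 1 / 4 * nm x.
  pose ep := 1 / 4 / (n.+1%:R : R).
  have n1 : 0 < (n.+1%:R : R) by exact: ltr0Sn.
  have ep0 : 0 < ep by rewrite divr_gt0 //; lra.
  have /boolp.choice[Ni hNi] : forall i : 'I_n, exists Ni, forall k, (Ni <= k)%N ->
      nm ((delta_mx 0 i : 'rV[C]_n) *m mpow J k) <= ep.
    move=> i; have [c [k [c0 kk h]]] := dec (delta_mx 0 i : 'rV[C]_n).
    have [M hM] := geo_small c kk ep0; exists M => m Mm; apply: le_trans (h m) _.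
    apply: le_trans (ltW hM); apply: ler_wpM2l => //; case/andP: kk => k0 k1.
    by apply: ler_wiXn2l => //; exact: ltW.
  exists (\max_i Ni i)%N => x.
  rewrite {1}[x]row_sum_delta mulmx_suml; apply: le_trans (nm_sum _) _.
  apply: (@le_trans _ _ (\sum_(i < n) ep * nm x)).
    apply: ler_sum => i _; rewrite -scalemxAl nmZ mulrC.
    apply: ler_pM; rewrite ?nm_ge0 ?nm_coord //; apply: hNi.
    by apply: leqW; exact: (leq_bigmax i).
  rewrite sumr_const card_ord -mulrnAl; apply: ler_wpM2r; first exact: nm_ge0.
  have nn : (n%:R : R) <= n.+1%:R by rewrite ler_nat.
  rewrite -mulr_natr; apply: (le_trans (ler_wpM2l (ltW ep0) nn)).
  by rewrite /ep divfK // gt_eqF.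
set G := iter N.+1 F.
have hG : holo_germ G := holo_iter N.+1 hF F0.
have G0 : G 0 = 0 := iter_fixed N.+1 F0.
have GJ : first_order G (mpow J N.+1) := first_order_iter N.+1 hF F0 FJ.
have [r1 r10 Gc] : exists2 r1 : R, 0 < r1 & forall x, nm x < r1 -> nm (G x) <= 1 / 2 * nm x.
  have /boolp.choice[e he] : forall j, exists e : R, 0 <= e /\
      \forall x \near (0 : 'rV[C]_n), nm (G x 0 j - (x *m mpow J N.+1) 0 j) <= e * nm x ^+ 2.
    by move=> j; have [e e0 he] := GJ j; exists e.
  have /near_forall/near0P[s s0 hs] := fun j => (he j).2.
  pose E := \sum_j e j.
  have E0 : 0 <= E by apply: sumr_ge0 => j _; have [] := he j.
  exists (Num.min s (1 / 4 / (E + 1))) => [|x].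
    by rewrite lt_min s0 /=; apply: divr_gt0; lra.
  rewrite lt_min => /andP[xs]; rewrite ltr_pdivlMr; last lra.
  move=> xE; have -> : G x = (x *m mpow J N.+1) + (G x - x *m mpow J N.+1) by rewrite addrC subrK.
  apply: le_trans (nmD _ _) _.
  suff : nm (G x - x *m mpow J N.+1) <= E * nm x ^+ 2.
    by have := hN x; have := nm_ge0 x; nra.
  apply: nm_rv_le => [|j]; first by rewrite mulr_ge0 ?exprn_ge0 ?nm_ge0.
  rewrite [X in nm X](_ : _ = G x 0 j - (x *m mpow J N.+1) 0 j); last by rewrite !mxE.
  apply: le_trans (hs x xs j) _; apply: ler_wpM2r; first by rewrite exprn_ge0 ?nm_ge0.
  by rewrite /E (bigD1 j) //= lerDl; apply: sumr_ge0 => i _; have [] := he i.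
have /boolp.choice[d hd] : forall j : 'I_N.+1, exists d : R, 0 <= d /\
    \forall x \near (0 : 'rV[C]_n), nm (iter j F x) <= d * nm x.
  by move=> j; have [d d0 h] := linear_bound (holo_iter j hF F0) (iter_fixed j F0); exists d.
have /near_forall/near0P[r2 r20 hr2] := fun j => (hd j).2.
pose D := \sum_j d j.
have D0 : 0 <= D by apply: sumr_ge0 => j _; have [] := hd j.
have Ge x k : nm x < r1 -> nm (iter k G x) <= (1 / 2) ^+ k * nm x /\ nm (iter k G x) < r1.
  move=> xr; elim: k => [|k [IH1 IH2]]; first by rewrite expr0 mul1r.
  have h := Gc _ IH2; rewrite iterS exprS; split.
    apply: (le_trans h); rewrite -[X in _ <= X]mulrA.
    by apply: ler_wpM2l => //; lra.
  by apply: (le_lt_trans h); have := nm_ge0 (iter k G x); lra.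
(* Bernoulli's inequality gives [th ^+ N.+1 >= 1 / 2], so halving every [N.+1] steps is decay at
   rate [th] per step. *)
pose th := 1 - 1 / (2 * N.+1%:R) : R.
have N1 : 1 <= (N.+1%:R : R) by rewrite ler1n.
have a01 : 0 <= (1 / (2 * N.+1%:R) : R) <= 1 / 2.
  apply/andP; split; first by apply: divr_ge0; lra.
  by rewrite ler_pdivrMr; lra.
have th01 : 0 < th < 1.
  have : 0 < (1 / (2 * N.+1%:R) : R) by apply: divr_gt0; lra.
  move: a01; rewrite /th; move: (1 / (2 * N.+1%:R)) => a /andP[a0 a1] h.
  by apply/andP; split; lra.
have /andP[th0 th1] := th01.
have thN : 1 / 2 <= th ^+ N.+1.
  have := @bernoulli_pow (1 / (2 * N.+1%:R)) N.+1; rewrite -/th => h.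
  have : 1 - N.+1%:R * (1 / (2 * N.+1%:R)) = 1 / 2 :> R by field; rewrite gt_eqF //; lra.
  move=> <-; apply: h; move: a01; move: (1 / (2 * N.+1%:R)) => a /andP[a0 a1].
  by apply/andP; split; lra.
exists (2 * D + 1), th, (Num.min r1 r2); split=> //; first lra.
  by rewrite lt_min r10.
move=> x; rewrite lt_min => /andP[x1 x2] i.
pose k := (i %/ N.+1)%N; pose j := (i %% N.+1)%N.
have ij : i = (j + k * N.+1)%N by rewrite addnC -divn_eq.
have jN : (j < N.+1)%N by rewrite ltn_mod.
have Ei : iter i F x = iter j F (iter k G x).
  rewrite ij iterD; congr (iter j F _).
  by elim: (k) => [//|m IHm]; rewrite mulSn iterD IHm.
have [g1 g2] := Ge x k x1.
have h12 : (1 / 2 : R) ^+ k <= 1 by apply: exprn_ile1; lra.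
have gx : nm (iter k G x) <= nm x.
  by apply: (le_trans g1); have := nm_ge0 x; move: h12; move: ((1 / 2) ^+ k) => K; nra.
have := hr2 (iter k G x) (le_lt_trans gx x2) (Ordinal jN).
rewrite /= -Ei => h.
have dD : d (Ordinal jN) <= D.
  by rewrite /D (bigD1 (Ordinal jN)) //= lerDl; apply: sumr_ge0 => m _; have [] := hd m.
have hk : (1 / 2 : R) ^+ k <= 2 * th ^+ i.
  rewrite ij exprD mulnC exprM.
  have t1 : 1 / 2 <= th ^+ j.
    apply: le_trans thN _; apply: ler_wiXn2l; rewrite ?(ltW th0) ?(ltW th1) //; exact: ltnW.
  have t2 : (1 / 2 : R) ^+ k <= (th ^+ N.+1) ^+ k.
    by apply: lerXn2r; rewrite ?nnegrE ?exprn_ge0 //; lra.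
  have : 0 <= (1 / 2 : R) ^+ k by apply: exprn_ge0; lra.
  move: ((1 / 2) ^+ k) ((th ^+ N.+1) ^+ k) (th ^+ j) t1 t2 => A B T; nra.
apply: (le_trans h); apply: (@le_trans _ _ (D * ((1 / 2) ^+ k * nm x))).
  by apply: ler_pM; rewrite ?nm_ge0 //; have [] := hd (Ordinal jN).
have hx := nm_ge0 x; rewrite mulrA; apply: ler_wpM2r => //.
have := exprn_ge0 i (ltW th0); move: (th ^+ i) ((1 / 2) ^+ k) hk => A B; nra.
Qed.

End Contraction.

(** * Linear functional equations over a contraction *)

Section FunctionalEquation.
Variable R : realType.
Local Notation C := (CC R).

Lemma near0S (V : normedModType C) (P Q : V -> Prop) : (forall x, P x -> Q x) ->
  (\forall x \near (0 : V), P x) -> \forall x \near (0 : V), Q x.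
Proof. by move=> PQ /near0P[r r0 h]; apply/near0P; exists r => // x /h /PQ. Qed.

Lemma near0I (V : normedModType C) (P Q : V -> Prop) :
  (\forall x \near (0 : V), P x) -> (\forall x \near (0 : V), Q x) ->
  \forall x \near (0 : V), P x /\ Q x.
Proof.
move=> /near0P[r r0 h] /near0P[u u0 k]; apply/near0P; exists (Num.min r u) => [|x].
  by rewrite lt_min r0.
by rewrite lt_min => /andP[/h ? /k].
Qed.

(** Iterating from 0, the [i]-th increment is bounded by [kap ^ i] times the size of [b] at [F^i x],
    of order [th ^ (m * i)]; hence the condition [kap * th ^+ m < 1]. The index map [s] lets
    components exchanged by [f] be treated as one system. *)
Lemma functional_equation n (F : 'rV[C]_n -> 'rV[C]_n) (c th r : R) (K : finType) (s : K -> K)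
    (w b : K -> 'rV[C]_n -> C) m (kap : R) :
  holo_germ F -> F 0 = 0 -> contracts F c th r ->
  (forall k, holo_germ (w k)) -> (forall k, holo_germ (b k)) -> (forall k, ord m (b k)) ->
  0 <= kap -> kap * th ^+ m < 1 ->
  (forall k, \forall x \near (0 : 'rV[C]_n), nm (w k x) <= kap) ->
  exists a : K -> 'rV[C]_n -> C,
    [/\ forall k, holo_germ (a k), forall k, ord m (a k) &
     \forall x \near (0 : 'rV[C]_n), forall k, a k x = w k x * a (s k) (F x) + b k x].
Proof.
move=> hF F0 [c1 /andP[th0 th1] r0 Fc] hw hb ob kap0 q1 wk.
have /boolp.choice[e he] : forall k, exists e : R, 0 <= e /\
    \forall x \near (0 : 'rV[C]_n), nm (b k x) <= e * nm x ^+ m.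
  by move=> k; have [e e0 he] := ob k; exists e.
pose E := \sum_k e k.
have E0 : 0 <= E by apply: sumr_ge0 => k _; have [] := he k.
have /near0P[r1 r10 good] : \forall x \near (0 : 'rV[C]_n), forall k,
    [/\ differentiable (w k) x, differentiable (b k) x, differentiable F x,
       nm (w k x) <= kap & nm (b k x) <= E * nm x ^+ m].
  apply: near_forall => k.
  apply: near0S (near0I (near0I (hw k) (hb k)) (near0I hF (near0I (wk k) (he k).2))) => x [[h1 h2] [h3 [h4 h5]]]; split=> //.
  apply: (le_trans h5); apply: ler_wpM2r; first by rewrite exprn_ge0 ?nm_ge0.
  by rewrite /E (bigD1 k) //= lerDl; apply: sumr_ge0 => i _; have [] := he i.
(* Points whose entire orbit stays in the good ball: a set stable under [F], as a ball need not be,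
   and containing the ball of radius [rho]. *)
pose D (x : 'rV[C]_n) := forall j, nm (iter j F x) < r1.
have DF x : D x -> D (F x) by move=> h j; rewrite -iterSr; exact: h.
pose rho := Num.min r (r1 / c).
have c0 : 0 < c by lra.
have rho0 : 0 < rho by rewrite lt_min r0 divr_gt0.
have Drho x : nm x < rho -> D x.
  rewrite lt_min => /andP[xr]; rewrite ltr_pdivlMr // => xr1 j.
  apply: (le_lt_trans (Fc x xr j)).
  have : th ^+ j <= 1 by apply: exprn_ile1; exact: ltW.
  move=> t1; apply: le_lt_trans xr1; rewrite mulrC mulrA; apply: ler_piMr => //.
  by rewrite mulr_ge0 ?nm_ge0 // ltW.
pose q := kap * th ^+ m.
have q0 : 0 <= q by rewrite mulr_ge0 // exprn_ge0 // ltW.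
have qq : 0 <= q < 1 by rewrite q0.
pose a i := iter i (fun (A : K -> 'rV[C]_n -> C) k x => w k x * A (s k) (F x) + b k x) (fun _ _ => 0).
have aS i k x : a i.+1 k x = w k x * a i (s k) (F x) + b k x by [].
have da i : forall k x, D x -> differentiable (a i k) x.
  elim: i => [|i IH] k x Dx; first exact: (differentiable_cst (0 : C)).
  have [h1 h2 h3 _ _] := good x (Dx 0%N) k.
  have h6 := @differentiable_comp _ _ _ _ F (a i (s k)) x h3 (IH (s k) _ (DF x Dx)).
  exact: (differentiableD (differentiableM h1 h6) h2).
have dif i : forall k x, D x -> nm (a i.+1 k x - a i k x) <= kap ^+ i * (E * nm (iter i F x) ^+ m).
  elim: i => [|i IH] k x Dx; have [_ _ _ h4 h5] := good x (Dx 0%N) k.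
    by rewrite aS mulr0 add0r subr0 expr0 mul1r.
  rewrite aS [a i.+1 k x]aS opprD addrACA subrr addr0 -mulrBr nmM.
  rewrite exprS -mulrA; apply: ler_pM; rewrite ?nm_ge0 //.
  by rewrite iterSr; apply: IH; exact: DF.
pose B (x : 'rV[C]_n) := E * c ^+ m * nm x ^+ m.
have B0 x : 0 <= B x by rewrite !mulr_ge0 ?exprn_ge0 ?nm_ge0 // ltW.
have dif2 i k x : nm x < rho -> nm (a i.+1 k x - a i k x) <= B x * q ^+ i.
  move=> xr; apply: (le_trans (dif i k x (Drho x xr))).
  have xr' : nm x < r by move: xr; rewrite lt_min => /andP[].
  have -> : B x * q ^+ i = kap ^+ i * (E * (c * th ^+ i * nm x) ^+ m).
    by rewrite /B /q !exprMn -!exprM [(m * i)%N]mulnC; ring.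
  apply: ler_wpM2l; first exact: exprn_ge0.
  apply: ler_wpM2l => //; apply: lerXn2r; rewrite ?nnegrE ?nm_ge0 //; last exact: Fc.
  by rewrite !mulr_ge0 ?exprn_ge0 ?nm_ge0 // ltW.
pose B1 := E * c ^+ m * rho ^+ m.
have B10 : 0 <= B1 by rewrite !mulr_ge0 ?exprn_ge0 // ltW.
have BB1 x : nm x < rho -> B x <= B1.
  move=> xr; apply: ler_wpM2l; first by rewrite mulr_ge0 ?exprn_ge0 // ltW.
  by apply: lerXn2r; rewrite ?nnegrE ?nm_ge0 // ltW.
have /boolp.choice[A hA] : forall k, exists A, (forall y, nm y < rho -> differentiable A y) /\
    forall i y, nm y < rho -> nm (a i k y - A y) <= 2 * B1 / (1 - q) * q ^+ i.
  move=> k.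
  have [i y|i y|A h1 h2] := @weierstrass R 'rV[C]_n (fun i => a i k) 0 rho q B1 qq B10.
  - by rewrite subr0 => yr; apply: da; exact: Drho.
  - rewrite subr0 => yr; apply: (le_trans (dif2 i k y yr)).
    by apply: ler_wpM2r; [exact: exprn_ge0 | exact: BB1].
  by exists A; split=> [y yr|i y yr]; [apply: h1 | apply: h2]; rewrite subr0.
exists A; split=> [k|k|].
- by apply/near0P; exists rho => // y yr; have [h _] := hA k; exact: h.
- exists (E * c ^+ m / (1 - q)).
    by rewrite divr_ge0 ?mulr_ge0 ?exprn_ge0 ?(ltW c0) // subr_ge0 ltW.
  apply/near0P; exists rho => // x xr.
  have ai i : nm (a i k x) <= B x * (1 - q ^+ i) / (1 - q).
    elim: i => [|i IH]; first by rewrite /= nm0 expr0 subrr mulr0 mul0r.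
    have -> : a i.+1 k x = (a i.+1 k x - a i k x) + a i k x by rewrite subrK.
    apply: (le_trans (nmD _ _)).
    have -> : B x * (1 - q ^+ i.+1) / (1 - q) = B x * q ^+ i + B x * (1 - q ^+ i) / (1 - q).
      by rewrite exprS; field; rewrite subr_eq0 gt_eqF.
    by apply: lerD => //; exact: dif2.
  apply: (@geo_le R q (2 * B1 / (1 - q)) _ _ qq) => i.
  have := (hA k).2 i x xr; have := nmBl (A k x) (a i k x); rewrite nmBC => h1 h2.
  have h3 : nm (a i k x) <= E * c ^+ m / (1 - q) * nm x ^+ m.
    apply: (le_trans (ai i)); rewrite [X in _ <= X](_ : _ = B x / (1 - q)); last by rewrite /B mulrAC.
    rewrite mulrAC; apply: ler_piMr; first by rewrite divr_ge0 // subr_ge0 ltW.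
    by rewrite lerBlDr lerDl exprn_ge0.
  by lra.
have Fr : \forall x \near (0 : 'rV[C]_n), nm (F x) < rho.
  by apply: (near_holo hF F0 (P := fun y => nm y < rho)); apply/near0P; exists rho.
have xr : \forall x \near (0 : 'rV[C]_n), nm x < rho by apply/near0P; exists rho.
apply: filterS2 Fr xr => x Fxr xr k.
apply/eqP; rewrite -subr_eq0; apply/eqP/nm0_eq0.
pose L := 2 * B1 / (1 - q).
have L0 : 0 <= L by apply: divr_ge0; [exact: mulr_ge0 | rewrite subr_ge0; exact: ltW].
apply: (@geo_le R q (L + kap * L) _ _ qq) => i; rewrite add0r.
have -> : A k x - (w k x * A (s k) (F x) + b k x) =
    w k x * (a i (s k) (F x) - A (s k) (F x)) - (a i.+1 k x - A k x) by rewrite aS; ring.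
apply: (le_trans (nmB _ _)); rewrite nmM.
have h1 := (hA k).2 i.+1 x xr; have h2 := (hA (s k)).2 i (F x) Fxr.
have [_ _ _ h4 _] := good x (Drho x xr 0%N) k.
rewrite -/L in h1 h2.
have h3 : nm (w k x) * nm (a i (s k) (F x) - A (s k) (F x)) <= kap * (L * q ^+ i).
  by apply: ler_pM; rewrite ?nm_ge0.
have h5 : L * q ^+ i.+1 <= L * q ^+ i.
  by apply: ler_wpM2l => //; rewrite exprS; apply: ler_piMl; [exact: exprn_ge0 | exact: ltW].
by lra.
Qed.

End FunctionalEquation.

(** * Generalized eigenvectors of the pullback *)

Section GeneralizedEigenvectors.
Variables (K : fieldType) (V : lmodType K) (T : V -> V) (Z : V -> Prop).
Hypothesis Tlin : forall a u v, T (a *: u + v) = a *: T u + T v.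
Hypothesis Z0 : Z 0.
Hypothesis Zlin : forall a u v, Z u -> Z v -> Z (a *: u + v).
Hypothesis ZT : forall u, Z u -> Z (T u).
Implicit Types (ls : seq K) (w u v : V).

(** The product of the [T - l], for [l] in [ls], sends [w] into [Z]. The subspace [Z] plays the role
    of zero: functions vanishing near 0, germs of order [M], or the span of some rows. Quotient
    spaces are thereby avoided. *)
Definition kill ls w := Z (foldl (fun y l => T y - l *: y) w ls).

Lemma TD u v : T (u + v) = T u + T v.
Proof. by rewrite -{1}[u]scale1r Tlin scale1r. Qed.

Lemma T0 : T 0 = 0.
Proof. by apply: (addrI (T 0)); rewrite -TD !addr0. Qed.

Lemma TZ a u : T (a *: u) = a *: T u.
Proof. by rewrite -[a *: u]addr0 Tlin T0 addr0. Qed.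

Lemma TB u v : T (u - v) = T u - T v.
Proof. by rewrite -scaleN1r TD TZ scaleN1r. Qed.

Lemma opC l l' w : T (T w - l' *: w) - l *: (T w - l' *: w) = T (T w - l *: w) - l' *: (T w - l *: w).
Proof.
rewrite !TB !TZ !scalerBr !scalerA [l * l']mulrC !opprB.
by rewrite [LHS]addrACA [RHS]addrACA [- _ - _]addrC.
Qed.

Lemma opB l u v : T (u - v) - l *: (u - v) = (T u - l *: u) - (T v - l *: v).
Proof. by rewrite TB scalerBr !opprB [LHS]addrACA [RHS]addrACA [- T v - _]addrC. Qed.

Lemma ZZ a u : Z u -> Z (a *: u).
Proof. by move=> Zu; rewrite -[a *: u]addr0; exact: Zlin. Qed.

Lemma ZD u v : Z u -> Z v -> Z (u + v).
Proof. by move=> Zu Zv; rewrite -[u]scale1r; exact: Zlin. Qed.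

Lemma ZB u v : Z u -> Z v -> Z (u - v).
Proof. by move=> Zu Zv; rewrite -scaleN1r; apply: ZD => //; exact: ZZ. Qed.

Lemma kill_lin ls a u v : kill ls u -> kill ls v -> kill ls (a *: u + v).
Proof.
rewrite /kill; elim: ls u v => [|l ls IH] u v /=; first exact: Zlin.
move=> hu hv; have := IH _ _ hu hv; congr (Z (foldl _ _ _)).
by rewrite Tlin scalerBr scalerDr opprD addrACA !scalerA [l * a]mulrC.
Qed.

Lemma kill_Z ls w : Z w -> kill ls w.
Proof.
rewrite /kill; elim: ls w => [//|l ls IH] w Zw /=; apply: IH.
by apply: ZB; [exact: ZT | exact: ZZ].
Qed.

Lemma killD ls u v : kill ls u -> kill ls v -> kill ls (u + v).
Proof. by move=> hu hv; rewrite -[u]scale1r; exact: kill_lin. Qed.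

Lemma killZ ls a u : kill ls u -> kill ls (a *: u).
Proof. by move=> hu; rewrite -[a *: u]addr0; apply: kill_lin => //; exact: kill_Z. Qed.

Lemma killB ls u v : kill ls u -> kill ls v -> kill ls (u - v).
Proof. by move=> hu hv; rewrite -scaleN1r; apply: killD => //; exact: killZ. Qed.

Lemma kill_T ls w : kill ls w -> kill ls (T w).
Proof.
rewrite /kill; elim: ls w => [|l ls IH] w /=; first exact: ZT.
by move=> /IH; rewrite TB TZ.
Qed.

Lemma kill_op ls l w : kill ls w -> kill ls (T w - l *: w).
Proof. by move=> h; apply: killB; [exact: kill_T | exact: killZ]. Qed.

Lemma kill_catl ls ls' w : kill ls w -> kill (ls ++ ls') w.
Proof. by rewrite /kill foldl_cat => h; exact: kill_Z. Qed.

Lemma kill_catr ls ls' w : kill ls' w -> kill (ls ++ ls') w.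
Proof.
rewrite /kill foldl_cat; elim: ls w => [//|l ls IH] w h /=.
by apply: IH; exact: kill_op.
Qed.

(** Coprime annihilators. By induction [T w = l w] modulo [Z] for the first factor [l], and then
    each factor [T - l'] of the other list acts on [w] as the non-zero scalar [l - l']. *)
Lemma kill_disjoint ls ls' w : (forall l, l \in ls -> l \notin ls') ->
  kill ls w -> kill ls' w -> Z w.
Proof.
elim: ls w => [//|l ls IH] w dis h h'.
have Zw : Z (T w - l *: w).
  apply: (IH (T w - l *: w)) => //; last exact: kill_op.
  by move=> x xls; apply: dis; rewrite inE xls orbT.
have ln : l \notin ls' by apply: dis; rewrite mem_head.
elim: ls' w ln h' Zw {IH dis h} => [//|l' ls' IH] w; rewrite inE negb_or => /andP[ll' ln] h' Zw.
have d0 : l - l' != 0 by rewrite subr_eq0.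
have E : T w - l' *: w = (T w - l *: w) + (l - l') *: w.
  by rewrite scalerBl addrA subrK.
have : Z (T w - l' *: w).
  apply: IH => //.
  by rewrite opC; apply: ZB; [exact: ZT | exact: ZZ].
rewrite E => h2; have := ZB h2 Zw; rewrite addrAC subrr add0r => h3.
by have := ZZ (l - l')^-1 h3; rewrite scalerA mulVf // scale1r.
Qed.

Variable H : V -> Prop.
Hypothesis H0 : H 0.
Hypothesis Hlin : forall a u v, H u -> H v -> H (a *: u + v).
Hypothesis HT : forall u, H u -> H (T u).

Lemma HB u v : H u -> H v -> H (u - v).
Proof. by move=> hu hv; rewrite addrC -scaleN1r; exact: Hlin. Qed.

Lemma HZ a u : H u -> H (a *: u).
Proof. by move=> hu; rewrite -[a *: u]addr0; exact: Hlin. Qed.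

Lemma kill_solve ls l0 w : l0 \notin ls -> H w -> kill ls w ->
  exists q, [/\ H q, kill ls q & Z (T q - l0 *: q - w)].
Proof.
elim: ls w => [|l ls IH] w; first by exists 0; split=> //; rewrite T0 scaler0 subr0 sub0r -scaleN1r; exact: ZZ.
rewrite inE negb_or => /andP[l0l l0n] Hw hw.
have [|q' [Hq' kq' Zq']] := IH (T w - l *: w) l0n _ hw.
  by apply: HB; [exact: HT | exact: HZ].
have d0 : l - l0 != 0 by rewrite subr_eq0 eq_sym.
exists ((l - l0)^-1 *: (w - q')); split; first by apply: HZ; exact: HB.
  apply: killZ; apply: killB => //; exact: kill_op.
rewrite TZ scalerA [l0 * _]mulrC -scalerA -scalerBr.
rewrite -{3}[w]scale1r -(mulVf d0) -scalerA -scalerBr; apply: ZZ.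
have -> : T (w - q') - l0 *: (w - q') - (l - l0) *: w = - (T q' - l0 *: q' - (T w - l *: w)).
  rewrite opB scalerBl; move: (T w) (l *: w) (l0 *: w) (T q' - l0 *: q') => a b c d.
  by rewrite !opprB addrAC addrA subrK addrC.
by rewrite -scaleN1r; exact: ZZ.
Qed.

(** The exponent is existential, so nothing has to be said about the size of Jordan blocks. *)
Definition geig l w := exists n, kill (nseq n l) w.

(** Split [T w - l *: w] by induction; whichever part does not belong to the eigenvalue [l] lies in
    the image of [T - l] by [kill_solve], and its preimage [q] is moved to the other summand. *)
Lemma fitting ls l0 w : H w -> kill ls w ->
  exists w1 w2, [/\ w = w1 + w2, H w1 /\ H w2, geig l0 w1 &
    exists2 ls', l0 \notin ls' & kill ls' w2].
Proof.
elim: ls w => [|l ls IH] w Hw hw.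
  exists 0, w; split; [by rewrite add0r | by [] | by exists 0%N | by exists [::]].
have [|w1 [w2 [E [Hw1 Hw2] [n g1] [ls' l0n k2]]]] := IH (T w - l *: w) _ hw.
  by apply: HB; [exact: HT | exact: HZ].
have Eq q : T (w - q) - l *: (w - q) = w1 + w2 - (T q - l *: q).
  by rewrite opB E.
have [ll0|ll0] := eqVneq l l0.
  have [q [Hq kq Zq]] := kill_solve l0n Hw2 k2.
  exists (w - q), q; split; [by rewrite subrK | by split=> //; exact: HB | | by exists ls'].
  exists n.+1; rewrite -[nseq _ _]/(l0 :: nseq n l0) -{1}ll0.
  rewrite /kill /= Eq.
  have -> : w1 + w2 - (T q - l *: q) = w1 - (T q - l *: q - w2).
    by move: (T q - l *: q) => X; rewrite opprB addrA.
  by apply: (@killB (nseq n l0) w1 (T q - l *: q - w2)) => //; apply: kill_Z; rewrite ll0.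
have ln : l \notin nseq n l0 by rewrite mem_nseq negb_and ll0 orbT.
have [q [Hq kq Zq]] := kill_solve ln Hw1 g1.
exists q, (w - q); split; [by rewrite addrC subrK | by split=> //; exact: HB | by exists n | ].
exists (l :: ls'); first by rewrite inE negb_or eq_sym ll0.
rewrite /kill /= Eq.
have -> : w1 + w2 - (T q - l *: q) = w2 - (T q - l *: q - w1).
  by move: (T q - l *: q) => X; rewrite opprB addrA [w1 + w2]addrC.
by apply: (@killB ls' w2 (T q - l *: q - w1)) => //; exact: kill_Z.
Qed.

End GeneralizedEigenvectors.

(** * Homogeneous forms and Taylor expansion *)

Section HomogeneousForms.
Variable R : realType.
Local Notation C := (CC R).

Lemma ordS n k (F : 'rV[C]_n -> C) : ord k.+1 F -> ord k F.
Proof. exact: ord_leq. Qed.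

(** Homogeneous polynomials of degree [k] without coefficients: a sum of coordinates times forms of
    degree [k - 1]. Hadamard's lemma produces exactly this shape, and no uniqueness of the [Q l] is
    needed. *)
Fixpoint hom n k (P : 'rV[C]_n -> C) : Prop :=
  if k is k'.+1 then exists Q : 'I_n -> 'rV[C]_n -> C,
     (forall l, hom k' (Q l)) /\ (forall x, P x = \sum_l x 0 l * Q l x)
  else exists c, forall x, P x = c.

Lemma hom_ext n k (P Q : 'rV[C]_n -> C) : (forall x, P x = Q x) -> hom k P -> hom k Q.
Proof. by move=> /funext ->. Qed.

Lemma hom0 n k : hom k (fun _ : 'rV[C]_n => 0).
Proof.
elim: k => [|k IH] /=; first by exists 0.
by exists (fun _ _ => 0); split=> // x; rewrite big1 // => l _; rewrite mulr0.
Qed.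

Lemma hom_lin n k a (P Q : 'rV[C]_n -> C) : hom k P -> hom k Q -> hom k (fun x => a * P x + Q x).
Proof.
elim: k P Q => [|k IH] P Q /=.
  by move=> [c hc] [d hd]; exists (a * c + d) => x; rewrite hc hd.
move=> [p [hp Ep]] [q [hq Eq]]; exists (fun l x => a * p l x + q l x); split=> [l|x].
  exact: IH.
rewrite Ep Eq mulr_sumr -big_split; apply: eq_bigr => l _ /=; ring.
Qed.

Lemma homZ n k a (P : 'rV[C]_n -> C) : hom k P -> hom k (fun x => a * P x).
Proof.
move=> hP; apply: hom_ext (hom_lin a hP (hom0 n k)) => x; exact: addr0.
Qed.

Lemma homD n k (P Q : 'rV[C]_n -> C) : hom k P -> hom k Q -> hom k (fun x => P x + Q x).
Proof. by move=> hP hQ; apply: hom_ext (hom_lin 1 hP hQ) => x; rewrite mul1r. Qed.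

Lemma homB n k (P Q : 'rV[C]_n -> C) : hom k P -> hom k Q -> hom k (fun x => P x - Q x).
Proof.
by move=> hP hQ; apply: hom_ext (hom_lin (-1) hQ hP) => x; rewrite mulN1r addrC.
Qed.

Lemma hom_sum n k (I : Type) (s : seq I) (P : I -> 'rV[C]_n -> C) :
  (forall i, hom k (P i)) -> hom k (fun x => \sum_(i <- s) P i x).
Proof.
move=> h; elim: s => [|i s IH].
  by apply: hom_ext (hom0 n k) => x; rewrite big_nil.
by apply: hom_ext (homD (h i) IH) => x; rewrite big_cons.
Qed.

Lemma hom_holo n k (P : 'rV[C]_n -> C) : hom k P -> holo_germ P.
Proof.
elim: k P => [|k IH] P /=.
  by move=> [c hc]; rewrite (_ : P = fun=> c); [exact: holo_cst | exact/funext].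
move=> [Q [hQ /funext ->]]; apply: holo_sum => l; apply: holoM; last exact: IH.
exact: holo_coord.
Qed.

Lemma coord_ord1 n (l : 'I_n) : ord 1 (fun x : 'rV[C]_n => x 0 l).
Proof. by apply: holo_ord1; [exact: holo_coord | rewrite mxE]. Qed.

Lemma hom_ord n k (P : 'rV[C]_n -> C) : hom k P -> ord k P.
Proof.
elim: k P => [|k IH] P; first by move=> h; apply: ord_holo; exact: (@hom_holo n 0).
move=> [Q [hQ /funext ->]]; apply: ord_sum => l.
by have := ordM (coord_ord1 l) (IH _ (hQ l)).
Qed.

Lemma hom_scale n k (P : 'rV[C]_n -> C) : hom k P -> forall t x, P (t *: x) = t ^+ k * P x.
Proof.
elim: k P => [|k IH] P /=; first by move=> [c hc] t x; rewrite !hc mul1r.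
move=> [Q [hQ EP]] t x; rewrite !EP mulr_sumr; apply: eq_bigr => l _.
by rewrite IH // mxE exprS; ring.
Qed.

Lemma hom_ord_eq0 n k (P : 'rV[C]_n -> C) : hom k P -> ord k.+1 P -> forall x, P x = 0.
Proof. by move=> hP; apply: (homogeneous_ord (ltnSn k)); exact: hom_scale. Qed.

Lemma hom_near0 n k (P : 'rV[C]_n -> C) : hom k P -> (\forall x \near (0 : 'rV[C]_n), P x = 0) ->
  forall x, P x = 0.
Proof.
move=> hP h; apply: (hom_ord_eq0 hP); exists 0 => //.
by apply: near0S h => x ->; rewrite nm0 mul0r.
Qed.

Lemma hom_mulmx n m k (P : 'rV[C]_m -> C) (B : 'M[C]_(n, m)) : hom k P -> hom k (fun x => P (x *m B)).
Proof.
elim: k P => [|k IH] P /=; first by move=> [c hc]; exists c.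
move=> [Q [hQ EP]]; exists (fun i x => \sum_l B i l * Q l (x *m B)); split=> [i|x].
  by apply: hom_sum => l; apply: homZ; exact: IH.
rewrite EP; under eq_bigr => l _ do rewrite mxE mulr_suml.
rewrite exchange_big; apply: eq_bigr => i _; rewrite mulr_sumr; apply: eq_bigr => l _; ring.
Qed.

(** Hadamard's lemma relative to the origin, applied again to the quotients [G l]. *)
Lemma taylor n k : forall w : 'rV[C]_n -> C, holo_germ w -> exists P : nat -> 'rV[C]_n -> C,
  (forall j, hom j (P j)) /\ ord k (fun x => w x - \sum_(j < k) P j x).
Proof.
elim: k => [|k IH] w hw.
  exists (fun _ _ => 0); split=> [j|]; first exact: hom0.
  by apply: ord_near (ord_holo hw); apply: near0S (hw) => x _; rewrite big_ord0 subr0.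
have [G hG EG] := hadamard pred0 hw.
have /boolp.choice[P hP] : forall l, exists P : nat -> 'rV[C]_n -> C,
  (forall j, hom j (P j)) /\ ord k (fun x => G l x - \sum_(j < k) P j x) := fun l => IH _ (hG l).
pose P' j (x : 'rV[C]_n) := if j is j'.+1 then \sum_l x 0 l * P l j' x else w 0.
exists P'; split=> [[|j]|]; first by exists (w 0).
  by exists (fun l => P l j); split=> // l; have [h _] := hP l; exact: h.
have h : ord k.+1 (fun x => \sum_l x 0 l * (G l x - \sum_(j < k) P l j x)).
  by apply: ord_sum => l; have := ordM (coord_ord1 l) (hP l).2.
apply: ord_near h; apply: near0S EG => x.
have -> : proj pred0 x = 0 by apply/rowP => i; rewrite !mxE.
rewrite big_ord_recl /= opprD addrA => ->; under eq_bigr => l _ do rewrite mulrBr.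
rewrite sumrB; congr (_ - _); first by apply: eq_bigr => l _; rewrite [(0 : 'rV[C]_n) 0 l]mxE subr0.
rewrite [RHS]exchange_big /=; apply: eq_bigr => l _.
by rewrite mulr_sumr.
Qed.

(** The Taylor forms of degree below [k] vanish by induction on the degree, each being homogeneous
    and of order larger than its degree. *)
Lemma leading_form n k (w : 'rV[C]_n -> C) : holo_germ w -> ord k w ->
  exists2 P, hom k P & ord k.+1 (fun x => w x - P x).
Proof.
move=> hw ow; have [P [hP oP]] := taylor k.+1 hw.
have Pz j : (j < k)%N -> forall x, P j x = 0.
  elim/ltn_ind: j => j IH jk; apply: (hom_ord_eq0 (hP j)).
  have h1 : ord j.+1 (fun x => w x - (w x - \sum_(i < k.+1) P i x)).
    by apply: ordB; [exact: (ord_leq jk ow) | exact: (ord_leq (leqW jk) oP)].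
  have h2 : ord j.+1 (fun x => \sum_(i < k.+1 | (j < i)%N) P i x).
    have h3 : ord j.+1 (fun x => \sum_(i < k.+1) (if (j < i)%N then P i x else 0)).
      apply: ord_sum => i; case ji : (j < i)%N; first exact: (ord_leq ji (hom_ord (hP i))).
      by exists 0 => //; apply: near0S (hw) => x _; rewrite nm0 mul0r.
    by apply: ord_near h3; apply: near0S (hw) => x _; rewrite -big_mkcond.
  apply: ord_near (ordB h1 h2); apply: near0S (hw) => x _.
  have jk1 : (j < k.+1)%N by exact: ltnW.
  rewrite opprB [w x + _]addrCA subrr addr0 (bigD1 (Ordinal jk1)) //=.
  rewrite [X in _ + X - _](bigID (fun i : 'I_k.+1 => (j < i)%N)) /=.
  rewrite [X in _ + (_ + X) - _]big1 => [|i /andP[h3 h4]]; last first.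
    apply: IH; last by apply: leq_ltn_trans jk; rewrite leqNgt.
    rewrite ltn_neqAle leqNgt h4 andbT; apply: contra h3 => /eqP h3.
    by apply/eqP/val_inj.
  rewrite addr0 (eq_bigl (fun i : 'I_k.+1 => (j < i)%N)) ?addrK // => i.
  have [ji|] := ltnP j i; last by rewrite andbF.
  rewrite andbT; apply/eqP => h3; move: ji; by rewrite h3 /= ltnn.
exists (P k) => //; apply: ord_near oP; apply: near0S (hw) => x _.
by rewrite big_ord_recr /= big1 ?add0r // => i _; exact: Pz.
Qed.

End HomogeneousForms.

(** * Pullback operators on germs *)

Section GermOperators.
Variable R : realType.
Local Notation C := (CC R).

Definition pull n (F : 'rV[C]_n -> 'rV[C]_n) (w : 'rV[C]_n -> C) : 'rV[C]_n -> C := fun x => w (F x).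
Definition nz n (w : 'rV[C]_n -> C) := \forall x \near (0 : 'rV[C]_n), w x = 0.
Definition lin n (J : 'M[C]_n) : 'rV[C]_n -> 'rV[C]_n := fun x => x *m J.

Lemma pull_lin n (F : 'rV[C]_n -> 'rV[C]_n) (a : C) (u v : 'rV[C]_n -> C) :
  pull F (a *: u + v) = a *: pull F u + pull F v.
Proof. by []. Qed.

Lemma nz0 n : nz (0 : 'rV[C]_n -> C).
Proof. by apply/near0P; exists 1. Qed.

Lemma nz_lin n (a : C) (u v : 'rV[C]_n -> C) : nz u -> nz v -> nz (a *: u + v).
Proof.
move=> hu hv; apply: near0S (near0I hu hv) => x [ux vx].
by rewrite -[LHS]/(a * u x + v x) ux vx mulr0 addr0.
Qed.

Lemma nz_pull n (F : 'rV[C]_n -> 'rV[C]_n) (u : 'rV[C]_n -> C) :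
  holo_germ F -> F 0 = 0 -> nz u -> nz (pull F u).
Proof. by move=> hF F0; exact: near_holo. Qed.

Lemma ord_lin n k (a : C) (u v : 'rV[C]_n -> C) : ord k u -> ord k v -> ord k (a *: u + v).
Proof. by move=> hu hv; exact: (ordD (ordZ a hu) hv). Qed.

Lemma ord_zero n k : ord k (0 : 'rV[C]_n -> C).
Proof. by exists 0 => //; apply/near0P; exists 1 => // x _; rewrite nm0 mul0r. Qed.

Lemma holo_lin n (a : C) (u v : 'rV[C]_n -> C) : holo_germ u -> holo_germ v -> holo_germ (a *: u + v).
Proof. by move=> hu hv; exact: (holoD (holoM (holo_cst _ a) hu) hv). Qed.

Lemma holo_lin_map n (J : 'M[C]_n) : holo_germ (lin J).
Proof. exact: (@holo_linear R n _ (mulmxr J)). Qed.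

Lemma lin0 n (J : 'M[C]_n) : lin J 0 = 0. Proof. exact: mul0mx. Qed.

Lemma nz_ord n k (w : 'rV[C]_n -> C) : nz w -> ord k w.
Proof. by move=> h; exists 0 => //; apply: near0S h => x ->; rewrite nm0 mul0r. Qed.

Definition geigen n (F : 'rV[C]_n -> 'rV[C]_n) l (w : 'rV[C]_n -> C) := geig (pull F) (@nz n) l w.

(** Since pullback is multiplicative, applying [T - l * l'] to [a * b] gives
    [(T a - l a) * T b + l a * (T b - l' b)]; each term has one factor fewer to kill. The new roots
    are tracked because products of eigenvalues are the resonances. *)
Lemma killM n (F : 'rV[C]_n -> 'rV[C]_n) (ls ls' : seq C) a b : holo_germ F -> F 0 = 0 ->
  kill (pull F) (@nz n) ls a -> kill (pull F) (@nz n) ls' b ->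
  exists2 ls'', kill (pull F) (@nz n) ls'' (fun x => a x * b x) &
    forall x, x \in ls'' -> exists l l', [/\ l \in ls, l' \in ls' & x = l * l'].
Proof.
move=> hF F0.
have Tl := @pull_lin n F; have ZT u := @nz_pull n F u hF F0.
have Z0 := @nz0 n; have Zl := @nz_lin n.
have [N] := ubnP (size ls + size ls'); elim: N ls ls' a b => // N IH ls ls' a b sN ha hb.
case: ls ha sN => [|l ls] ha sN.
  exists [::] => //; apply: near0S ha => x /= ax; by rewrite ax mul0r.
case: ls' hb sN => [|l' ls'] hb sN.
  exists [::] => //; apply: near0S hb => x /= bx; by rewrite bx mulr0.
have [||L1 k1 m1] := IH ls (l' :: ls') (pull F a - l *: a) (pull F b) _ ha.
- by move: sN; rewrite /= addSn.
- exact: kill_T.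
have [|||L2 k2 m2] := IH (l :: ls) ls' a (pull F b - l' *: b).
- by move: sN; rewrite /= addnS.
- exact: ha.
- exact: hb.
exists ((l * l') :: (L1 ++ L2)).
  have E : pull F (fun x => a x * b x) - (l * l') *: (fun x => a x * b x) =
     (fun x => (pull F a - l *: a) x * pull F b x) + l *: (fun x => a x * (pull F b - l' *: b) x).
    apply/funext => x; rewrite -[LHS]/(a (F x) * b (F x) - l * l' * (a x * b x)).
    rewrite -[RHS]/((a (F x) - l * a x) * b (F x) + l * (a x * (b (F x) - l' * b x))).
    by ring.
  rewrite /kill /= E; apply: (@killD _ _ (pull F) (@nz n) Tl Zl (L1 ++ L2)).
    exact: kill_catl.
  by apply: killZ => //; exact: kill_catr.
move=> x; rewrite inE mem_cat => /orP[/eqP ->|/orP[/m1|/m2]].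
- by exists l, l'; rewrite !mem_head.
- by move=> [u [v [h1 h2 ->]]]; exists u, v; split=> //; rewrite inE h1 orbT.
- by move=> [u [v [h1 h2 ->]]]; exists u, v; split=> //; rewrite inE h2 orbT.
Qed.

Lemma geigenM n (F : 'rV[C]_n -> 'rV[C]_n) l l' a b : holo_germ F -> F 0 = 0 ->
  geigen F l a -> geigen F l' b -> geigen F (l * l') (fun x => a x * b x).
Proof.
move=> hF F0 [i hi] [j hj]; have [L kL mL] := killM hF F0 hi hj.
exists (size L); rewrite (_ : nseq _ _ = L) //; apply/esym/all_pred1P/allP => x /mL[u [v [hu hv ->]]].
by move: hu hv; rewrite !mem_nseq => /andP[_ /eqP ->] /andP[_ /eqP ->] /=.
Qed.

Lemma kill_common n (F : 'rV[C]_n -> 'rV[C]_n) (I : finType) (P : I -> 'rV[C]_n -> C) (Q : C -> Prop) :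
  holo_germ F -> F 0 = 0 ->
  (forall i, exists2 ls, kill (pull F) (@nz n) ls (P i) & forall x, x \in ls -> Q x) ->
  exists2 ls, kill (pull F) (@nz n) ls (\sum_i P i) & forall x, x \in ls -> Q x.
Proof.
move=> hF F0 h.
have Tl := @pull_lin n F; have ZT u := @nz_pull n F u hF F0.
have Z0 := @nz0 n; have Zl := @nz_lin n.
elim: (index_enum I) => [|i s [ls kls Qls]].
  by exists [::] => //; rewrite big_nil; exact: nz0.
have [ls' kls' Qls'] := h i; exists (ls ++ ls').
  by rewrite big_cons; apply: killD => //; [exact: kill_catr | exact: kill_catl].
by move=> x; rewrite mem_cat => /orP[/Qls|/Qls'].
Qed.

(** Cayley-Hamilton in factored form, the characteristic polynomial being split over [C]. *)
Lemma cayley_roots n (J : 'M[C]_n) : exists2 ls : seq C,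
  (forall l, l \in ls -> root (char_poly J) l) &
  forall m (M : 'M[C]_(m, n)), foldl (fun y l => y *m (J - l%:M)) M ls = 0.
Proof.
have [ls E] := closed_field_poly_normal (char_poly J).
have lc : lead_coef (char_poly J) = 1 by apply/monicP; exact: char_poly_monic.
exists ls.
  move=> l lls; rewrite E lc scale1r root_prod_XsubC //.
case: n J E lc => [|n] J E lc m M; first by rewrite [LHS]thinmx0.
have h (s : seq C) (N : 'M[C]_(m, n.+1)) : foldl (fun y l => y *m (J - l%:M)) N s =
    N *m horner_mx J (\prod_(z <- s) ('X - z%:P)).
  elim: s N => [|l s IH] N /=; first by rewrite big_nil rmorph1 mulmx1.
  by rewrite IH big_cons rmorphM rmorphB /= horner_mx_X horner_mx_C mulmxA.
rewrite h; have := Cayley_Hamilton J; rewrite {1}E lc scale1r => ->.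
exact: mulmx0.
Qed.

Lemma form_killed n (J : 'M[C]_n) (u : 'cV[C]_n) : exists ls,
  kill (pull (lin J)) (@nz n) ls (fun x => (x *m u) 0 0).
Proof.
have [ls _ h] := cayley_roots J; exists ls.
have E (s : seq C) (M : 'M[C]_n) : foldl (fun y l => pull (lin J) y - l *: y) (fun x : 'rV[C]_n => (x *m M *m u) 0 0) s =
   (fun x : 'rV[C]_n => (x *m foldl (fun y l => (J - l%:M) *m y) M s *m u) 0 0).
  elim: s M => [//|l s IH] M /=; rewrite -IH; congr foldl; apply/funext => x.
  rewrite -[LHS]/((x *m J *m M *m u) 0 0 - l * (x *m M *m u) 0 0).
  by rewrite mulmxBl mul_scalar_mx mulmxBr !mulmxA mulmxBl -scalemxAr -scalemxAl !mxE.
have comm (s : seq C) (M : 'M[C]_n) : (forall l, M *m (J - l%:M) = (J - l%:M) *m M) ->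
    foldl (fun y l => (J - l%:M) *m y) M s = foldl (fun y l => y *m (J - l%:M)) M s.
  elim: s M => [//|l s IH] M hM /=; rewrite -hM IH // => l'.
  have cJ (k : C) : comm_mx J (J - k%:M).
    by apply: comm_mxB; [exact: comm_mx_refl | exact: comm_mx_scalar].
  have c2 : comm_mx (J - l%:M) (J - l'%:M).
    apply: comm_mxB; last by exact: comm_mx_scalar.
    by apply: comm_mx_sym; exact: cJ.
  by rewrite mulmxA -hM -!mulmxA; congr (_ *m _); exact: c2.
have E1 : (fun x : 'rV[C]_n => (x *m u) 0 0) = (fun x => (x *m 1%:M *m u) 0 0).
  by apply/funext => x; rewrite mulmx1.
rewrite /kill E1 E comm; last by move=> l; rewrite mul1mx mulmx1.
by rewrite h; apply/near0P; exists 1 => // x _; rewrite mulmx0 mul0mx mxE.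
Qed.

Lemma hom_killed n k (J : 'M[C]_n) (P : 'rV[C]_n -> C) : hom k P ->
  exists ls, kill (pull (lin J)) (@nz n) ls P.
Proof.
have hJ := holo_lin_map J; have J0 := lin0 J.
elim: k P => [|k IH] P /=.
  move=> [c hc]; exists [:: 1]; apply/near0P; exists 1 => // x _.
  by rewrite -[LHS]/(P (lin J x) - 1 * P x) !hc mul1r subrr.
move=> [Q [hQ /funext EP]].
have [|ls h _] := @kill_common n (lin J) 'I_n (fun l x => x 0 l * Q l x) (fun _ => True) hJ J0.
  move=> l; have [ls1 h1] := form_killed J (delta_mx l 0).
  have [ls2 h2] := IH _ (hQ l); have [L hL _] := killM hJ J0 h1 h2.
  exists L => //; move: hL; congr (kill _ _ _ _); apply/funext => x; congr (_ * _).
  by rewrite -colE mxE.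
by exists ls; rewrite EP; move: h; congr (kill _ _ _ _); apply/funext => x; rewrite fct_sumE.
Qed.

End GermOperators.

(** * Generalized eigengerms of a contraction *)

Section NormalFormDynamics.
Variables (R : realType) (n : nat).
Local Notation C := (CC R).
Variables (F : 'rV[C]_n -> 'rV[C]_n) (J : 'M[C]_n) (c th r : R).
Hypotheses (hF : holo_germ F) (F0 : F 0 = 0) (FJ : first_order F J) (Fc : contracts F c th r).
Implicit Types (w b P Q : 'rV[C]_n -> C).
Local Notation T := (pull F).
Local Notation S := (pull (lin J)).
Local Notation nz := (@nz R n).

Let Tl := @pull_lin R n F.
Let Sl := @pull_lin R n (lin J).
Let Z0 := @nz0 R n.
Let Zl := @nz_lin R n.
Let ZT u := @nz_pull R n F u hF F0.
Let ZS u := @nz_pull R n (lin J) u (holo_lin_map J) (lin0 J).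
Let OT k (u : 'rV[C]_n -> C) (h : ord k u) : ord k (T u) := ord_comp hF F0 h.

Lemma pull_leading k P : hom k P -> ord k.+1 (fun x => P (F x) - P (lin J x)).
Proof.
elim: k P => [|k IH] P /=.
  by move=> [a ha]; exists 0 => //; apply: near0S hF => x _; rewrite !ha subrr nm0 mul0r.
move=> [Q [hQ EP]].
have h1 l : ord k.+2 (fun x => (F x 0 l - (x *m J) 0 l) * Q l (F x)).
  by have := ordM (FJ l) (ord_comp hF F0 (hom_ord (hQ l))).
have h2 l : ord k.+2 (fun x => (x *m J) 0 l * (Q l (F x) - Q l (lin J x))).
  have h3 : ord 1 (fun x => (x *m J) 0 l).
    by have := ord_comp (holo_lin_map J) (lin0 J) (@coord_ord1 R n l).
  by have := ordM h3 (IH _ (hQ l)).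
apply: ord_near (ord_sum (index_enum 'I_n) (fun l => ordD (h1 l) (h2 l))).
apply: near0S hF => x _; rewrite !EP -sumrB; apply: eq_bigr => l _.
by rewrite /lin; ring.
Qed.

Lemma leading_step k w P (l : C) : hom k P -> ord k.+1 (fun x => w x - P x) ->
  hom k (S P - l *: P) /\ ord k.+1 (fun x => (T w - l *: w) x - (S P - l *: P) x).
Proof.
move=> hP oP; split.
  apply: hom_ext (homB (hom_mulmx J hP) (homZ l hP)) => x; by [].
have h1 := ord_comp hF F0 oP.
have h2 := ordB (ordD h1 (pull_leading hP)) (ordZ l oP).
apply: ord_near h2; apply: near0S hF => x _.
rewrite -[RHS]/((w (F x) - l * w x) - (P (lin J x) - l * P x)); ring.
Qed.

Lemma leading_foldl ls k w P : hom k P -> ord k.+1 (fun x => w x - P x) ->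
  hom k (foldl (fun y l => S y - l *: y) P ls) /\
  ord k.+1 (fun x => foldl (fun y l => T y - l *: y) w ls x - foldl (fun y l => S y - l *: y) P ls x).
Proof.
elim: ls w P => [//|l ls IH] w P hP oP /=.
by have [h1 h2] := leading_step l hP oP; exact: IH.
Qed.

Lemma leading_kill ls k w P : hom k P -> ord k.+1 (fun x => w x - P x) ->
  kill T (ord k.+1) ls w -> kill S nz ls P.
Proof.
move=> hP oP kw; have [h1 h2] := leading_foldl ls hP oP.
have h3 : ord k.+1 (foldl (fun y l => S y - l *: y) P ls).
  by apply: ord_near (ordB kw h2); apply: near0S hF => x _; rewrite opprB addrC subrK.
by apply/near0P; exists 1 => // x _; exact: (hom_ord_eq0 h1 h3).
Qed.

Lemma holo_step (l : C) w : holo_germ w -> holo_germ (T w - l *: w).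
Proof.
by move=> hw; apply: (holoB (holo_comp hw hF F0)); apply: holoM => //; exact: holo_cst.
Qed.

Lemma holo_foldl ls w : holo_germ w -> holo_germ (foldl (fun y l => T y - l *: y) w ls).
Proof. by elim: ls w => [//|l ls IH] w hw /=; apply: IH; exact: holo_step. Qed.

(** One degree at a time: the leading form is annihilated by factors of the linear pullback, and the
    same factors of [T] then raise the order of the germ by one. *)
Lemma annihilated w k m : holo_germ w -> ord k w -> exists ls, kill T (ord (k + m)) ls w.
Proof.
move=> hw ow; elim: m => [|m [ls kls]]; first by exists [::]; rewrite addn0.
have hw' := holo_foldl ls hw.
have [P hP oP] := leading_form hw' kls.
have [ls' kls'] := hom_killed J hP.
exists (ls ++ ls'); rewrite /kill foldl_cat.
have [h1 h2] := leading_foldl ls' hP oP.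
have h3 : ord (k + m).+1 (foldl (fun y l => S y - l *: y) P ls') by exact: nz_ord.
rewrite addnS; apply: ord_near (ordD h2 h3); apply: near0S hF => x _; by rewrite subrK.
Qed.

(** Along an orbit [w (F^i x) = l ^ i * w x], whereas the order of [w] bounds the left side by a
    constant times [(th ^ M) ^ i]. *)
Lemma flat_eigen w M (l : C) : l != 0 -> th ^+ M < nm l -> ord M w -> nz (T w - l *: w) -> nz w.
Proof.
move=> l0 tl [e e0 /near0P[r1 r10 he]] /near0P[r2 r20 hw].
have [c1 /andP[th0 th1] r0 hc] := Fc.
pose rho := Num.min r (Num.min r1 r2 / c).
have c0 : 0 < c by lra.
have rho0 : 0 < rho by rewrite lt_min r0 /= divr_gt0 // lt_min r10.
apply/near0P; exists rho => // x.
rewrite lt_min => /andP[xr]; rewrite ltr_pdivlMr // => xc.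
have bnd i : nm (iter i F x) < Num.min r1 r2.
  apply: (le_lt_trans (hc x xr i)); apply: le_lt_trans xc; rewrite mulrC mulrA.
  apply: ler_piMr; first by rewrite mulr_ge0 ?nm_ge0 // ltW.
  by apply: exprn_ile1; exact: ltW.
have Ei i : w (iter i F x) = l ^+ i * w x.
  elim: i => [|i IH]; first by rewrite mul1r.
  have := hw (iter i F x); have := bnd i; rewrite lt_min => /andP[_ b2] /(_ b2).
  rewrite -[X in X = _ -> _]/(w (F (iter i F x)) - l * w (iter i F x)) => /eqP.
  by rewrite subr_eq0 => /eqP; rewrite iterS => ->; rewrite IH exprS mulrA.
have nl : 0 < nm l by rewrite nm_gt0.
pose q := th ^+ M / nm l.
have qq : 0 <= q < 1.
  by rewrite divr_ge0 ?exprn_ge0 ?(ltW th0) ?(ltW nl) //= ltr_pdivrMr // mul1r.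
apply: nm0_eq0; apply: (@geo_le R q (e * (c * nm x) ^+ M) _ _ qq) => i; rewrite add0r.
have li : 0 < nm l ^+ i by rewrite exprn_gt0.
rewrite -(ler_pM2l li) -nmX -nmM -Ei.
have b1 : nm (iter i F x) < r1 by have := bnd i; rewrite lt_min => /andP[].
apply: (le_trans (he _ b1)).
have -> : nm (l ^+ i) * (e * (c * nm x) ^+ M * q ^+ i) = e * (c * th ^+ i * nm x) ^+ M.
  have -> : (c * th ^+ i * nm x) ^+ M = (c * nm x) ^+ M * (th ^+ M) ^+ i.
    by rewrite mulrAC exprMn -!exprM [(i * M)%N]mulnC.
  have -> : q ^+ i = (th ^+ M) ^+ i / nm l ^+ i by rewrite /q expr_div_n.
  by rewrite nmX; field; rewrite gt_eqF.
apply: ler_wpM2l => //; apply: lerXn2r; rewrite ?nnegrE ?nm_ge0 //; last exact: hc.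
by rewrite !mulr_ge0 ?exprn_ge0 ?nm_ge0 // ltW.
Qed.

Lemma flat_geigen w M (l : C) : l != 0 -> th ^+ M < nm l -> ord M w -> geigen F l w -> nz w.
Proof.
move=> l0 tl ow [k]; elim: k w ow => [//|k IH] w ow kw.
apply: (flat_eigen l0 tl ow); apply: IH; last exact: kw.
exact: (ordB (OT ow) (ordZ l ow)).
Qed.

(** [T - l] is onto on germs of order [M]: rewritten as [d = (d o F - e) / l], the equation is a
    functional equation with multiplier [l^-1] on a single index. *)
Lemma flat_solve M (l : C) e : l != 0 -> th ^+ M < nm l -> holo_germ e -> ord M e ->
  exists d, [/\ holo_germ d, ord M d & nz (T d - l *: d - e)].
Proof.
move=> l0 tl he oe; have nl : 0 < nm l by rewrite nm_gt0.
have [||||||a [ha oa Ea]] := @functional_equation R n F c th r unit id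
    (fun _ _ => l^-1) (fun _ x => - l^-1 * e x) M (nm l)^-1 hF F0 Fc.
- by move=> _; exact: holo_cst.
- by move=> _; apply: holoM => //; exact: holo_cst.
- by move=> _; exact: ordZ.
- by rewrite invr_ge0 ltW.
- by rewrite mulrC ltr_pdivrMr // mul1r.
- by move=> _; apply: near0S hF => x _; rewrite nmV.
exists (a tt); split=> //; apply: near0S Ea => x /(_ tt) /= E.
rewrite -[LHS]/(a tt (F x) - l * a tt x - e x) E; by field.
Qed.

(** An approximate generalized eigenvector becomes exact after a correction of order [M]: correct
    [T w - l *: w] by induction, then lift the correction through [T - l]. *)
Lemma flat_correct M (l : C) k w : l != 0 -> th ^+ M < nm l -> holo_germ w ->
  kill T (ord M) (nseq k l) w ->
  exists d, [/\ holo_germ d, ord M d & kill T nz (nseq k l) (w - d)].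
Proof.
move=> l0 tl; elim: k w => [|k IH] w hw kw.
  by exists w; split=> //; apply: near0S hF => x _; rewrite -[LHS]/(w x - w x) subrr.
have [d' [hd' od' kd']] := IH (T w - l *: w) (holo_step l hw) kw.
have [d [hd od Ed]] := flat_solve l0 tl hd' od'.
exists d; split; [exact: hd | exact: od | rewrite /kill /=].
have -> : T (w - d) - l *: (w - d) = ((T w - l *: w) - d') - (T d - l *: d - d').
  by rewrite (opB Tl); move: (T w - l *: w) (T d - l *: d) => a b; rewrite opprB addrA subrK.
by apply: (killB Tl Z0 Zl ZT) => //; apply: (kill_Z _ Zl ZT).
Qed.

Lemma geo_exp (l : C) : l != 0 -> exists M, forall M', (M <= M')%N -> th ^+ M' < nm l.
Proof.
move=> l0; have [_ /andP[th0 th1] _ _] := Fc; have nl : 0 < nm l by rewrite nm_gt0.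
have [|M] := @geo_small R th 1 (nm l) _ nl; first by rewrite (ltW th0).
rewrite mul1r => hM; exists M => M' MM'; apply: le_lt_trans hM.
by apply: ler_wiXn2l => //; exact: ltW.
Qed.

(** Modulo high order, the linear form [b] is annihilated by finitely many factors and has an
    [l]-component [w1]. The complementary component has no linear part, so [w1] is tangent to [b]; a
    flat correction makes it an exact generalized eigengerm. *)
Lemma eigen_germ (b : 'rV[C]_n -> C) (l : C) : l != 0 -> hom 1 b -> geigen (lin J) l b ->
  exists v, [/\ holo_germ v, geigen F l v & ord 2 (fun x => v x - b x)].
Proof.
move=> l0 hb gb; have [M0 hM0] := geo_exp l0.
(* The order [M.+1] is at least 2, so corrections of that order leave the linear part unchanged. *)
pose M := M0.+1; have tl : th ^+ M.+1 < nm l by apply: hM0; rewrite -addn2 leq_addr.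
have [ls kls] := annihilated M (hom_holo hb) (hom_ord hb).
pose H (w : 'rV[C]_n -> C) := holo_germ w /\ ord 1 w.
have H0 : H 0 by split; [exact: holo_cst | exact: ord_zero].
have Hl a u v : H u -> H v -> H (a *: u + v).
  by move=> [h1 h2] [h3 h4]; split; [exact: holo_lin | exact: ord_lin].
have HT u : H u -> H (T u) by move=> [h1 h2]; split; [exact: (holo_comp h1 hF F0) | exact: OT].
have Hb : H b by split; [exact: hom_holo hb | exact: hom_ord].
have [w1 [w2 [E [[h1 o1] [h2 o2]] [k g1] [ls' l0n k2]]]] :=
  @fitting _ _ T (ord M.+1) Tl (@ord_zero R n _) (@ord_lin R n _) (@OT M.+1) H H0 Hl HT ls l b Hb kls.
have [P1 hP1 oP1] := leading_form h1 o1; have [P2 hP2 oP2] := leading_form h2 o2.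
have EP x : b x = P1 x + P2 x.
  apply/eqP; rewrite -subr_eq0; apply/eqP.
  apply: (@hom_ord_eq0 R n 1 (fun x => b x - (P1 x + P2 x))); first by apply: homB => //; exact: homD.
  apply: ord_near (ordD oP1 oP2); apply: near0S hF => y _.
  by rewrite E -[(w1 + w2) y]/(w1 y + w2 y); ring.
have M2 ls0 w : kill T (ord M.+1) ls0 w -> kill T (ord 2) ls0 w by apply: ord_leq; rewrite ltnS.
have g1' : kill S nz (nseq k l) P1 := leading_kill hP1 oP1 (M2 _ _ g1).
have k2' : kill S nz ls' P2 := leading_kill hP2 oP2 (M2 _ _ k2).
have [k' gb'] := gb.
have P2E : P2 = b - P1 by apply/funext => x; rewrite -[RHS]/(b x - P1 x) EP addrC addKr.
(* [P2] is a difference of two generalized eigenvectors for [l], and it is also killed by factors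
   that avoid [l]. *)
have P2z : nz P2.
  apply: (@kill_disjoint _ _ S nz Sl Z0 Zl ZS (nseq k' l ++ nseq k l) ls') => //.
    by move=> x; rewrite mem_cat !mem_nseq => /orP[/andP[_ /eqP ->]|/andP[_ /eqP ->]].
  rewrite P2E; apply: (killB Sl Z0 Zl ZS); first by apply: (kill_catl Z0 Zl ZS); exact: gb'.
  by apply: (kill_catr Sl Z0 Zl ZS); exact: g1'.
have {}P2z := hom_near0 hP2 P2z.
have [d [hd od kd]] := flat_correct l0 tl h1 g1.
exists (w1 - d); split; [exact: holoB | by exists k | ].
have od2 : ord 2 d by apply: ord_leq od; rewrite ltnS.
apply: ord_near (ordB oP1 od2); apply: near0S hF => x _.
by rewrite EP P2z addr0 -[(w1 - d) x]/(w1 x - d x) addrAC.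
Qed.

(** * Finite resonant expansions *)

Section Resonances.
Variables (I : finType) (X ell : I -> 'rV[C]_n -> C) (chi : I -> C) (eps : I -> 'I_n -> C).
Hypotheses (hX : forall i, holo_germ (X i)) (hell : forall i, hom 1 (ell i)).
Hypothesis Xell : forall i, ord 2 (fun x => X i x - ell i x).
Hypothesis gell : forall i, geigen (lin J) (chi i) (ell i).
Hypothesis gX : forall i, chi i != 0 -> geigen F (chi i) (X i).
Hypothesis basis : forall (x : 'rV[C]_n) l, x 0 l = \sum_i eps i l * ell i x.

(** A polynomial in the [Y i], with monomials written as words in the indices: multiplication by a
    factor is then a cons, and exponents can be recovered by counting letters. *)
Definition words (Y : I -> 'rV[C]_n -> C) (L : seq (C * seq I)) (x : 'rV[C]_n) :=
  \sum_(t <- L) t.1 * \prod_(i <- t.2) Y i x.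

Lemma words_cat Y L L' x : words Y (L ++ L') x = words Y L x + words Y L' x.
Proof. exact: big_cat. Qed.

Lemma hom_words k P : hom k P -> exists2 L, (forall t, t \in L -> size t.2 = k) &
  forall x, P x = words ell L x.
Proof.
elim: k P => [|k IH] P /=.
  move=> [a ha]; exists [:: (a, [::])]; first by move=> t; rewrite inE => /eqP ->.
  by move=> x; rewrite ha /words big_seq1 big_nil mulr1.
move=> [Q [hQ EP]].
have sum (D : Type) (s : seq D) (G : D -> 'rV[C]_n -> C) :
   (forall d, exists2 L, (forall t, t \in L -> size t.2 = k.+1) & forall x, G d x = words ell L x) ->
   exists2 L, (forall t, t \in L -> size t.2 = k.+1) & forall x, \sum_(d <- s) G d x = words ell L x.
  move=> h; elim: s => [|d s [L hL EL]]; first by exists [::] => // x; rewrite /words !big_nil.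
  have [L' hL' EL'] := h d; exists (L' ++ L).
    by move=> t; rewrite mem_cat => /orP[/hL'|/hL].
  by move=> x; rewrite big_cons words_cat EL' EL.
have [|L hL EL] := sum _ (index_enum ('I_n * I)%type) (fun li x => eps li.2 li.1 * ell li.2 x * Q li.1 x).
  move=> [l i] /=; have [L hL EL] := IH _ (hQ l).
  exists [seq (eps i l * t.1, i :: t.2) | t <- L].
    by move=> t /mapP[t' /hL ht' ->] /=; rewrite ht'.
  move=> x; rewrite EL /words big_map mulr_sumr; apply: eq_bigr => t _ /=.
  by rewrite big_cons; ring.
exists L => // x; rewrite EP -EL.
transitivity (\sum_l \sum_i eps i l * ell i x * Q l x).
  by apply: eq_bigr => l _; rewrite basis mulr_suml.
by rewrite pair_big.
Qed.

Lemma geigen_word (G : 'rV[C]_n -> 'rV[C]_n) (Y : I -> 'rV[C]_n -> C) (s : seq I) : holo_germ G -> G 0 = 0 ->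
  (forall i, i \in s -> geigen G (chi i) (Y i)) ->
  geigen G (\prod_(i <- s) chi i) (fun x => \prod_(i <- s) Y i x).
Proof.
move=> hG G0; elim: s => [|i s IH] h.
  rewrite big_nil; exists 1%N; apply: near0S hF => x _.
  by rewrite /= -[LHS]/(\prod_(i <- [::]) Y i (G x) - 1 * \prod_(i <- [::]) Y i x) !big_nil mul1r subrr.
rewrite big_cons (_ : (fun x => _) = (fun x => Y i x * \prod_(i <- s) Y i x)).
  apply: geigenM => //; first by apply: h; rewrite mem_head.
  by apply: IH => j js; apply: h; rewrite inE js orbT.
by apply/funext => x; rewrite big_cons.
Qed.

Lemma word_leading (s : seq I) :
  ord (size s).+1 (fun x => \prod_(i <- s) X i x - \prod_(i <- s) ell i x) /\
  ord (size s) (fun x => \prod_(i <- s) X i x).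
Proof.
have oX i : ord 1 (X i).
  apply: ord_near (ordD (ordS (Xell i)) (hom_ord (hell i))).
  by apply: near0S hF => x _; rewrite subrK.
elim: s => [|i s [IH1 IH2]] /=.
  split; first by exists 0 => //; apply: near0S hF => x _; rewrite !big_nil subrr nm0 mul0r.
  apply: ord_holo; exact: holo_prod.
split.
  have h1 := ordM (Xell i) IH2; have h2 := ordM (hom_ord (hell i)) IH1.
  apply: ord_near (ordD h1 h2); apply: near0S hF => x _; rewrite !big_cons; ring.
have := ordM (oX i) IH2; apply: ord_near; apply: near0S hF => x _; by rewrite big_cons.
Qed.

Lemma words_leading k L : (forall t, t \in L -> size t.2 = k) ->
  ord k.+1 (fun x => words X L x - words ell L x).
Proof.
elim: L => [|t L IH] hL.
  by exists 0 => //; apply: near0S hF => x _; rewrite /words !big_nil subrr nm0 mul0r.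
have h1 : ord k.+1 (fun x => words X L x - words ell L x).
  by apply: IH => t' h; apply: hL; rewrite inE h orbT.
have h2 := (word_leading t.2).1; rewrite hL ?mem_head // in h2.
apply: ord_near (ordD (ordZ t.1 h2) h1); apply: near0S hF => x _.
by rewrite /words !big_cons; ring.
Qed.

Lemma words_holo L : holo_germ (words X L).
Proof.
by apply: holo_sum => t; apply: holoM; [exact: holo_cst | apply: holo_prod].
Qed.

Lemma geigen_lin (G : 'rV[C]_n -> 'rV[C]_n) (l a : C) (u v : 'rV[C]_n -> C) : holo_germ G -> G 0 = 0 -> geigen G l u -> geigen G l v ->
  geigen G l (a *: u + v).
Proof.
move=> hG G0 [i hi] [j hj]; exists (i + j)%N; rewrite nseqD.
apply: (kill_lin (@pull_lin _ _ G) Zl); first by apply: (kill_catl Z0 Zl (fun u => @nz_pull _ _ G u hG G0)); exact: hi.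
by apply: (kill_catr (@pull_lin _ _ G) Z0 Zl (fun u => @nz_pull _ _ G u hG G0)); exact: hj.
Qed.

Lemma geigen0 (G : 'rV[C]_n -> 'rV[C]_n) (l : C) : geigen G l 0.
Proof. by exists 0%N; exact: Z0. Qed.

Lemma words_geigen (G : 'rV[C]_n -> 'rV[C]_n) (Y : I -> 'rV[C]_n -> C) (l : C) L : holo_germ G -> G 0 = 0 ->
  (forall t, t \in L -> \prod_(i <- t.2) chi i = l) ->
  (forall t i, t \in L -> i \in t.2 -> geigen G (chi i) (Y i)) -> geigen G l (words Y L).
Proof.
move=> hG G0; elim: L => [|t L IH] hL hY.
  by rewrite (_ : words Y [::] = 0); [exact: geigen0 | apply/funext => x; rewrite /words big_nil].
rewrite (_ : words Y (t :: L) = t.1 *: (fun x => \prod_(i <- t.2) Y i x) + words Y L).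
  apply: geigen_lin => //.
    rewrite -(hL t (mem_head _ _)); apply: geigen_word => // i it; apply: (hY t) => //; exact: mem_head.
  by apply: IH => [t' h|t' i h hi]; [apply: hL | apply: (hY t') => //]; rewrite inE h orbT.
by apply/funext => x; rewrite /words big_cons.
Qed.

Lemma words_kill_other (l : C) L : (forall t, t \in L -> \prod_(i <- t.2) chi i != l) ->
  exists2 ls, l \notin ls & kill S nz ls (words ell L).
Proof.
elim: L => [|t L IH] hL.
  by exists [::] => //; apply: near0S hF => x _; rewrite /words /= big_nil.
have [|ls ln kls] := IH; first by move=> t' h; apply: hL; rewrite inE h orbT.
have [k kt] : geigen (lin J) (\prod_(i <- t.2) chi i) (fun x => \prod_(i <- t.2) ell i x).
  by apply: geigen_word => //; [exact: holo_lin_map | exact: lin0].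
exists (nseq k (\prod_(i <- t.2) chi i) ++ ls).
  by rewrite mem_cat mem_nseq negb_or ln andbT negb_and eq_sym (hL t (mem_head _ _)) orbT.
rewrite (_ : words ell (t :: L) = t.1 *: (fun x => \prod_(i <- t.2) ell i x) + words ell L).
  by apply: (kill_lin Sl Zl); [apply: (kill_catl Z0 Zl ZS); exact: kt | apply: (kill_catr Sl Z0 Zl ZS); exact: kls].
by apply/funext => x; rewrite /words big_cons.
Qed.

Lemma prod_neq0 (s : seq I) : \prod_(i <- s) chi i != 0 -> forall i, i \in s -> chi i != 0.
Proof.
move=> h i si; apply: contra h => /eqP ci; apply/eqP; rewrite (big_rem i) //=.
by rewrite ci mul0r.
Qed.

(** Expand the leading form in words in the [ell i]. Its non-resonant words sum to zero, being
    killed by factors different from [l]; subtracting the resonant words in the germs [X i] raises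
    the order. At order [M] a generalized eigengerm is zero, so the process stops and the expansion
    is finite and exact. *)
Lemma resonant_expansion (l : C) w : l != 0 -> holo_germ w -> geigen F l w ->
  exists2 L, (forall t, t \in L -> \prod_(i <- t.2) chi i = l) &
    \forall x \near (0 : 'rV[C]_n), w x = words X L x.
Proof.
move=> l0 hw gw; have [M hM] := geo_exp l0.
suff H m k u : (M <= k + m)%N -> holo_germ u -> ord k u -> geigen F l u ->
   exists2 L, (forall t, t \in L -> \prod_(i <- t.2) chi i = l) &
    \forall x \near (0 : 'rV[C]_n), u x = words X L x.
  by apply: (H M 0%N) => //; exact: ord_holo.
elim: m k u => [|m IH] k u Mk hu ou gu.
  exists [::] => //; rewrite addn0 in Mk.
  have := flat_geigen l0 (hM _ Mk) ou gu; apply: near0S => x ->; by rewrite /words big_nil.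
have [P hP oP] := leading_form hu ou.
have [L hL EL] := hom_words hP.
pose res (t : C * seq I) := \prod_(i <- t.2) chi i == l.
pose L1 := [seq t <- L | res t]; pose L2 := [seq t <- L | ~~ res t].
have EP : P = words ell L1 + words ell L2.
  apply/funext => x; rewrite -[RHS]/(words ell L1 x + words ell L2 x) EL /words.
  by rewrite (bigID res) /= !big_filter.
have hL1 t : t \in L1 -> \prod_(i <- t.2) chi i = l by rewrite mem_filter => /andP[/eqP].
have sL1 t : t \in L1 -> size t.2 = k by rewrite mem_filter => /andP[_ /hL].
(* A resonant word has non-zero weight [l], so it uses only those [X i] that are known to be
   generalized eigengerms. *)
have nzc t : t \in L1 -> forall i, i \in t.2 -> chi i != 0.
  by move=> /hL1 h; apply: prod_neq0; rewrite h.
have g1 : geigen F l (words X L1).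
  by apply: words_geigen => // t i tL it; apply: gX; exact: (nzc t).
have hJ := holo_lin_map J; have J0 := lin0 J.
have g1' : geigen (lin J) l (words ell L1) by apply: words_geigen.
have gP : geigen (lin J) l P.
  have [j kj] := gu; exists j; apply: (leading_kill hP oP); exact: nz_ord.
have [ls2 ln2 k2] : exists2 ls, l \notin ls & kill S nz ls (words ell L2).
  by apply: words_kill_other => t; rewrite mem_filter => /andP[].
have z2 : nz (words ell L2).
  have [j kj] : geigen (lin J) l (words ell L2).
    rewrite (_ : words ell L2 = (-1) *: words ell L1 + P); first exact: geigen_lin.
    by rewrite EP scaleN1r addKr.
  apply: (@kill_disjoint _ _ S nz Sl Z0 Zl ZS (nseq j l) ls2) => //.
  by move=> x; rewrite mem_nseq => /andP[_ /eqP ->].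
have [||||L' hL' EL'] := IH k.+1 (u - words X L1).
- by rewrite addSnnS.
- by apply: holoB => //; exact: words_holo.
- apply: ord_near (ordB oP (words_leading sL1)); apply: near0S z2 => x z2x.
  rewrite -[RHS]/(u x - words X L1 x) EP -[(_ + _) x]/(words ell L1 x + words ell L2 x) z2x; ring.
- rewrite (_ : u - words X L1 = (-1) *: words X L1 + u); first exact: geigen_lin.
  by rewrite scaleN1r addrC.
exists (L1 ++ L').
  by move=> t; rewrite mem_cat => /orP[/hL1|/hL'].
apply: near0S EL' => x; rewrite words_cat -[X in X = _ -> _]/(u x - words X L1 x) => <-.
by rewrite addrC subrK.
Qed.

End Resonances.

End NormalFormDynamics.

(** * The cotangent map and the critical divisor *)

Section AdaptedBases.
Variables (R : realType) (d : nat).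
Local Notation C := (CC R).
Variable M : 'M[C]_d.

Local Notation T := (fun w : 'rV[C]_d => w *m M).
Local Notation zero := (fun w : 'rV[C]_d => w = 0).

Definition roweig (l : C) (w : 'rV[C]_d) := geig T zero l w.

(** The rows of [B] are a basis of an [M]-stable subspace on which [M] has characteristic polynomial
    [P]. *)
Definition stable_rows k (B : 'M[C]_(k, d)) (P : {poly C}) :=
  row_free B /\ exists2 Y, B *m M = Y *m B & char_poly Y = P.

Let Tl a (u v : 'rV[C]_d) : (a *: u + v) *m M = a *: (u *m M) + v *m M.
Proof. by rewrite mulmxDl scalemxAl. Qed.
Let Zl a (u v : 'rV[C]_d) : u = 0 -> v = 0 -> a *: u + v = 0.
Proof. by move=> -> ->; rewrite scaler0 addr0. Qed.
Let ZT (u : 'rV[C]_d) : u = 0 -> u *m M = 0.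
Proof. by move=> ->; rewrite mul0mx. Qed.

Lemma row_fitting l0 (w : 'rV[C]_d) : exists w1 w2 : 'rV[C]_d, [/\ w = w1 + w2, roweig l0 w1 &
   exists2 ls', l0 \notin ls' & kill T zero ls' w2].
Proof.
have [ls _ h] := cayley_roots M.
have kw : kill T zero ls w.
  rewrite /kill -[RHS](h 1%N w); elim: ls w {h} => [//|l ls IH] w /=.
  by rewrite IH mulmxBr mul_mx_scalar.
have [||||w1 [w2 [E _ g1 k2]]] := @fitting _ _ T zero Tl erefl Zl ZT (fun=> True) _ _ _ ls l0 w _ kw => //.
by exists w1, w2.
Qed.

(** The vectors obtained from [w] by applying [M - l] repeatedly end at 0; the last one outside the
    span of [B] is an eigenvector modulo that span. *)
Lemma extend_row k (B : 'M[C]_(k, d)) l w : (B *m M <= B)%MS -> roweig l w -> ~~ (w <= B)%MS ->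
  exists b : 'rV[C]_d, [/\ roweig l b, ~~ (b <= B)%MS & (b *m M - l *: b <= B)%MS].
Proof.
move=> sB [n]; elim: n w => [|n IH] w; first by rewrite /kill /= => ->; rewrite sub0mx.
move=> kw nw; have [h|h] := boolP (w *m M - l *: w <= B)%MS; last by apply: IH h.
by exists w; split=> //; exists n.+1.
Qed.

Lemma stable_rows_add k (B : 'M[C]_(k, d)) P l (b : 'rV[C]_d) : stable_rows B P ->
  ~~ (b <= B)%MS -> (b *m M - l *: b <= B)%MS -> stable_rows (col_mx B b) (P * ('X - l%:P)).
Proof.
move=> [fB [Y EY cY]] nb /submxP[D ED]; split.
  rewrite -kermx_eq0; apply/eqP/row_matrixP => i; rewrite row0.
  have := row_sub i (kermx (col_mx B b)); move: (row i _) => u /sub_kermxP.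
  rewrite -[u]hsubmxK mul_row_col [rsubmx u]mx11_scalar mul_scalar_mx.
  have [->|c0] := eqVneq (rsubmx u 0 0) 0.
    rewrite scale0r addr0 => h; have -> : lsubmx u = 0.
      by apply: (row_free_inj fB); rewrite h mul0mx.
    by rewrite (raddf0 (@scalar_mx C 1)) row_mx0.
  move=> /eqP; rewrite addrC addr_eq0 => /eqP h; case/negP: nb.
  rewrite -[b]scale1r -(mulVf c0) -scalerA h; apply: scalemx_sub.
  by rewrite -mulNmx; exact: submxMl.
exists (block_mx Y 0 D l%:M).
  rewrite mul_col_mx mul_block_col mul0mx addr0 EY; congr col_mx.
  by rewrite -ED mul_scalar_mx subrK.
rewrite -cY /char_poly /char_poly_mx map_block_mx map_mx0 (map_scalar_mx (@polyC _)) /=.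
rewrite scalar_mx_block opp_block_mx add_block_mx oppr0 addr0 det_lblock.
by rewrite det_mx11 !mxE.
Qed.

Lemma stable_rows_cast k k' (E : k = k') (B : 'M[C]_(k, d)) P :
  stable_rows (castmx (E, erefl) B) P <-> stable_rows B P.
Proof. by case: _ / E; rewrite castmx_id. Qed.

(** Adds eigenvectors modulo the span, with eigenvalue in [S], until every generalized eigenvector
    of that kind is included. Each step contributes a linear factor to the characteristic
    polynomial, which keeps the count of multiplicities. *)
Lemma stable_rows_extend (S : C -> Prop) k (B : 'M[C]_(k, d)) P : stable_rows B P ->
  exists e (mu : 'I_e -> C) (N : 'M[C]_(e, d)),
  [/\ stable_rows (col_mx B N) (P * \prod_i ('X - (mu i)%:P)),
      forall i, S (mu i) /\ roweig (mu i) (row i N) &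
      forall l w, S l -> roweig l w -> (w <= col_mx B N)%MS].
Proof.
have [m] := ubnP (d - k); elim: m k B P => // m IH k B P dk sB.
have [[l [w [Sl gw nw]]]|none] := pselect (exists l w, [/\ S l, roweig l w & ~~ (w <= B)%MS]).
  have sMB : (B *m M <= B)%MS by have [_ [Y -> _]] := sB; exact: submxMl.
  have [b [gb nb sb]] := extend_row sMB gw nw.
  have sB' := stable_rows_add sB nb sb.
  have lek : (k + 1 <= d)%N.
    by have [/eqP fB' _] := sB'; rewrite -[X in (X <= _)%N]fB'; exact: rank_leq_col.
  have [|e [mu [N [sN hmu hN]]]] := IH _ _ _ _ sB'.
    by rewrite addn1 in lek *; move: dk; rewrite ltnS; apply: leq_trans; rewrite ltn_sub2l.
  have E : col_mx B (col_mx b N) = castmx (esym (addnA k 1 e), erefl) (col_mx (col_mx B b) N) := col_mxA.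
  exists (1 + e)%N, (fun i => match fintype.split i with inl _ => l | inr j => mu j end), (col_mx b N).
  split.
  - rewrite E; apply/stable_rows_cast; rewrite big_split_ord /= big_ord1.
    have -> : fintype.split (lshift e 0 : 'I_(1 + e)) = inl 0 by exact: (unsplitK (inl _ : 'I_1 + 'I_e)).
    rewrite mulrA (eq_bigr (fun i => 'X - (mu i)%:P)) // => i _.
    have -> : fintype.split (rshift 1 i : 'I_(1 + e)) = inr i by exact: (unsplitK (inr _ : 'I_1 + 'I_e)).
    by [].
  - move=> i; rewrite -(splitK i); case: (fintype.split i) => j; rewrite unsplitK.
      split=> //; rewrite (_ : row _ _ = b) //.
      by apply/rowP => x; rewrite !mxE unsplitK ord1.
    have [h1 h2] := hmu j; split=> //.
    by rewrite (_ : row _ _ = row j N) //; apply/rowP => x; rewrite !mxE unsplitK.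
  - move=> l' w' Sl' gw'; have := hN l' w' Sl' gw'; rewrite E.
    by case: _ / (esym _); rewrite castmx_id.
exists 0%N, (fun _ => 0), 0; split.
- rewrite big_ord0 mulr1 (_ : col_mx B 0 = castmx (esym (addn0 k), erefl) B); first by apply/stable_rows_cast.
  apply/matrixP => i j; rewrite castmxE !mxE; case: splitP => [i' ii'|[]//].
  by rewrite cast_ord_id; congr (B _ _); apply: val_inj.
- by case.
- move=> l w Sl gw; apply: contrapT => /negP h; apply: none; exists l, w; split=> //.
  by apply: contra h => wB; rewrite -addsmxE; exact: submx_trans wB (addsmxSl _ _).
Qed.

Lemma char_poly_stable k (B : 'M[C]_(k, d)) P : stable_rows B P -> row_full B -> char_poly M = P.
Proof.
move=> [/eqP fB [Y EY <-]] /eqP FB; have E : k = d by rewrite -fB.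
move: B Y EY fB FB; case: _ / (esym E) => B Y EY fB _; move: EY.
have uB : B \in unitmx by rewrite -row_free_unit; apply/eqP.
move=> EY; have : map_mx polyC B *m char_poly_mx M = char_poly_mx Y *m map_mx polyC B.
  rewrite /char_poly_mx mulmxBr mulmxBl -!map_mxM /= EY mul_scalar_mx mul_mx_scalar.
  by [].
move/(congr1 determinant); rewrite !det_mulmx mulrC -/(char_poly M) -/(char_poly Y).
apply: mulIf; rewrite det_map_mx polyC_eq0.
by move: uB; rewrite unitmxE unitfE.
Qed.

(** If [(M - l) w] is in the span of [B], split [w] by [row_fitting]: the [l]-part is in the span by
    hypothesis, and modulo the span the other part has coprime annihilators. *)
Lemma roweig_span k (B : 'M[C]_(k, d)) : (B *m M <= B)%MS ->
  (forall l w, roweig l w -> (w <= B)%MS) -> row_full B.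
Proof.
move=> sB hB; have [ls _ h] := cayley_roots M.
pose inB (w : 'rV[C]_d) : Prop := (w <= B)%MS.
have B0 : inB 0 by exact: sub0mx.
have Bl a u v : inB u -> inB v -> inB (a *: u + v) by move=> hu hv; apply: addmx_sub => //; exact: scalemx_sub.
have BT u : inB u -> inB (u *m M) by move=> hu; exact: submx_trans (submxMr M hu) sB.
suff H ls' w : kill T inB ls' w -> inB w.
  rewrite -sub1mx; apply/row_subP => i; apply: (H ls); rewrite /kill.
  rewrite (_ : foldl _ _ _ = 0) // -(h 1%N (row i 1%:M)).
  by elim: ls (row i _) {h} => [//|l ls IH] w /=; rewrite IH mulmxBr mul_mx_scalar.
elim: ls' w => [//|l ls' IH] w kw; have {IH} hw : inB (w *m M - l *: w) by apply: IH.
have [w1 [w2 [E g1 [l2 nl k2]]]] := row_fitting l w.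
have b1 : inB w1 := hB l w1 g1.
rewrite E; apply: addmx_sub => //.
have dis x : x \in [:: l] -> x \notin l2 by rewrite inE => /eqP ->.
have k1 : kill T inB [:: l] w2.
  have -> : w2 = w - w1 by rewrite E addrC addKr.
  rewrite /kill /= (opB Tl) /inB addmx_sub // eqmx_opp addmx_sub //; first exact: BT.
  by rewrite eqmx_opp scalemx_sub.
have k2' : kill T inB l2 w2 by rewrite /kill k2.
exact: (@kill_disjoint _ _ T inB Tl B0 Bl BT [:: l] l2 w2 dis k1 k2').
Qed.

(** [U] is extended by generalized eigenvectors for non-zero eigenvalues ([N]), then for the
    eigenvalue 0 ([Q]). Since [m] is the multiplicity of 0, the number [r + e] is that of the
    non-zero eigenvalues. *)
Lemma adapted_basis r (U : 'M[C]_(r, d)) (X : 'M[C]_r) : row_free U -> U *m M = X *m U -> X \in unitmx ->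
  exists e (mu : 'I_e -> C) (N : 'M[C]_(e, d)) m (Q : 'M[C]_(m, d)),
  [/\ [/\ row_free (col_mx (col_mx U N) Q), row_full (col_mx (col_mx U N) Q) &
       exists2 Y, Y \in unitmx & col_mx U N *m M = Y *m col_mx U N],
      forall i, mu i != 0 /\ roweig (mu i) (row i N),
      forall j, roweig 0 (row j Q),
      \prod_i ('X - (mu i)%:P) %| char_poly M &
      mup 0 (char_poly M) = m].
Proof.
move=> fU EU uX.
have sU : stable_rows U (char_poly X) by split=> //; exists X.
have [e [mu [N [sN hmu hN]]]] := stable_rows_extend (fun l => l != 0) sU.
have [m [nu [Q [sQ hnu hQ]]]] := stable_rows_extend (fun l => l = 0) sN.
have full : row_full (col_mx (col_mx U N) Q).
  have sM : (col_mx (col_mx U N) Q *m M <= col_mx (col_mx U N) Q)%MS.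
    by have [_ [Y -> _]] := sQ; exact: submxMl.
  apply: roweig_span sM _ => l w gw; have [l0|l0] := eqVneq l 0; first exact: (hQ l).
  by rewrite -addsmxE; apply: submx_trans (hN l w l0 gw) (addsmxSl _ _).
have fQ := sQ.1; have CM := char_poly_stable sQ full.
have cX : (char_poly X)`_0 != 0.
  by rewrite char_poly_det mulf_neq0 ?signr_eq0 // -unitfE -unitmxE.
have cN : (char_poly X * \prod_i ('X - (mu i)%:P)).[0] != 0.
  rewrite hornerM mulf_neq0 //; first by rewrite horner_coef0.
  rewrite horner_prod.
  by apply/prodf_neq0 => i _; rewrite !hornerE oppr_eq0; case: (hmu i).
exists e, mu, N, m, Q; split; [split=> // | exact: hmu | | | ].
- have [_ [Y EY cY]] := sN; exists Y => //.
  have := cN; rewrite -cY horner_coef0 char_poly_det mulf_eq0 negb_or => /andP[_].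
  by rewrite unitmxE unitfE.
- by move=> j; have [h1 h2] := hnu j; rewrite -h1.
- by rewrite CM -mulrA mulrCA; exact: dvdp_mulIl.
- have -> : char_poly M = char_poly X * \prod_i ('X - (mu i)%:P) * 'X ^+ m.
    rewrite CM -[X in 'X ^+ X]card_ord -prodr_const; congr (_ * _); apply: eq_bigr => i _.
    by have [-> _] := hnu i; rewrite subr0.
  by rewrite mupMr ?rootE // -['X]subr0 mup_XsubCX eqxx.
Qed.
End AdaptedBases.

(** * Independence of [du], [dv], [dy] and nilpotency along [z] *)

Section TransientRows.
Variable R : realType.
Local Notation C := (CC R).

Lemma mpow_intertwine d k (M : 'M[C]_d) (B : 'M[C]_(k, d)) Y n :
  B *m M = Y *m B -> B *m mpow M n = mpow Y n *m B.
Proof.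
move=> E; elim: n => [|n IH] /=; first by rewrite mulmx1 mul1mx.
by rewrite mulmxA IH -!mulmxA E.
Qed.

Lemma mpow_unit k (Y : 'M[C]_k) n : Y \in unitmx -> mpow Y n \in unitmx.
Proof. by move=> uY; elim: n => [|n IH] /=; rewrite ?unitmx1 // unitmx_mul IH. Qed.

Lemma mpow_add k (Y : 'M[C]_k) m n : mpow Y (m + n) = mpow Y m *m mpow Y n.
Proof. by elim: n => [|n IH]; rewrite ?addn0 ?mulmx1 // addnS /= IH mulmxA. Qed.

Lemma mpow_tr k (Y : 'M[C]_k) n : (mpow Y n)^T = mpow Y^T n.
Proof. by elim: n => [|n IH] /=; rewrite ?trmx1 // trmx_mul IH mpowC. Qed.

Lemma mpow_exp k (Y : 'M[C]_k) n : Y ^+ n = mpow Y n.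
Proof.
elim: n => [|n IH]; first exact: expr0.
by rewrite exprSr IH.
Qed.

Variables (d r e : nat) (M : 'M[C]_d) (U : 'M[C]_(r, d)) (N : 'M[C]_(e, d)).
Variables (X : 'M[C]_r) (Y : 'M[C]_(r + e)).
Hypotheses (EX : U *m M = X *m U) (uX : X \in unitmx).
Hypotheses (fS : row_free (col_mx U N)) (EY : col_mx U N *m M = Y *m col_mx U N) (uY : Y \in unitmx).

Lemma row_free0 m n (A : 'M[C]_(m, n)) : (forall u : 'rV_m, u *m A = 0 -> u = 0) -> row_free A.
Proof.
move=> h; rewrite -kermx_eq0; apply/eqP/row_matrixP => i; rewrite row0; apply: h.
by apply/sub_kermxP; exact: row_sub.
Qed.

Lemma row_freeE m n (A : 'M[C]_(m, n)) (u : 'rV_m) : row_free A -> u *m A = 0 -> u = 0.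
Proof. by move=> fA E; apply: (row_free_inj fA); rewrite E mul0mx. Qed.

(* [M] is invertible on the span of [U, N] and a power of [M] sends the rows of [Q] into the span of [U]. *)
Lemma transient_rows_free p (Q : 'M[C]_(p, d)) k : row_free (col_mx U Q) ->
  (Q *m mpow M k <= U)%MS -> row_free (col_mx (col_mx U N) Q).
Proof.
move=> fUQ /submxP[D ED]; apply: row_free0 => u.
rewrite -[u]hsubmxK mul_row_col; move: (lsubmx u) (rsubmx u) => a b E.
have uXk := mpow_unit k uX; have uYk := mpow_unit k uY.
pose u0 := - (b *m D *m invmx (mpow X k)).
have E1 : a *m col_mx U N *m mpow M k = u0 *m U *m mpow M k.
  rewrite -[RHS]mulmxA (mpow_intertwine k EX) mulmxA /u0 mulNmx mulmxKV // mulNmx -[b *m D *m U]mulmxA -ED.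
  by move/eqP: E; rewrite addr_eq0 => /eqP ->; rewrite mulNmx mulmxA.
have E2 : (a - row_mx u0 0) *m mpow Y k = 0.
  apply: (row_freeE fS); rewrite -mulmxA -(mpow_intertwine k EY) mulmxA mulmxBl mulmxBl E1.
  by rewrite mul_row_col mul0mx addr0 subrr.
have {}E2 : a = row_mx u0 0.
  by apply/eqP; rewrite -subr_eq0 -[X in X == _](mulmxK uYk) E2 mul0mx.
have E3 : row_mx u0 b = 0.
  by apply: (row_freeE fUQ); rewrite mul_row_col -E E2 mul_row_col mul0mx addr0.
have [u00 b0] : u0 = 0 /\ b = 0 by apply: eq_row_mx; rewrite E3 row_mx0.
by rewrite E2 u00 b0 !row_mx0.
Qed.

Lemma mpow_sub_stable m (Q : 'M[C]_(m, d)) : row_full (col_mx (col_mx U N) Q) ->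
  (forall j, roweig M 0 (row j Q)) -> exists n, (mpow M n <= col_mx U N)%MS.
Proof.
move=> full gQ.
have /boolp.choice[n hn] : forall j, exists n, row j Q *m mpow M n = 0.
  move=> j.
  have [k hk] := gQ j; exists k; move: hk; rewrite /kill.
  elim: k (row j Q) => [|k IH] w /=; first by rewrite mulmx1.
  by rewrite scale0r subr0 => /IH; rewrite mpowC mulmxA.
pose n0 := (\max_j n j)%N; exists n0.
have Qn : Q *m mpow M n0 = 0.
  apply/row_matrixP => j; rewrite row_mul row0.
  by rewrite -(subnKC (leq_bigmax j : n j <= n0)%N) mpow_add mulmxA hn mul0mx.
have /submxP[D ED] : (1%:M <= col_mx (col_mx U N) Q)%MS by rewrite sub1mx.
rewrite -[mpow M n0]mul1mx ED -[D]hsubmxK mul_row_col mulmxDl -[_ *m Q *m _]mulmxA Qn mulmx0 addr0.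
by rewrite -mulmxA (mpow_intertwine n0 EY) mulmxA submxMl.
Qed.

(** With [G'] the inverse of the matrix of coordinate forms, the rows of [L] are the tangent vectors
    in the [z] directions: they annihilate the other coordinate forms [W] and are dual to [Z].
    Stability of [W] gives [L *m M^T = H *m L], so [mpow H n *m L] is [L] times the transpose of
    [mpow M n], which vanishes. *)
Lemma nilpotent_block p t n (Q : 'M[C]_(p, d)) (Z : 'M[C]_(t, d)) (G' : 'M[C]_(d, r + e + p + t)) :
  (mpow M n <= col_mx U N)%MS -> (col_mx (col_mx U N) Q *m M <= col_mx (col_mx U N) Q)%MS ->
  col_mx (col_mx (col_mx U N) Q) Z *m G' = 1%:M -> G' *m col_mx (col_mx (col_mx U N) Q) Z = 1%:M ->
  mpow (dsubmx G'^T *m M^T *m Z^T) n = 0.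
Proof.
move=> /submxP[D ED] /submxP[D2 ED2]; set S := col_mx U N in D ED D2 ED2 *; set W := col_mx S Q in D2 ED2 *.
move=> GG' G'G; set L := dsubmx G'^T; set H := L *m M^T *m Z^T.
have LG : L *m (col_mx W Z)^T = row_mx 0 1%:M.
  rewrite -[L]/(dsubmx G'^T) mul_dsub_mx -trmx_mul GG' trmx1.
  by rewrite (scalar_mx_block (r + e + p) t) block_mxEv col_mxKd.
have := LG; rewrite tr_col_mx mul_mx_row => /eq_row_mx[LW LZ].
have LMW : L *m M^T *m W^T = 0 by rewrite -mulmxA -trmx_mul ED2 trmx_mul mulmxA LW mul0mx.
have LM : L *m M^T = H *m L.
  rewrite -[LHS]mulmx1 -[X in _ *m X]trmx1 -G'G trmx_mul tr_col_mx mulmxA mul_mx_row LMW.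
  rewrite -/H -[X in row_mx _ _ *m X]vsubmxK mul_row_col mul0mx add0r.
  by [].
have LS : L *m S^T = 0 by move: LW; rewrite tr_col_mx mul_mx_row -row_mx0 => /eq_row_mx[].
have HL : mpow H n *m L = 0.
  by rewrite -(mpow_intertwine n LM) -mpow_tr ED trmx_mul mulmxA LS mul0mx.
by rewrite -[mpow H n]mulmx1 -LZ mulmxA HL mul0mx.
Qed.

End TransientRows.

(** * Combinatorics of periodic components *)

Section PeriodicComponents.
Variables (q : nat) (A : 'I_q -> 'I_q -> nat).

(** The target of [k] when the pullback of [W^k] is a single component with multiplicity one, as
    recorded by [simple_comp]. Otherwise the value carries no meaning; [k] is the default for a zero
    row. *)
Definition next_comp (k : 'I_q) : 'I_q := odflt k [pick l | A k l != 0%N].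
Definition simple_comp (k : 'I_q) := A k = div_unit (next_comp k).

Local Notation tau := next_comp.

Lemma sum_div_unit (k : 'I_q) : (\sum_l div_unit k l = 1 :> nat)%N.
Proof.
by rewrite (bigD1 k) //= big1 /div_unit ?eqxx // => l /negPf ->.
Qed.

Lemma simple_compP k : (\sum_l A k l)%N = 1%N -> simple_comp k.
Proof.
move=> /eqP/sum_nat_eq1[l [_ Akl h]].
have Al j : j != l -> A k j = 0%N by move=> jl; exact: h.
have -> : simple_comp k = (A k = div_unit l).
  rewrite /simple_comp /next_comp; case: pickP => [l'|/(_ l)]; last by rewrite Akl.
  by have [->|/Al ->] := eqVneq l' l.
apply/funext => j; rewrite /div_unit; have [->|/Al -> //] := eqVneq j l.
by rewrite Akl.
Qed.

Lemma pull_div_unit k : pull_div A (div_unit k) = A k.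
Proof.
apply/funext => l; rewrite /pull_div (bigD1 k) //= big1 => [|j /negPf jk].
  by rewrite /div_unit eqxx mul1n addn0.
by rewrite /div_unit jk mul0n.
Qed.

Lemma iter_simple k n : (forall i, (i < n)%N -> simple_comp (iter i tau k)) ->
  iter n (pull_div A) (div_unit k) = div_unit (iter n tau k).
Proof.
elim: n => [//|n IH] h; rewrite iterS IH => [|i ilt]; last by apply: h; exact: ltnW.
by rewrite pull_div_unit h.
Qed.

Hypothesis A_gt0 : forall k, (0 < \sum_l A k l)%N.

Lemma sum_pull_div (v : 'I_q -> nat) : (\sum_l v l <= \sum_l pull_div A v l)%N.
Proof.
rewrite exchange_big /=; apply: leq_sum => k _.
by rewrite -big_distrr /= leq_pmulr.
Qed.

(** The total multiplicity of a divisor never decreases under pullback, the rows of [A] being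
    non-zero. On a periodic orbit it therefore stays equal to 1, so each divisor met is a single
    component. *)
Lemma periodicP k : periodic_comp A k <->
  exists2 n, (0 < n)%N & iter n tau k = k /\ forall i, (i < n)%N -> simple_comp (iter i tau k).
Proof.
split=> [[n [n0 hn]]|[n n0 [E h]]]; last first.
  by exists n; split=> // l; rewrite iter_simple // E.
have {}hn : iter n (pull_div A) (div_unit k) = div_unit k by apply/funext.
have mono i j : (\sum_l iter i (pull_div A) (div_unit k) l <=
    \sum_l iter (i + j) (pull_div A) (div_unit k) l)%N.
  elim: j => [|j IH]; first by rewrite addn0.
  by rewrite addnS iterS; apply: leq_trans IH (sum_pull_div _).
have one i : (i <= n)%N -> (\sum_l iter i (pull_div A) (div_unit k) l = 1)%N.
  move=> ilen; apply/eqP; rewrite eqn_leq; apply/andP; split.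
    by have := mono i (n - i)%N; rewrite subnKC // hn sum_div_unit.
  by have := mono 0%N i; rewrite add0n sum_div_unit.
have h i : (i <= n)%N -> forall j, (j < i)%N -> simple_comp (iter j tau k).
  elim: i => [//|i IH] ilt j; rewrite ltnS leq_eqVlt => /orP[/eqP ->|]; last exact/IH/ltnW.
  apply: simple_compP; rewrite -pull_div_unit -iter_simple; last exact/IH/ltnW.
  by rewrite -iterS one.
exists n => //; split; last exact: h.
have := hn; rewrite iter_simple; last exact: h.
by move=> /(congr1 (fun u => u k)); rewrite /div_unit eqxx; have [|] := eqVneq k (iter n tau k).
Qed.

Lemma periodic_simple k : periodic_comp A k -> simple_comp k.
Proof. by move=> /periodicP[n n0 [_ /(_ 0%N n0)]]. Qed.

Lemma periodic_next k : periodic_comp A k -> periodic_comp A (tau k).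
Proof.
move=> /periodicP[n n0 [E h]]; apply/periodicP; exists n => //; split; first by rewrite -iterSr iterS E.
move=> i; rewrite leq_eqVlt => /orP[/eqP Ei|ilt]; rewrite -iterSr; last exact: h.
by rewrite Ei E; exact: (h 0%N).
Qed.

Lemma periodic_next_inj k l : periodic_comp A k -> periodic_comp A l -> tau k = tau l -> k = l.
Proof.
move=> /periodicP[n n0 [En _]] /periodicP[m m0 [Em _]] E.
have it i j (x : 'I_q) : iter i tau x = x -> iter (j * i) tau x = x.
  by move=> Ex; elim: j => [//|j IH]; rewrite mulSn iterD IH.
rewrite -(it _ m _ En) -(it _ n _ Em) [(n * m)%N]mulnC.
have mn : (0 < m * n)%N by rewrite muln_gt0 m0.
by case: (m * n)%N mn => // N _; rewrite !iterSr E.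
Qed.

(** Pigeonhole on the [q + 1] components met at times 0 to [q]. *)
Lemma eventually_periodic k : (forall i, (i <= q)%N -> simple_comp (iter i tau k)) ->
  exists2 i, (i <= q)%N & periodic_comp A (iter i tau k).
Proof.
move=> h.
have [i [j [ij jq E]]] : exists i j, [/\ (i < j)%N, (j <= q)%N & iter i tau k = iter j tau k].
  have /injectivePn[a [b ab E]] : ~~ injectiveb (fun i : 'I_q.+1 => iter i tau k).
    by apply/negP => /injectiveP /leq_card; rewrite !card_ord ltnn.
  have [lt|gt|/val_inj ea] := ltngtP (a : nat) b; last by rewrite ea eqxx in ab.
    by exists a, b; split=> //; rewrite -ltnS.
  by exists b, a; split=> //; rewrite -ltnS.
exists i; first exact: leq_trans (ltnW ij) jq.
apply/periodicP; exists (j - i)%N; first by rewrite subn_gt0.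
split=> [|m]; rewrite -iterD ?subnK //; first exact: ltnW.
rewrite ltn_subRL addnC => mj; apply: h; exact: leq_trans (ltnW mj) jq.
Qed.

End PeriodicComponents.

Lemma enum_family (T : finType) (S : {set T}) n : #|S| = n ->
  exists f : 'I_n -> T, injective f /\ forall k, k \in S <-> exists i, k = f i.
Proof.
move=> <-; exists enum_val; split; first exact: enum_val_inj.
move=> k; split=> [kS|[i ->]]; last exact: enum_valP.
by exists (enum_rank_in kS k); rewrite enum_rankK_in.
Qed.

(** * Linear forms as row vectors *)

Section LinearForms.
Variables (R : realType) (d : nat).
Local Notation C := (CC R).

Definition rform (w x : 'rV[C]_d) : C := (x *m w^T) 0 0.

Lemma rform_hom w : hom 1 (rform w).
Proof.
exists (fun l _ => w 0 l); split=> [l|x]; first by exists (w 0 l).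
by rewrite /rform mxE; apply: eq_bigr => l _; rewrite [w^T _ _]mxE.
Qed.

Lemma rformB v w x : rform (v - w) x = rform v x - rform w x.
Proof. by rewrite /rform linearB /= mulmxBr !mxE. Qed.

Lemma rformZ a w x : rform (a *: w) x = a * rform w x.
Proof. by rewrite /rform linearZ /= -scalemxAr !mxE. Qed.

Lemma rform0 x : rform 0 x = 0.
Proof. by rewrite /rform trmx0 mulmx0 mxE. Qed.

Lemma rform_row k (A : 'M[C]_(k, d)) i x : rform (row i A) x = (x *m A^T) 0 i.
Proof. by rewrite /rform !mxE; apply: eq_bigr => l _; rewrite !mxE. Qed.

Lemma rform_lin (J : 'M[C]_d) w x : rform w (x *m J) = rform (w *m J^T) x.
Proof. by rewrite /rform trmx_mul trmxK mulmxA. Qed.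

Lemma rform_inj v w : ord 2 (fun x => rform v x - rform w x) -> v = w.
Proof.
move=> o; have z := hom_ord_eq0 (homB (rform_hom v) (rform_hom w)) o.
apply/eqP; rewrite -subr_eq0; apply/eqP/rowP => l; rewrite [RHS]mxE.
have := z (delta_mx 0 l); rewrite -rformB => <-.
by rewrite /rform -rowE -tr_col !mxE.
Qed.

Lemma roweig_geigen (J : 'M[C]_d) l w : roweig J^T l w -> geigen (lin J) l (rform w).
Proof.
move=> [n kn]; exists n; move: kn; rewrite /kill; elim: n w => [|n IH] w /=.
  by move=> ->; apply/near0P; exists 1 => // x _; exact: rform0.
move=> /IH; congr (nz (foldl _ _ _)); apply/funext => x.
by rewrite rformB rformZ -rform_lin.
Qed.

Lemma row_foldl (M : 'M[C]_d) n l (w : 'rV[C]_d) :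
  foldl (fun y z => y *m M - z *: y) w (nseq n l) = w *m mpow (M - l%:M) n.
Proof.
elim: n w => [|n IH] w /=; first by rewrite mulmx1.
by rewrite IH mpowC mulmxA mulmxBr mul_mx_scalar.
Qed.

(** [M^n - l^n] is [M - l] times a matrix commuting with it, so powers of the latter annihilate as
    well. *)
Lemma roweig_mpow (M : 'M[C]_d) l w n : roweig M l w -> roweig (mpow M n) (l ^+ n) w.
Proof.
have [Q EQ cQ] : exists2 Q, mpow M n - (l ^+ n)%:M = (M - l%:M) *m Q & Q *m (M - l%:M) = (M - l%:M) *m Q.
  elim: n => [|n [Q EQ cQ]]; first by exists 0; rewrite ?mulmx0 ?mul0mx // expr0 subrr.
  have cM : M *m (M - l%:M) = (M - l%:M) *m M by rewrite mulmxBr mulmxBl mul_mx_scalar mul_scalar_mx.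
  exists (Q *m M + (l ^+ n)%:M).
    rewrite mulmxDr mulmxA -EQ mulmxBl mul_mx_scalar scalerBr mul_scalar_mx exprSr scalar_mxM mul_scalar_mx.
    by rewrite addrA subrK.
  by rewrite mulmxDl mulmxDr -mulmxA cM mulmxA cQ mulmxA mul_mx_scalar mul_scalar_mx.
move=> [k hk]; exists k; move: hk; rewrite /kill !row_foldl EQ.
suff -> : mpow ((M - l%:M) *m Q) k = mpow (M - l%:M) k *m mpow Q k.
  by move=> h; rewrite mulmxA h mul0mx.
move: (M - l%:M) cQ => B cQ; elim: k => [|k IH] /=; first by rewrite mulmx1.
by rewrite IH -!mulmxA; congr (_ *m _); rewrite !mulmxA (mpow_intertwine k (esym cQ)).
Qed.

Lemma ord_prod (I : Type) (s : seq I) (F : I -> 'rV[C]_d -> C) (n : I -> nat) :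
  (forall i, ord 1 (F i)) -> ord (\sum_(i <- s) n i) (fun x => \prod_(i <- s) F i x ^+ n i).
Proof.
move=> hF; have oX i m : ord m (fun x => F i x ^+ m).
  elim: m => [|m IH]; first by apply: ord_holo; exact: holo_cst.
  rewrite (_ : (fun x => _) = (fun x => F i x * F i x ^+ m)); first by have := ordM (hF i) IH.
  by apply/funext => x; rewrite exprS.
elim: s => [|i s IH].
  rewrite big_nil; apply: ord_holo; rewrite (_ : (fun x => _) = (fun=> 1)); first exact: holo_cst.
  by apply/funext => x; rewrite big_nil.
rewrite big_cons (_ : (fun x => _) = (fun x => F i x ^+ n i * \prod_(i <- s) F i x ^+ n i)).
  exact: ordM.
by apply/funext => x; rewrite big_cons.
Qed.

End LinearForms.

(** * The cotangent map on the components of the divisor *)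

Section FirstOrderPullback.
Variables (R : realType) (d q : nat).
Local Notation C := (CC R).
Variables (f : 'rV[C]_d -> 'rV[C]_d) (phi : 'I_q -> 'rV[C]_d -> C) (A : 'I_q -> 'I_q -> nat).
Variable c : 'I_q -> 'rV[C]_d -> C.
Hypotheses (hf : holo_germ f) (f0 : f 0 = 0) (hphi : forall k, holo_germ (phi k) /\ phi k 0 = 0).
Hypothesis hc : forall k, [/\ holo_germ (c k), c k 0 != 0 &
  \forall x \near (0 : 'rV[C]_d), phi k (f x) = c k x * \prod_l phi l x ^+ A k l].
Local Notation G := (grad phi).
Local Notation M := (jac f 0)^T.

(** [phi_k o f] vanishes at 0 and [c k] does not, so the monomial cannot be trivial. *)
Lemma pullback_gt0 k : (0 < \sum_l A k l)%N.
Proof.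
have [_ ck E] := hc k; rewrite lt0n; apply/negP; rewrite sum_nat_eq0 => /forallP h.
move/nbhs_singleton: E; rewrite f0 (hphi k).2 big1 => [|l _].
  by rewrite mulr1 => E; rewrite E eqxx in ck.
by have /implyP/(_ isT)/eqP -> := h l; rewrite expr0.
Qed.

Lemma grad_first_order k : ord 2 (fun x => phi k x - rform (row k G) x).
Proof.
have h := holo_ord2 (hphi k).1; apply: ord_near h; apply: near0S hf => x _.
by rewrite (hphi k).2 subr0 gradE rform_row.
Qed.

Lemma prod_simple k x : simple_comp A k -> \prod_l phi l x ^+ A k l = phi (next_comp A k) x.
Proof.
move=> ->; rewrite (bigD1 (next_comp A k)) //= /div_unit eqxx expr1 big1 ?mulr1 // => l /negPf ->.
by rewrite expr0.
Qed.

Lemma pullback_form k : ord 2 (fun x => phi k (f x) - rform (row k G *m M) x).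
Proof.
have h1 := ord_comp hf f0 (grad_first_order k).
have h2 := ord_sum (index_enum 'I_d) (fun l => ordZ (row k G 0 l) (holo_first_order hf f0 l)).
apply: ord_near (ordD h1 h2); apply: near0S hf => x _.
rewrite -rform_lin (eq_bigr (fun l => row k G 0 l * f x 0 l - row k G 0 l * (x *m jac f 0) 0 l)); last first.
  by move=> l _; rewrite mulrBr.
have E (y : 'rV[C]_d) : \sum_l row k G 0 l * y 0 l = rform (row k G) y.
  by rewrite [RHS]mxE; apply: eq_bigr => l _; rewrite [_^T _ _]mxE mulrC.
by rewrite sumrB !E addrA subrK.
Qed.

Lemma pullback_grad_simple k : simple_comp A k -> row k G *m M = c k 0 *: row (next_comp A k) G.
Proof.
move=> sk; have [hck ck E] := hc k; apply: rform_inj.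
have h1 : ord 2 (fun x => (c k x - c k 0) * phi (next_comp A k) x).
  apply: (@ordM R d 1 1); apply: holo_ord1; rewrite ?subrr //; [| exact: (hphi _).1 | exact: (hphi _).2].
  by apply: holoB => //; exact: holo_cst.
have h2 := ordZ (c k 0) (grad_first_order (next_comp A k)).
apply: ord_near (ordB (ordD h1 h2) (pullback_form k)); apply: near0S E => x Ex.
rewrite Ex prod_simple // rformZ; ring.
Qed.

Lemma pullback_grad0 k : ~ simple_comp A k -> row k G *m M = 0.
Proof.
move=> nk; have [hck ck E] := hc k; apply: rform_inj.
have A2 : (1 < \sum_l A k l)%N.
  have := pullback_gt0 k; rewrite leq_eqVlt => /orP[/eqP s1|//].
  by case: nk; apply: simple_compP.
have o1 l : ord 1 (phi l) by apply: holo_ord1; [exact: (hphi _).1 | exact: (hphi _).2].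
have h1 := ordM (ord_holo hck) (ord_leq A2 (ord_prod (index_enum 'I_q) (A k) o1)).
apply: ord_near (ordB h1 (pullback_form k)); apply: near0S E => x Ex.
rewrite Ex rform0; ring.
Qed.

(** Each step multiplies the differential by a constant and moves it to the next component, or kills
    it when the pullback has total multiplicity at least 2. If it survives [q.+1] steps, a periodic
    component has been reached, and its successors are periodic. *)
Lemma transient_grad k : exists (a : C) l,
  row k G *m mpow M q.+1 = a *: row l G /\ (a = 0 \/ periodic_comp A l).
Proof.
pose tau := next_comp A.
have H n : exists a : C, row k G *m mpow M n = a *: row (iter n tau k) G /\
    (a = 0 \/ forall i, (i < n)%N -> simple_comp A (iter i tau k)).
  elim: n => [|n [a [E h]]]; first by exists 1; rewrite mulmx1 scale1r; split=> //; right.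
  rewrite /= mulmxA E -scalemxAl.
  have [sk|nk] := pselect (simple_comp A (iter n tau k)); last first.
    by exists 0; rewrite (pullback_grad0 nk) scaler0 scale0r; split=> //; left.
  rewrite (pullback_grad_simple sk) scalerA; exists (a * c (iter n tau k) 0); split=> //.
  case: h => [->|h]; first by left; rewrite mul0r.
  by right => i; rewrite ltnS leq_eqVlt => /orP[/eqP ->|/h].
have [a [E h]] := H q.+1; exists a, (iter q.+1 tau k); split=> //.
case: h => [->|h]; [by left | right].
have pq : exists2 i, (i <= q)%N & periodic_comp A (iter i tau k).
  exact: (eventually_periodic pullback_gt0 (fun i ilt => h i ilt)).
have [i iq pi] := pq.
have -> : iter q.+1 tau k = iter (q.+1 - i) tau (iter i tau k) by rewrite -iterD subnK // ltnW.
by elim: (q.+1 - i)%N => [//|m IH] /=; exact: (periodic_next pullback_gt0).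
Qed.

End FirstOrderPullback.

(** * Normalizing coordinates *)

Section PeriodicCoordinates.
Variable R : realType.
Local Notation C := (CC R).

Lemma nm_lt1 (z : C) : `|z| < 1 -> nm z < 1.
Proof. by rewrite /nm ltcE /= => /andP[]. Qed.

Lemma contracting_contracts d (f : 'rV[C]_d -> 'rV[C]_d) : contracting f -> exists c th r, contracts f c th r.
Proof.
move=> [f0 [hf hroot]].
apply: (contraction_of_decay hf f0 (holo_first_order hf f0)) => x.
have [ls hls h] := cayley_roots (jac f 0).
by apply: (mpow_decay (ls := ls)) => // l /hls /hroot /nm_lt1.
Qed.

Lemma contracts_iter d (F : 'rV[C]_d -> 'rV[C]_d) c th r n : (0 < n)%N ->
  contracts F c th r -> contracts (iter n F) c th r.
Proof.
move=> n0 [c1 /andP[th0 th1] r0 hF]; split=> //; first exact/andP.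
move=> x xr i; have E : iter i (iter n F) x = iter (i * n) F x.
  by elim: i => [//|i IH]; rewrite mulSn iterD iterS IH.
rewrite E; apply: le_trans (hF x xr _) _; apply: ler_wpM2r; first exact: nm_ge0.
apply: ler_wpM2l; first exact: le_trans ler01 c1.
by apply: ler_wiXn2l; [exact: ltW | exact: ltW | exact: leq_pmulr].
Qed.

(** Write the unknown as 1 plus a germ of order 1, whose inhomogeneous term is [w k - 1]. *)
Lemma unit_equation d (F : 'rV[C]_d -> 'rV[C]_d) c th r (K : finType) (s : K -> K) (w : K -> 'rV[C]_d -> C) :
  holo_germ F -> F 0 = 0 -> contracts F c th r -> (forall k, holo_germ (w k) /\ w k 0 = 1) ->
  exists a : K -> 'rV[C]_d -> C, (forall k, holo_germ (a k) /\ a k 0 = 1) /\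
    \forall x \near (0 : 'rV[C]_d), forall k, a k x = w k x * a (s k) (F x).
Proof.
move=> hF F0 Fc hw; have [_ /andP[th0 th1] _ _] := Fc.
have hb k : holo_germ (fun x => w k x - 1) by apply: holoB; [exact: (hw k).1 | exact: holo_cst].
have b0 k : w k 0 - 1 = 0 by rewrite (hw k).2 subrr.
have ob k : ord 1 (fun x => w k x - 1) by exact: holo_ord1.
have th2 : 0 < 1 + th by lra.
(* Any constant strictly between 1 and [1 / th] would do: the [w k] are close to 1 near 0, and
   [kap * th] must be below 1. *)
pose kap := 2 / (1 + th).
have kap1 : 1 < kap by rewrite /kap ltr_pdivlMr //; lra.
have wk k : \forall x \near (0 : 'rV[C]_d), nm (w k x) <= kap.
  have [e e0 /near0P[r1 r10 he]] := ob k.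
  apply/near0P; exists (Num.min r1 ((kap - 1) / (e + 1))).
    by rewrite lt_min r10 /= divr_gt0 // ?subr_gt0 //; lra.
  move=> x; rewrite lt_min => /andP[x1]; rewrite ltr_pdivlMr; last by lra.
  move=> x2; have h1 := he x x1; rewrite expr1 in h1.
  have h2 := nmD (w k x - 1) 1; rewrite subrK nm1 in h2.
  have h3 := nm_ge0 x; move: (nm x) (nm (w k x)) (nm (w k x - 1)) x2 h1 h2 h3 => X Y Z; nra.
have kap0 : 0 <= kap by lra.
have kth : kap * th ^+ 1 < 1 by rewrite expr1 /kap mulrAC ltr_pdivrMr //; lra.
have [a [ha oa Ea]] := @functional_equation R d F c th r K s w (fun k x => w k x - 1) 1 kap hF F0 Fc
   (fun k => (hw k).1) hb ob kap0 kth wk.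
exists (fun k x => 1 + a k x); split.
  move=> k; split; first by apply: holoD; [exact: holo_cst | exact: ha].
  by rewrite (ord_gt0 _ (oa k)) ?addr0.
by apply: near0S Ea => x Ex k; rewrite Ex; ring.
Qed.

Lemma first_order_uniq n m (F : 'rV[C]_n -> 'rV[C]_m) J K : (\forall x \near (0 : 'rV[C]_n), True) ->
  first_order F J -> first_order F K -> J = K.
Proof.
move=> nr hJ hK; apply/trmx_inj/row_matrixP => j; apply: rform_inj.
apply: ord_near (ordB (hK j) (hJ j)); apply: near0S nr => x _.
by rewrite !rform_row !trmxK; ring.
Qed.

Lemma perm_normal_form r (alpha w : 'rV[C]_r) (sigma : 'S_r) k :
  hmul alpha (mono_map (perm_natmx sigma) w) 0 k = alpha 0 k * w 0 (sigma k).
Proof.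
rewrite !mxE; congr (_ * _); rewrite (bigD1 (sigma k)) //= big1 => [|l lk].
  by rewrite mxE eqxx expr1 mulr1.
by rewrite mxE eq_sym (negPf lk) expr0.
Qed.

(** Iterates stay monomial, and their coefficients are read at the point [(1, ..., 1)]. At the order
    of [sigma] the permutation disappears, so the value there is [xi]. *)
Lemma iter_normal_form r (alpha w : 'rV[C]_r) (sigma : 'S_r) n k :
  let Nf := fun u => hmul alpha (mono_map (perm_natmx sigma) u) in
  iter n Nf w 0 k = iter n Nf (const_mx 1) 0 k * w 0 ((sigma ^+ n)%g k).
Proof.
move=> Nf; elim: n k => [|n IH] k; first by rewrite /= mxE mul1r perm1.
by rewrite !iterS !perm_normal_form IH mulrA expgS permM.
Qed.

Lemma iter_conj d (S : Type) (f : 'rV[C]_d -> 'rV[C]_d) (u : 'rV[C]_d -> S) (Nf : S -> S) n :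
  holo_germ f -> f 0 = 0 -> (\forall x \near (0 : 'rV[C]_d), u (f x) = Nf (u x)) ->
  \forall x \near (0 : 'rV[C]_d), u (iter n f x) = iter n Nf (u x).
Proof.
move=> hf f0 h; elim: n => [|n IH]; first by apply: near0S h.
have h' := near_holo (holo_iter n hf f0) (iter_fixed n f0) h.
by apply: near0S (near0I h' IH) => x [E1 E2] /=; rewrite E1 E2.
Qed.

Lemma prod_count (I : finType) (X : I -> C) (s : seq I) :
  \prod_(i <- s) X i = \prod_i X i ^+ count_mem i s.
Proof.
elim: s => [|i s IH]; first by rewrite big_nil big1 // => i _; rewrite expr0.
rewrite big_cons IH; under [RHS]eq_bigr => j _ do rewrite /= exprD.
rewrite big_split /=; congr (_ * _); rewrite (bigD1 i) //= eqxx expr1 big1 ?mulr1 // => j ji.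
by rewrite eq_sym (negPf ji) expr0.
Qed.

Lemma prod_sum3 (r e m : nat) (G : 'I_r + 'I_e + 'I_m -> C) :
  \prod_i G i = (\prod_i G (inl (inl i))) * (\prod_k G (inl (inr k))) * \prod_j G (inr j).
Proof. by rewrite !big_sumType. Qed.

Lemma sum_sum3 (r e m : nat) (G : 'I_r + 'I_e + 'I_m -> C) :
  \sum_i G i = (\sum_i G (inl (inl i))) + (\sum_k G (inl (inr k))) + \sum_j G (inr j).
Proof. by rewrite !big_sumType. Qed.

End PeriodicCoordinates.

(** * Construction of the coordinates [v] and of [rho] *)

Section ResonantBlock.
Variables (R : realType) (d r e m : nat).
Local Notation C := (CC R).
Variables (f : 'rV[C]_d -> 'rV[C]_d) (c th rad : R).
Hypotheses (hf : holo_germ f) (f0 : f 0 = 0) (fc : contracts f c th rad).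
Local Notation J := (jac f 0).
Variables (U : 'M[C]_(r, d)) (N : 'M[C]_(e, d)) (Q : 'M[C]_(m, d)) (mu : 'I_e -> C).
Hypothesis full : row_full (col_mx (col_mx U N) Q).
Hypothesis gN : forall k, mu k != 0 /\ roweig J^T (mu k) (row k N).
Hypothesis gQ : forall j, roweig J^T 0 (row j Q).
Variables (u : 'I_r -> 'rV[C]_d -> C) (alpha : 'rV[C]_r) (sigma : 'S_r).
Hypothesis hu : forall i, holo_germ (u i) /\ ord 2 (fun x => u i x - rform (row i U) x).
Hypothesis uf : \forall x \near (0 : 'rV[C]_d), forall i, u i (f x) = alpha 0 i * u (sigma i) x.

Local Notation eta := #[sigma]%g.
Local Notation Nf := (fun w => hmul alpha (mono_map (perm_natmx sigma) w)).
Local Notation xi := (iter eta Nf (const_mx 1)).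
Local Notation F := (iter eta f).
Local Notation K := (mpow J eta).

Let hF : holo_germ F := holo_iter eta hf f0.
Let F0 : F 0 = 0 := iter_fixed eta f0.
Let FK : first_order F K := first_order_iter eta hf f0 (holo_first_order hf f0).
Let Fc : contracts F c th rad := contracts_iter (order_gt0 sigma) fc.

Lemma u_eigen i : \forall x \near (0 : 'rV[C]_d), u i (F x) = xi 0 i * u i x.
Proof.
have h : \forall x \near (0 : 'rV[C]_d), (\row_i u i (f x) : 'rV[C]_r) = Nf (\row_i u i x).
  by apply: near0S uf => x E; apply/rowP => k; rewrite perm_normal_form !mxE E.
have := @iter_conj R d 'rV[C]_r f (fun x => \row_i u i x) Nf eta hf f0 h.
apply: near0S => x /(congr1 (fun w : 'rV[C]_r => w 0 i)); rewrite mxE => ->.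
by rewrite iter_normal_form expg_order perm1 mxE.
Qed.

Lemma u_geigen i : geigen F (xi 0 i) (u i).
Proof.
exists 1%N; apply: near0S (u_eigen i) => x E.
by rewrite /= -[LHS]/(u i (F x) - xi 0 i * u i x) E subrr.
Qed.

Lemma u_form_geigen i : geigen (lin K) (xi 0 i) (rform (row i U)).
Proof.
have [n kn] := u_geigen i; exists n.
exact: (leading_kill hF F0 FK (rform_hom _) (hu i).2 (nz_ord 2 kn)).
Qed.

Lemma N_form_geigen k : geigen (lin K) (mu k ^+ eta) (rform (row k N)).
Proof. by apply: roweig_geigen; rewrite mpow_tr; apply: roweig_mpow; exact: (gN k).2. Qed.

Lemma geigen_pull l v : geigen F l v -> geigen F l (pull f v).
Proof.
move=> [n kn]; exists n; move: kn; rewrite /kill; elim: n v => [|n IH] v /=; first exact: nz_pull.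
move=> /IH; congr (nz (foldl _ _ _)); apply/funext => x.
by rewrite -[LHS]/(v (F (f x)) - l * v (f x)) -iterSr iterS.
Qed.

Lemma prod_count3 (X : 'I_r + 'I_e + 'I_m -> C) s : (forall j, inr j \notin s) ->
  \prod_(i <- s) X i = (\prod_i X (inl (inl i)) ^+ count_mem (inl (inl i)) s) *
    \prod_k X (inl (inr k)) ^+ count_mem (inl (inr k)) s.
Proof.
move=> ns; apply: (etrans (prod_count X s)); rewrite prod_sum3.
by rewrite [X in _ * X]big1 ?mulr1 // => j _; rewrite (count_memPn (ns j)) expr0.
Qed.

(** Eigengerms and expansions are taken for [F], on which [u] is diagonal, and not for [f], which
    permutes the [u i]. Both summands of [v o f - mu v] lie in the generalized eigenspace of
    [mu ^ eta] for [F], so the difference has a resonant expansion. *)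
Lemma resonant_block : exists (v : 'I_e -> 'rV[C]_d -> C) (rho : 'I_e -> seq (poly_term R r e)),
  [/\ forall k, holo_germ (v k) /\ ord 2 (fun x => v k x - rform (row k N) x),
      \forall x \near (0 : 'rV[C]_d), forall k, v k (f x) = mu k * v k x +
        poly_eval rho (\row_i u i x) (\row_k v k x) 0 k &
      forall k tm, tm \in rho k -> monom xi tm.1.1 * monom_pow (\row_k mu k) eta tm.1.2 = mu k ^+ eta].
Proof.
have mu0 k : mu k ^+ eta != 0 by rewrite expf_neq0 //; exact: (gN k).1.
have /boolp.choice[v hv] : forall k, exists v, [/\ holo_germ v, geigen F (mu k ^+ eta) v &
    ord 2 (fun x => v x - rform (row k N) x)].
  by move=> k; exact: (eigen_germ hF F0 FK Fc (mu0 k) (rform_hom _) (N_form_geigen k)).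
pose I := ('I_r + 'I_e + 'I_m)%type.
(* The third family completes the [du] and [dv] to a basis of linear forms. Its weight is 0, so it
   cannot occur in a word of weight [mu k ^+ eta], and plain linear forms are enough for it. *)
pose X (i : I) := match i with inl (inl i) => u i | inl (inr k) => v k | inr j => rform (row j Q) end.
pose ell (i : I) := rform match i with inl (inl i) => row i U | inl (inr k) => row k N | inr j => row j Q end.
pose chi (i : I) := match i with inl (inl i) => xi 0 i | inl (inr k) => mu k ^+ eta | inr j => 0 end.
have /submxP[D ED] : (1%:M <= col_mx (col_mx U N) Q)%MS by rewrite sub1mx.
pose eps (i : I) l := match i with inl (inl i) => D l (lshift m (lshift e i))
  | inl (inr k) => D l (lshift m (rshift r k)) | inr j => D l (rshift (r + e) j) end.
have hX i : holo_germ (X i).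
  by case: i => [[i|k]|j]; [exact: (hu i).1 | have [] := hv k | exact: hom_holo (rform_hom _)].
have Xell i : ord 2 (fun x => X i x - ell i x).
  case: i => [[i|k]|j]; [exact: (hu i).2 | by have [] := hv k | ].
  by exists 0 => //; apply: near0S hf => x _; rewrite subrr nm0 mul0r.
have gell i : geigen (lin K) (chi i) (ell i).
  case: i => [[i|k]|j]; [exact: u_form_geigen | exact: N_form_geigen | ].
  have -> : chi (inr j) = 0 ^+ eta by rewrite expr0n; case: (eta) (order_gt0 sigma).
  by apply: roweig_geigen; rewrite mpow_tr; apply: roweig_mpow.
have gX i : chi i != 0 -> geigen F (chi i) (X i).
  by case: i => [[i|k]|j] /=; [move=> _; exact: u_geigen | have [] := hv k | rewrite eqxx].
have basis (x : 'rV[C]_d) l : x 0 l = \sum_i eps i l * ell i x.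
  rewrite sum_sum3 -[x in LHS]mulmx1 -[1%:M]trmx1 ED trmx_mul mulmxA mxE !big_split_ord /=.
  rewrite !tr_col_mx !mul_mx_row /ell.
  by congr (_ + _ + _); apply: eq_bigr => i _; rewrite /= rform_row ?(row_mxEl, row_mxEr) [D^T _ _]mxE mulrC.
have res k : exists2 L : seq (C * seq I), (forall t, t \in L -> \prod_(i <- t.2) chi i = mu k ^+ eta) &
    \forall x \near (0 : 'rV[C]_d), v k (f x) - mu k * v k x = words X L x.
  have [hvk gvk _] := hv k.
  apply: (resonant_expansion hF F0 FK Fc hX (fun i => rform_hom _) Xell gell gX basis (mu0 k)).
    by apply: holoB; [exact: (holo_comp hvk hf f0) | apply: holoM => //; exact: holo_cst].
  rewrite (_ : (fun x => _) = (- mu k) *: v k + pull f (v k)); last first.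
    apply/funext => x; rewrite -[RHS]/(- mu k * v k x + v k (f x)); ring.
  apply: geigen_lin => //; exact: geigen_pull.
have /boolp.choice[L hL] : forall k, exists L : seq (C * seq I),
    (forall t, t \in L -> \prod_(i <- t.2) chi i = mu k ^+ eta) /\
    \forall x \near (0 : 'rV[C]_d), v k (f x) - mu k * v k x = words X L x.
  by move=> k; have [L h1 h2] := res k; exists L.
have nr k t : t \in L k -> forall j, inr j \notin t.2.
  move=> tL j; apply/negP => jt; have := mu0 k; rewrite -((hL k).1 t tL) => h.
  by have := prod_neq0 h jt; rewrite eqxx.
(* Words become pairs of exponent vectors by counting letters; letters of the third family are
   excluded by [nr]. *)
exists v, (fun k => [seq ((fun i => count_mem (inl (inl i)) t.2, fun j => count_mem (inl (inr j)) t.2), t.1) | t <- L k]).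
split.
- by move=> k; have [] := hv k.
- have h : \forall x \near (0 : 'rV[C]_d), forall k, v k (f x) - mu k * v k x = words X (L k) x.
    by apply: near_forall => k; exact: (hL k).2.
  apply: near0S h => x h k; have E := h k; rewrite mxE big_map -[LHS](subrK (mu k * v k x)) E addrC; congr (_ + _).
  rewrite /words big_seq [RHS]big_seq; apply: eq_bigr => t tL /=.
  rewrite (prod_count3 _ (nr k t tL)) mulrA /monom /=.
  by congr (_ * _ * _); apply: eq_bigr => i _; rewrite mxE.
- move=> k tm /mapP[t tL ->] /=; rewrite -((hL k).1 t tL) (prod_count3 _ (nr k t tL)); congr (_ * _).
  by apply: eq_bigr => j _; rewrite mxE exprM.
Qed.

End ResonantBlock.

(** * Periodic and non-periodic components *)

Section Assembly.
Variables (R : realType) (d q : nat).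
Local Notation C := (CC R).
Variables (f : 'rV[C]_d -> 'rV[C]_d) (phi : 'I_q -> 'rV[C]_d -> C) (A : 'I_q -> 'I_q -> nat).
Variable c : 'I_q -> 'rV[C]_d -> C.
Hypotheses (hf : holo_germ f) (f0 : f 0 = 0) (hphi : forall k, holo_germ (phi k) /\ phi k 0 = 0).
Hypothesis hc : forall k, [/\ holo_germ (c k), c k 0 != 0 &
  \forall x \near (0 : 'rV[C]_d), phi k (f x) = c k x * \prod_l phi l x ^+ A k l].
Local Notation G := (grad phi).
Local Notation M := (jac f 0)^T.

Variables (r p : nat) (iu : 'I_r -> 'I_q) (jy : 'I_p -> 'I_q).
Hypotheses (iu_inj : injective iu) (jy_inj : injective jy).
Hypothesis iuP : forall k, periodic_comp A k <-> exists i, k = iu i.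
Hypothesis jyP : forall k, ~ periodic_comp A k <-> exists j, k = jy j.
Hypothesis fG : row_free G.

Let A0 := pullback_gt0 f0 hphi hc.
Local Notation U := (rowsub iu G).
Local Notation Q := (rowsub jy G).

Lemma comp_cases (P : 'I_q -> Prop) : (forall i, P (iu i)) -> (forall j, P (jy j)) -> forall k, P k.
Proof.
move=> h1 h2 k; have [/iuP[i ->]|/jyP[j ->]] := pselect (periodic_comp A k); [exact: h1 | exact: h2].
Qed.

Lemma iu_neq_jy i j : iu i != jy j.
Proof.
apply/eqP => E; have : ~ periodic_comp A (iu i) by rewrite E; apply/jyP; exists j.
by apply; apply/iuP; exists i.
Qed.

Lemma prod_comps (g : 'I_q -> C) : \prod_k g k = (\prod_i g (iu i)) * \prod_j g (jy j).
Proof.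
rewrite (bigID (mem [set iu i | i in 'I_r])) /=; congr (_ * _).
  by rewrite big_imset => [|? ? _ _ /iu_inj] //; apply: eq_bigl.
rewrite (eq_bigl (mem [set jy j | j in 'I_p])); first by rewrite big_imset => [|? ? _ _ /jy_inj] //; apply: eq_bigl.
apply: comp_cases => [i|j] /=.
  rewrite imset_f //; apply/esym/imsetP => -[j _ E]; by have := iu_neq_jy i j; rewrite E eqxx.
rewrite [RHS]imset_f //; apply/imsetP => -[i _ E]; by have := iu_neq_jy i j; rewrite E eqxx.
Qed.

Lemma rowsub_free k (g : 'I_k -> 'I_q) (B : 'M[C]_(q, d)) : row_free B -> injective g -> row_free (rowsub g B).
Proof.
move=> fB gi; have -> : rowsub g B = (\matrix_(i, l) (g i == l)%:R) *m B.
  apply/matrixP => i j; rewrite !mxE (bigD1 (g i)) //= big1 ?addr0 => [|l /negPf gl].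
    by rewrite mxE eqxx mul1r.
  by rewrite mxE eq_sym gl mul0r.
rewrite /row_free mxrankMfree // -/(row_free _); apply/row_freeP; exists (\matrix_(l, i) (g i == l)%:R).
apply/matrixP => i j; rewrite !mxE (bigD1 (g i)) //= big1 ?addr0 => [|l /negPf gl].
  by rewrite !mxE eqxx mul1r eq_sym (inj_eq gi).
by rewrite mxE eq_sym gl mul0r.
Qed.

Lemma components_free : row_free (col_mx U Q).
Proof.
pose g (i : 'I_(r + p)) := match fintype.split i with inl i => iu i | inr j => jy j end.
have -> : col_mx U Q = rowsub g G.
  move: G => B; by apply/matrixP => i j; rewrite !mxE /g; case: (fintype.split i) => k; rewrite mxE.
apply: (rowsub_free fG) => i j; rewrite /g -{2}(splitK i) -{2}(splitK j).
case: (fintype.split i) => a; case: (fintype.split j) => b.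
- by move=> /iu_inj ->.
- by move=> /eqP; rewrite (negPf (iu_neq_jy a b)).
- by move=> /esym/eqP; rewrite (negPf (iu_neq_jy b a)).
- by move=> /jy_inj ->.
Qed.

Lemma row_periodic l : periodic_comp A l -> (row l G <= U)%MS.
Proof. by move=> /iuP[i ->]; rewrite -row_rowsub; exact: row_sub. Qed.

Lemma transient_sub : (Q *m mpow M q.+1 <= U)%MS.
Proof.
apply/row_subP => j; rewrite row_mul row_rowsub.
have [a [l [-> [->|hl]]]] := transient_grad hf f0 hphi hc (jy j); first by rewrite scale0r sub0mx.
by apply: scalemx_sub; exact: row_periodic.
Qed.

Lemma components_stable : (col_mx U Q *m M <= col_mx U Q)%MS.
Proof.
have h k : (row k G *m M <= col_mx U Q)%MS.
  have [sk|nk] := pselect (simple_comp A k); last by rewrite (pullback_grad0 hf f0 hphi hc nk) sub0mx.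
  rewrite (pullback_grad_simple hf f0 hphi hc sk); apply: scalemx_sub.
  move: (next_comp A k) => l; move: l; apply: comp_cases => i; rewrite -row_rowsub -addsmxE.
    exact: submx_trans (row_sub _ _) (addsmxSl _ _).
  exact: submx_trans (row_sub _ _) (addsmxSr _ _).
apply/row_subP => i; rewrite row_mul; move: i => i; rewrite -(splitK i).
case: (fintype.split i) => k /=; first by rewrite rowKu row_rowsub.
by rewrite rowKd row_rowsub.
Qed.

Lemma next_perm : exists sigma : 'S_r, forall i, next_comp A (iu i) = iu (sigma i).
Proof.
have /boolp.choice[s hs] : forall i, exists j, next_comp A (iu i) = iu j.
  by move=> i; apply/iuP; apply: (periodic_next A0); apply/iuP; exists i.
have s_inj : injective s.
  move=> i j E; apply: iu_inj; apply: (periodic_next_inj A0); [by apply/iuP; exists i | by apply/iuP; exists j | ].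
  by rewrite !hs E.
by exists (perm s_inj) => i; rewrite permE.
Qed.

(** On the periodic differentials the cotangent map is the diagonal of the [c_k(0)] times a
    permutation, hence invertible; this is why [r] of the non-zero eigenvalues belong to [u]. *)
Lemma periodic_intertwine (sigma : 'S_r) : (forall i, next_comp A (iu i) = iu (sigma i)) ->
  exists2 X, U *m M = X *m U & X \in unitmx.
Proof.
move=> hs; exists (diag_mx (\row_i c (iu i) 0) *m perm_mx sigma).
  apply/row_matrixP => i; rewrite row_mul row_rowsub (pullback_grad_simple hf f0 hphi hc); last first.
    by apply: (periodic_simple A0); apply/iuP; exists i.
  rewrite hs -mulmxA -row_permE mul_diag_mx; move: G => B; apply/rowP => j.
  by rewrite !mxE.
rewrite unitmx_mul unitmx_perm andbT unitmxE det_diag unitfE.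
by apply/prodf_neq0 => i _; rewrite mxE; have [] := hc (iu i).
Qed.

Lemma periodic_coordinates (sigma : 'S_r) cc th rad : contracts f cc th rad ->
  (forall i, next_comp A (iu i) = iu (sigma i)) ->
  exists a : 'I_r -> 'rV[C]_d -> C, (forall i, holo_germ (a i) /\ a i 0 = 1) /\
   \forall x \near (0 : 'rV[C]_d), forall i,
     phi (iu i) (f x) * a i (f x) = c (iu i) 0 * (phi (iu (sigma i)) x * a (sigma i) x).
Proof.
(* The functional equation expresses an unknown through the image of another one under [f], so [a_k]
   refers back to its predecessor under [sigma]. *)
move=> fc hs; pose s k := (sigma^-1)%g k.
have hw k : holo_germ (fun x => c (iu (s k)) x * (c (iu (s k)) 0)^-1) /\
    c (iu (s k)) 0 * (c (iu (s k)) 0)^-1 = 1.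
  have [h1 h2 _] := hc (iu (s k)); split; last by rewrite mulfV.
  by apply: holoM => //; exact: holo_cst.
have [a [ha Ea]] := unit_equation s hf f0 fc hw; exists a; split=> //.
have E : \forall x \near (0 : 'rV[C]_d), forall k, phi k (f x) = c k x * \prod_l phi l x ^+ A k l.
  by apply: near_forall => k; have [] := hc k.
apply: near0S (near0I E Ea) => x [E1 E2] i.
rewrite E1 prod_simple; last by apply: (periodic_simple A0); apply/iuP; exists i.
rewrite hs (E2 (sigma i)) /s permK; have [_ ci _] := hc (iu i); by field.
Qed.

Lemma first_order_product (g a : 'rV[C]_d -> C) (w : 'rV[C]_d) : holo_germ g -> g 0 = 0 -> holo_germ a -> a 0 = 1 ->
  ord 2 (fun x => g x - rform w x) -> ord 2 (fun x => g x * a x - rform w x).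
Proof.
move=> hg g0 ha a0 og.
have h1 : ord 2 (fun x => g x * (a x - 1)).
  apply: (@ordM R d 1 1); apply: holo_ord1; rewrite ?a0 ?subrr //.
  by apply: holoB => //; exact: holo_cst.
apply: ord_near (ordD h1 og); apply: near0S hf => x _; ring.
Qed.

End Assembly.

(** * Charts and their inverses at first order *)

Section Conjugacy.
Variable R : realType.
Local Notation C := (CC R).

Lemma first_order_lin n k (B : 'M[C]_(n, k)) : first_order (fun x : 'rV[C]_n => x *m B) B.
Proof. by move=> j; exists 0 => //; apply/near0P; exists 1 => // x _; rewrite subrr nm0 mul0r. Qed.

Lemma near0T n : \forall x \near (0 : 'rV[C]_n), True.
Proof. by apply/near0P; exists 1. Qed.

Lemma first_order_near n k (F H : 'rV[C]_n -> 'rV[C]_k) B : (\forall x \near (0 : 'rV[C]_n), F x = H x) ->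
  first_order F B -> first_order H B.
Proof. by move=> E hF j; apply: ord_near (hF j); apply: near0S E => x ->. Qed.

Lemma chart n k (Phi : 'rV[C]_n -> 'rV[C]_k) (B : 'M[C]_(k, n)) : holo_germ Phi -> Phi 0 = 0 ->
  first_order Phi B^T -> row_free B -> row_full B -> biholo_germ Phi.
Proof.
move=> hP P0 fP fB FB.
apply: (inverse_function (A := B^T) (B := (pinvmx B)^T) hP P0 (first_order_diff hP P0 fP)).
  by rewrite -trmx_mul mulVpmx // trmx1.
by rewrite -trmx_mul mulmxVp // trmx1.
Qed.

Lemma chart_inverse n k (Phi : 'rV[C]_n -> 'rV[C]_k) (Psi : 'rV[C]_k -> 'rV[C]_n) (B : 'M[C]_(k, n)) :
  holo_germ Phi -> Phi 0 = 0 -> first_order Phi B^T -> holo_germ Psi -> Psi 0 = 0 ->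
  (\forall x \near (0 : 'rV[C]_n), Psi (Phi x) = x) -> (\forall y \near (0 : 'rV[C]_k), Phi (Psi y) = y) ->
  exists G' : 'M[C]_(n, k), [/\ first_order Psi G'^T, B *m G' = 1%:M & G' *m B = 1%:M].
Proof.
move=> hP P0 fP hS S0 E1 E2; have fS := holo_first_order hS S0; exists (jac Psi 0)^T.
split; first by rewrite trmxK.
- apply: trmx_inj; rewrite trmx_mul trmxK trmx1; exact: (first_order_uniq (near0T k)
    (first_order_near E2 (first_order_comp hS S0 fS fP)) (@first_order_id R k)).
- apply: trmx_inj; rewrite trmx_mul trmxK trmx1; exact: (first_order_uniq (near0T n)
    (first_order_near E1 (first_order_comp hP P0 fP fS)) (@first_order_id R n)).
Qed.

Lemma holo_row_mx n k1 k2 (F1 : 'rV[C]_n -> 'rV[C]_k1) (F2 : 'rV[C]_n -> 'rV[C]_k2) :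
  holo_germ F1 -> holo_germ F2 -> holo_germ (fun x => row_mx (F1 x) (F2 x)).
Proof.
move=> h1 h2; apply: holo_row => i; rewrite -(splitK i); case: (fintype.split i) => j /=.
  rewrite (_ : (fun x => _) = (fun x => F1 x 0 j)); first exact: holo_entry j h1.
  by apply/funext => x; rewrite row_mxEl.
rewrite (_ : (fun x => _) = (fun x => F2 x 0 j)); first exact: holo_entry j h2.
by apply/funext => x; rewrite row_mxEr.
Qed.

Lemma first_order_row_mx n k1 k2 (F1 : 'rV[C]_n -> 'rV[C]_k1) (F2 : 'rV[C]_n -> 'rV[C]_k2) B1 B2 :
  first_order F1 B1^T -> first_order F2 B2^T -> first_order (fun x => row_mx (F1 x) (F2 x)) (col_mx B1 B2)^T.
Proof.
move=> h1 h2 i; rewrite -(splitK i); case: (fintype.split i) => j /=.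
  apply: ord_near (h1 j); apply: near0S (near0T n) => x _.
  by rewrite tr_col_mx mul_mx_row !row_mxEl.
apply: ord_near (h2 j); apply: near0S (near0T n) => x _.
by rewrite tr_col_mx mul_mx_row !row_mxEr.
Qed.

Lemma first_order_forms n k (u : 'I_k -> 'rV[C]_n -> C) (B : 'M[C]_(k, n)) :
  (forall i, holo_germ (u i) /\ ord 2 (fun x => u i x - rform (row i B) x)) ->
  [/\ holo_germ (fun x => \row_i u i x : 'rV[C]_k), (\row_i u i 0 : 'rV[C]_k) = 0 &
      first_order (fun x => \row_i u i x : 'rV[C]_k) B^T].
Proof.
move=> h; split.
- apply: holo_row => i; rewrite (_ : (fun x => _) = u i); first exact: (h i).1.
  by apply/funext => x; rewrite mxE.
- apply/rowP => i; rewrite !mxE; have := ord_gt0 (isT : (0 < 2)%N) (h i).2.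
  by rewrite /rform mul0mx mxE subr0.
- move=> i; apply: ord_near (h i).2; apply: near0S (near0T n) => x _.
  by rewrite rform_row mxE.
Qed.

Lemma nilpotent_transversal n k t (Psi : 'rV[C]_(k + t) -> 'rV[C]_n) (f : 'rV[C]_n -> 'rV[C]_n)
    (Z : 'M[C]_(t, n)) (G' : 'M[C]_(n, k + t)) j :
  holo_germ Psi -> Psi 0 = 0 -> first_order Psi G'^T -> holo_germ f -> f 0 = 0 ->
  mpow (dsubmx G'^T *m jac f 0 *m Z^T) j = 0 ->
  jac (fun z : 'rV[C]_t => f (Psi (row_mx 0 z)) *m Z^T) 0 ^+ j = 0.
Proof.
move=> hS S0 fS hf f0 nil.
pose i0 (z : 'rV[C]_t) : 'rV[C]_(k + t) := z *m row_mx 0 1%:M.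
have Ei z : row_mx 0 z = i0 z by rewrite /i0 mul_mx_row mulmx0 mulmx1.
have hi : holo_germ i0 := @holo_linear R t _ (mulmxr (row_mx 0 1%:M)).
have i00 : i0 0 = 0 by exact: mul0mx.
have h1 := first_order_comp hi i00 (first_order_lin _) fS.
have h1h := holo_comp hS hi i00.
have h10 : Psi (i0 0) = 0 by rewrite i00.
have h2 := first_order_comp h1h h10 h1 (holo_first_order hf f0).
have h2h := holo_comp hf h1h h10.
have h20 : f (Psi (i0 0)) = 0 by rewrite h10.
have h3 := first_order_comp h2h h20 h2 (first_order_lin Z^T).
have h3h : holo_germ (fun z => f (Psi (i0 z)) *m Z^T).
  exact: (holo_comp (@holo_linear R n _ (mulmxr Z^T)) h2h h20).
have h30 : f (Psi (i0 0)) *m Z^T = 0 by rewrite h20 mul0mx.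
rewrite (_ : (fun z => _) = (fun z => f (Psi (i0 z)) *m Z^T)); last by apply/funext => z; rewrite Ei.
rewrite (first_order_uniq (near0T t) (holo_first_order h3h h30) h3) mpow_exp.
have -> : row_mx 0 1%:M *m G'^T = dsubmx G'^T.
  by rewrite -{1}[G'^T]vsubmxK mul_row_col mul0mx add0r mul1mx.
exact: nil.
Qed.

Lemma char_poly_tr n (B : 'M[C]_n) : char_poly B^T = char_poly B.
Proof.
rewrite /char_poly -det_tr; congr (\det _); rewrite /char_poly_mx linearB /= tr_scalar_mx.
by rewrite map_trmx trmxK.
Qed.

End Conjugacy.

(** * The normal form *)

Section NormalForm.
Variables (R : realType) (d q : nat).
Local Notation C := (CC R).

Lemma col_mx_subl k1 k2 (B1 : 'M[C]_(k1, d)) (B2 : 'M[C]_(k2, d)) : (B1 <= col_mx B1 B2)%MS.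
Proof. by rewrite -addsmxE addsmxSl. Qed.

Lemma col_mx_subr k1 k2 (B1 : 'M[C]_(k1, d)) (B2 : 'M[C]_(k2, d)) : (B2 <= col_mx B1 B2)%MS.
Proof. by rewrite -addsmxE addsmxSr. Qed.

(** The dimensions are variables here because the construction finds them as numbers of rows; only
    afterwards are they identified with [s - r], [q - r] and [d - (s + p)], in one rewriting of this
    predicate. *)
Definition normalizes (f : 'rV[C]_d -> 'rV[C]_d) r e p t :=
  exists (Phi : 'rV[C]_d -> 'rV[C]_(r + e + p + t))
         (alpha : 'rV[C]_r) (sigma : 'S_r) (mu : 'rV[C]_e)
         (rho : 'I_e -> seq (poly_term R r e)) (beta : 'rV[C]_p)
         (Cm : 'M[nat]_(r, p)) (Dm : 'M[nat]_(p, p))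
         (g : 'rV[C]_(r + e + p + t) -> 'rV[C]_p)
         (h : 'rV[C]_(r + e + p + t) -> 'rV[C]_t),
    let B := perm_natmx sigma in
    let F := normal_form alpha B mu rho beta Cm Dm g h in
    let eta := #[sigma]%g in
    let xi := iter eta (fun u => hmul alpha (mono_map B u)) (const_mx 1) in
    [/\ biholo_germ Phi /\
        (\forall x \near (0 : 'rV[C]_d), Phi (f x) = F (Phi x)),
        (forall i, alpha 0 i != 0),
        (forall i, mu 0 i != 0 /\ `|mu 0 i| < 1),
        (forall j, beta 0 j != 0) &
     [/\ \prod_(k < e) ('X - (mu 0 k)%:P) %| char_poly (jac f 0),
        (holo_germ g /\ g 0 = 0) /\ (holo_germ h /\ h 0 = 0),
        (\forall x \near (0 : 'rV[C]_d),
            in_crit_inf f x <->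
            \prod_(i < r) blk_u (Phi x) 0 i * \prod_(j < p) blk_y (Phi x) 0 j = 0),
        (exists n : nat,
            jac (fun z : 'rV[C]_t => h (row_mx 0 z)) 0 ^+ n = 0) &
        (forall k : 'I_e, forall tm, tm \in rho k ->
            monom xi tm.1.1 * monom_pow mu eta tm.1.2 = mu 0 k ^+ eta)]].

Lemma normal_form_exists (f : 'rV[C]_d -> 'rV[C]_d) (phi : 'I_q -> 'rV[C]_d -> C) (A : 'I_q -> 'I_q -> nat) :
  contracting f -> rigid_with f phi -> pullback_matrix f phi A ->
  let s := (d - mup 0%R (char_poly (jac f 0)))%N in
  let r := #|[set k : 'I_q | `[< periodic_comp A k >] ]| in
  exists e p t, [/\ e = (s - r)%N, p = (q - r)%N & t = (d - (s + p))%N] /\ normalizes f r e p t.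
Proof.
move=> fcon rig pm s r.
have [f0 [hf hroot]] := fcon; have [[hphi _] crit] := rig.
have fG := transversal_row_free rig.1.
have /boolp.choice[c hc] : forall k, exists c : 'rV[C]_d -> C, [/\ holo_germ c, c 0 != 0 &
    \forall x \near (0 : 'rV[C]_d), phi k (f x) = c x * \prod_l phi l x ^+ A k l].
  exact: pullback_factorization hf f0 rig pm.
pose Per := [set k : 'I_q | `[< periodic_comp A k >] ].
have [iu [iu_inj iuP']] := @enum_family _ Per r erefl.
have [jy [jy_inj jyP']] := @enum_family _ (~: Per) _ erefl.
have iuP k : periodic_comp A k <-> exists i, k = iu i.
  by rewrite -iuP' inE; split=> /asboolP.
have jyP k : ~ periodic_comp A k <-> exists j, k = jy j.
  by rewrite -jyP' !inE; split=> [h|/asboolP //]; apply/asboolP.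
have cardP : (r + #|~: Per| = q)%N by rewrite cardsC card_ord.
(* The cardinal becomes a variable [p]; its value [q - r] is recovered from [cardP]. *)
move: (#|~: Per|) jy jy_inj jyP cardP {jyP'} => p jy jy_inj jyP cardP.
have [sigma hs] := next_perm f0 hphi hc iu_inj iuP.
have [X EX uX] := periodic_intertwine hf f0 hphi hc iuP hs.
have fUQ := components_free iu_inj jy_inj iuP jyP fG.
have fU : row_free (rowsub iu (grad phi)) := rowsub_free fG iu_inj.
have [e [mu [N [m [Q [[fB FB [Y uY EY]] hmu hQ dvd mup0]]]]]] := adapted_basis fU EX uX.
have [cc [th [rad fc]]] := contracting_contracts fcon.
have [a [ha Ea]] := periodic_coordinates hf f0 hphi hc iuP fc hs.
pose u i x := phi (iu i) x * a i x.
have hu i : holo_germ (u i) /\ ord 2 (fun x => u i x - rform (row i (rowsub iu (grad phi))) x).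
  have [h1 h2] := hphi (iu i); have [h3 h4] := ha i.
  split; first exact: holoM.
  by rewrite row_rowsub; apply: (first_order_product hf h1 h2 h3 h4); exact: (grad_first_order hf hphi).
pose alpha : 'rV[C]_r := \row_i c (iu i) 0.
have uf : \forall x \near (0 : 'rV[C]_d), forall i, u i (f x) = alpha 0 i * u (sigma i) x.
  by apply: near0S Ea => x E i; rewrite /u E mxE.
have [v [rho [hv Ev res]]] := resonant_block hf f0 fc FB hmu hQ hu uf.
have fS : row_free (col_mx (rowsub iu (grad phi)) N).
  apply: row_free0 => w w0; have : row_mx w 0 = 0 :> 'rV_(r + e + m).
    by apply: (row_freeE fB); rewrite mul_row_col w0 mul0mx addr0.
  by rewrite -row_mx0 => /eq_row_mx[].
have fW := transient_rows_free EX uX fS EY uY fUQ (transient_sub hf f0 hphi hc jy iuP).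
(* The [z] coordinates are any forms completing [du], [dv], [dy]. The rows [Q] of the adapted basis
   would not do: they need not be independent of the [dy]. *)
have [t [Z [fT FT]]] := complete_rows fW.
have [nn hnn] := mpow_sub_stable EY FB hQ.
have dB : (r + e + m = d)%N by rewrite -(eqP fB) (eqP FB).
have dT : (r + e + p + t = d)%N by rewrite -(eqP fT) (eqP FT).
have sE : s = (r + e)%N by rewrite /s -(char_poly_tr (jac f 0)) mup0 -dB addnK.
exists e, p, t; split.
  split; [by rewrite sE addKn | by rewrite -cardP addKn | by rewrite sE -{1}dT addKn].
have hy j : holo_germ (phi (jy j)) /\ ord 2 (fun x => phi (jy j) x - rform (row j (rowsub jy (grad phi))) x).
  by split; [exact: (hphi _).1 | rewrite row_rowsub; exact: (grad_first_order hf hphi)].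
have [hPu Pu0 fPu] := first_order_forms hu; have [hPv Pv0 fPv] := first_order_forms hv.
have [hPy Py0 fPy] := first_order_forms hy.
have hPz : holo_germ (fun x : 'rV[C]_d => x *m Z^T) := @holo_linear R d _ (mulmxr Z^T).
have hPhi := holo_row_mx (holo_row_mx (holo_row_mx hPu hPv) hPy) hPz.
have fPhi := first_order_row_mx (first_order_row_mx (first_order_row_mx fPu fPv) fPy) (first_order_lin Z^T).
move: hPhi fPhi; set Phi := (fun x => row_mx _ (x *m Z^T)) => hPhi fPhi.
have P0 : Phi 0 = 0 by rewrite /Phi Pu0 Pv0 Py0 mul0mx !row_mx0.
have bih := chart hPhi P0 fPhi fT FT.
have [_ [_ [Psi [S0 [hS [E1 E2]]]]]] := bih.
have [G' [fPsi KG GK]] := chart_inverse hPhi P0 fPhi hS S0 E1 E2.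
have a0 i : a i 0 != 0 by rewrite (ha i).2 oner_neq0.
(* The monomial in the pullback of [y] involves the [phi (iu i)], not the coordinates
   [u i = phi (iu i) * a i]; the units [a i] are moved into this factor. *)
pose un j x := c (jy j) x * \prod_i (a i x)^-1 ^+ A (jy j) (iu i).
have hun j : holo_germ (un j).
  apply: holoM; first by have [] := hc (jy j).
  by apply: holo_prod => i; apply: holoX; apply: holoV (a0 i); exact: (ha i).1.
have un0 j : un j 0 = c (jy j) 0.
  by rewrite /un big1 ?mulr1 // => i _; rewrite (ha i).2 invr1 expr1n.
have c0 k : c k 0 != 0 by have [] := hc k.
have nza : \forall x \near (0 : 'rV[C]_d), forall i, a i x != 0.
  apply: near_forall => i; have [b b0 hb] := holo_neq0 (ha i).1 (a0 i).
  by apply: near0S hb => x h; rewrite -nm_gt0; exact: lt_le_trans h.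
have phE : \forall x \near (0 : 'rV[C]_d), forall k, phi k (f x) = c k x * \prod_l phi l x ^+ A k l.
  by apply: near_forall => k; have [] := hc k.
(* The value of [un j] at 0 is [c (jy j) 0], since the [a i] equal 1 there; dividing by it gives
   [beta] as the constant and makes [g] vanish at 0. *)
pose g (w : 'rV[C]_(r + e + p + t)) : 'rV[C]_p := \row_j (un j (Psi w) * (c (jy j) 0)^-1 - 1).
pose h (w : 'rV[C]_(r + e + p + t)) : 'rV[C]_t := f (Psi w) *m Z^T.
have bu x : blk_u (Phi x) = \row_i u i x by rewrite /blk_u /Phi !row_mxKl.
have bv x : blk_v (Phi x) = \row_k v k x by rewrite /blk_v /Phi !row_mxKl row_mxKr.
have by_ x : blk_y (Phi x) = \row_j phi (jy j) x by rewrite /blk_y /Phi row_mxKl row_mxKr.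
exists Phi, alpha, sigma, (\row_k mu k), rho, (\row_j c (jy j) 0),
  (\matrix_(i, j) A (jy j) (iu i)), (\matrix_(l, j) A (jy j) (jy l)), g, h.
have dv : \prod_(k < e) ('X - ((\row_k mu k : 'rV[C]_e) 0 k)%:P) %| char_poly (jac f 0).
  by rewrite -(char_poly_tr (jac f 0)); under eq_bigr => k _ do rewrite mxE.
split; [split=> // | by move=> i; rewrite mxE | | by move=> j; rewrite mxE | split=> //].
- apply: near0S (near0I (near0I uf Ev) (near0I (near0I nza phE) E1)) => x [[Eu Evx] [[na Ep] Es]].
  rewrite /normal_form bu bv by_; congr (row_mx (row_mx (row_mx _ _) _) _).
  + by apply/rowP => i; rewrite perm_normal_form !mxE Eu mxE.
  + by apply/rowP => k; rewrite mxE Evx [RHS]mxE !mxE.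
  + apply/rowP => j; rewrite mxE Ep (prod_comps iu_inj jy_inj iuP jyP).
    have Eu' : \prod_i phi (iu i) x ^+ A (jy j) (iu i) =
        (\prod_i u i x ^+ A (jy j) (iu i)) * \prod_i (a i x)^-1 ^+ A (jy j) (iu i).
      rewrite -big_split /=; apply: eq_bigr => i _; rewrite -exprMn /u mulfK //.
    have Em : mono_map (\matrix_(i, j) A (jy j) (iu i)) (\row_i u i x) 0 j = \prod_i u i x ^+ A (jy j) (iu i).
      by rewrite mxE; apply: eq_bigr => i _; rewrite !mxE.
    have Ed : mono_map (\matrix_(l, j) A (jy j) (jy l)) (\row_j phi (jy j) x) 0 j =
        \prod_l phi (jy l) x ^+ A (jy j) (jy l).
      by rewrite mxE; apply: eq_bigr => l _; rewrite !mxE.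
    have Eg : (const_mx 1 + g (Phi x)) 0 j = un j x * (c (jy j) 0)^-1.
      by rewrite !mxE Es addrC subrK.
    have hE (v1 v2 : 'rV[C]_p) : hmul v1 v2 0 j = v1 0 j * v2 0 j by rewrite mxE.
    rewrite !hE Em Ed Eg Eu' mxE /un.
    move: (\prod_i u i x ^+ _) (\prod_i (a i x)^-1 ^+ _) (\prod_l phi (jy l) x ^+ _) (c (jy j) x) (c0 (jy j)) => z1 z2 z3 z4.
    by move: (c (jy j) 0) => z5 z50; field.
  + by rewrite /h Es.
- move=> k; rewrite mxE; split; first exact: (hmu k).1.
  apply: hroot; move: dv; rewrite (bigD1 k) //= mxE => dv; move: (dvdp_trans (dvdp_mulr _ (dvdpp _)) dv).
  by rewrite dvdp_XsubCl.
- split; split.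
  + apply: holo_row => j; rewrite (_ : (fun x => _) = (fun w => un j (Psi w) * (c (jy j) 0)^-1 - 1)); last first.
      by apply/funext => w; rewrite mxE.
    apply: holoB; last exact: holo_cst.
    by apply: holoM; [exact: (holo_comp (hun j) hS S0) | exact: holo_cst].
  + by apply/rowP => j; rewrite !mxE S0 un0 mulfV ?subrr.
  + have z0 : f (Psi 0) = 0 by rewrite S0 f0.
    exact: (holo_comp hPz (holo_comp hf hS S0) z0).
  + by rewrite /h S0 f0 mul0mx.
(* Near 0 the [a i] do not vanish, so the product of the [u i] and [y j] has the same zeros as the
   product of all the [phi k]. *)
- apply: near0S (near0I crit nza) => x [-> na]; rewrite bu by_.
  under eq_bigr => i _ do rewrite mxE; under [X in _ * X]eq_bigr => i _ do rewrite mxE.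
  rewrite big_split /=; split=> [[k pk]|/eqP].
    have z : \prod_k phi k x = 0 by rewrite (bigD1 k) //= pk mul0r.
    move: z; rewrite (prod_comps iu_inj jy_inj iuP jyP) => z.
    by rewrite mulrAC z mul0r.
  rewrite mulrAC mulf_eq0 => /orP[/eqP|/prodf_eq0[i _]]; last by rewrite (negPf (na i)).
  rewrite -(prod_comps iu_inj jy_inj iuP jyP (phi^~ x)) => /eqP/prodf_eq0[k _ /eqP pk]; by exists k.
- exists nn; apply: (nilpotent_transversal hS S0 fPsi hf f0).
  have := nilpotent_block hnn _ KG GK; rewrite trmxK; apply.
  have := components_stable hf f0 hphi hc iuP jyP; rewrite [X in (X <= _)%MS]mul_col_mx col_mx_sub => /andP[_ st].
  rewrite [X in (X <= _)%MS]mul_col_mx EY col_mx_sub; apply/andP; split.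
    by apply: submx_trans (submxMl _ _) _; exact: col_mx_subl.
  apply: (submx_trans st); rewrite col_mx_sub; apply/andP; split; last exact: col_mx_subr.
  by apply: submx_trans (col_mx_subl _ _); exact: col_mx_subl.
- by move=> k tm htm; rewrite [in RHS]mxE; exact: res.
Qed.

End NormalForm.

Theorem mainTheorem4 (R : realType) (d q : nat)
    (f : 'rV[CC R]_d -> 'rV[CC R]_d)
    (phi : 'I_q -> 'rV[CC R]_d -> CC R)
    (A : 'I_q -> 'I_q -> nat) :
  contracting f ->
  rigid_with f phi ->
  pullback_matrix f phi A ->
  let s := (d - mup 0 (char_poly (jac f 0)))%N in
  let r := #|[set k : 'I_q | `[< periodic_comp A k >] ]| in
  let p := (q - r)%N in
  let e := (s - r)%N in
  let t := (d - (s + p))%N in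
  exists (Phi : 'rV[CC R]_d -> 'rV[CC R]_(r + e + p + t))
         (alpha : 'rV[CC R]_r) (sigma : 'S_r) (mu : 'rV[CC R]_e)
         (rho : 'I_e -> seq (poly_term R r e)) (beta : 'rV[CC R]_p)
         (Cm : 'M[nat]_(r, p)) (Dm : 'M[nat]_(p, p))
         (g : 'rV[CC R]_(r + e + p + t) -> 'rV[CC R]_p)
         (h : 'rV[CC R]_(r + e + p + t) -> 'rV[CC R]_t),
    let B := perm_natmx sigma in
    let F := normal_form alpha B mu rho beta Cm Dm g h in
    let eta := #[sigma]%g in
    let xi := iter eta (fun u => hmul alpha (mono_map B u)) (const_mx 1) in
    [/\ biholo_germ Phi /\
        (\forall x \near (0 : 'rV[CC R]_d), Phi (f x) = F (Phi x)),
        (forall i, alpha 0 i != 0),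
        (forall i, mu 0 i != 0 /\ `|mu 0 i| < 1),
        (forall j, beta 0 j != 0) &
     [/\ \prod_(k < e) ('X - (mu 0 k)%:P) %| char_poly (jac f 0),
        (holo_germ g /\ g 0 = 0) /\ (holo_germ h /\ h 0 = 0),
        (\forall x \near (0 : 'rV[CC R]_d),
            in_crit_inf f x <->
            \prod_(i < r) blk_u (Phi x) 0 i * \prod_(j < p) blk_y (Phi x) 0 j = 0),
        (exists n : nat,
            jac (fun z : 'rV[CC R]_t => h (row_mx 0 z)) 0 ^+ n = 0) &
        (forall k : 'I_e, forall tm, tm \in rho k ->
            monom xi tm.1.1 * monom_pow mu eta tm.1.2 = mu 0 k ^+ eta)]].
Proof.
move=> fcon rig pm s r p e t.
have [e' [p' [t' [[Ee Ep Et] H]]]] := normal_form_exists fcon rig pm.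
by rewrite Et Ep Ee in H; exact: H.
Qed.
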